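(* Let $p\in\{3,5\}$ and let $k$ be an algebraically closed field of characteristic $p$. For every positive integer $d$ with $p\nmid d$, there exists a polynomial $f\in \mathbb{F}_p[x]$ of degree $d$ such that the Artin–Schreier curve $Y_f$ has $a$-number equal to $$L(\{d\})=\max_{1\le j\le p-1}\sum_{i=j}^{p-1}\left(\left\lfloor \frac{id}{p}\right\rfloor - \left\lfloor \frac{id}{p}-\left(1-\frac1p\right)\frac{jd}{p}\right\rfloor\right).$$ Consequently $a(d)=L(\{d\})$.
   Context: For $f\in k[x]$, $Y_f$ denotes the smooth projective connected curve over $k$ with affine equation $y^p-y=f$; it is a $\mathbb{Z}/p\mathbb{Z}$-cover of $\mathbb{P}^1$ branched only at $\infty$, and when $p\nmid \deg f$ its ramification invariant (lower-numbering ramification break) at $\infty$ is $\deg f$. The $a$-number of a curve $Z$ over $k$ is $\dim_k\operatorname{Hom}(\alpha_p,\operatorname{Jac}(Z)[p])$, equivalently the dimension of the kernel of the Cartier operator on regular differentials of $Z$. For a positive integer $d$ with $p\nmid d$, $a(d)$ denotes the minimal $a$-number of a curve over $k$ admitting a $\mathbb{Z}/p\mathbb{Z}$-cover of $\mathbb{P}^1$ branched at exactly one point with ramification invariant $d$. *)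

(* Defs.v *)
From HB Require Import structures.
From mathcomp Require Import all_boot all_order all_algebra all_fingroup all_field.
From mathcomp Require Import fraction.
Set Implicit Arguments.
Unset Strict Implicit.
Unset Printing Implicit Defensive.
Import Order.TTheory GRing.Theory Num.Theory.
Local Open Scope ring_scope.

(* A smooth projective connected curve over an algebraically closed field k is
   represented by its function field F, with structure map c : k -> F; finite
   morphisms of curves are finite extensions of function fields. *)

Section Curve.
Variables (k F : fieldType) (c : {rmorphism k -> F}).

(* Closed points of the curve: normalized discrete valuations of F that are
   trivial on k. The value of pval at 0 carries no meaning. *)
Record place := Place {
  pval :> F -> int;
  pvalM : forall a b, a != 0 -> b != 0 -> pval (a * b) = pval a + pval b;
  pvalD : forall a b, a != 0 -> b != 0 -> a + b != 0 ->
    Num.min (pval a) (pval b) <= pval (a + b);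
  pval_const : forall z, z != 0 -> pval (c z) = 0;
  pval_uniformizer : exists2 t, t != 0 & pval t = 1
}.

Definition same_place (v w : place) : Prop := forall a, a != 0 -> v a = w a.

(* v a >= n, with the convention v 0 = +oo *)
Definition vge (v : place) (n : int) (a : F) : bool := (a == 0) || (n <= v a).

Record derivation (M : lmodType F) (D : F -> M) : Prop := Derivation {
  derivationD : forall a b, D (a + b) = D a + D b;
  derivationM : forall a b, D (a * b) = a *: D b + b *: D a;
  derivation_const : forall z, D (c z) = 0
}.

Definition kaehler (Om : lmodType F) (d : F -> Om) : Prop :=
  derivation d /\
  forall (M : lmodType F) (D : F -> M), derivation D ->
    exists2 phi : {linear Om -> M}, (forall a, D a = phi (d a)) &
      forall psi : {linear Om -> M}, (forall a, D a = psi (d a)) -> psi =1 phi.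

Section Differentials.
Variables (Om : lmodType F) (d : F -> Om).

(* om = g dt with t a uniformizer at v and g in the local ring at v *)
Definition regular_at (v : place) (om : Om) : Prop :=
  exists t g, [/\ t != 0, v t = 1, vge v 0 g & om = g *: d t].

Definition regular (om : Om) : Prop := forall v : place, regular_at v om.

(* In characteristic p these properties characterize the Cartier operator on
   the differentials of F / k (Cartier's theorem). *)
Record cartier (p : nat) (C : Om -> Om) : Prop := Cartier {
  cartierD : forall om om', C (om + om') = C om + C om';
  cartierZ : forall a om, C (a ^+ p *: om) = a *: C om;
  cartier_exact : forall a, C (d a) = 0;
  cartier_log : forall a, C (a ^+ p.-1 *: d a) = d a
}.

(* e is a k-basis of S, k acting on Om through c *)
Definition basis_over_k (n : nat) (S : Om -> Prop) (e : 'I_n -> Om) : Prop :=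
  [/\ forall i, S (e i),
      forall z : 'I_n -> k, \sum_i c (z i) *: e i = 0 -> forall i, z i = 0 &
      forall om, S om -> exists z : 'I_n -> k, om = \sum_i c (z i) *: e i].

End Differentials.

Definition a_number (p n : nat) : Prop :=
  exists (Om : lmodType F) (d : F -> Om) (C : Om -> Om) (e : 'I_n -> Om),
    [/\ kaehler d, cartier d p C &
        basis_over_k (fun om => regular d om /\ C om = 0) e].

End Curve.

Section Covers.
Variable k : fieldType.

Definition P1 : fieldType := {fraction {poly k}}.

Definition P1_const : {rmorphism k -> P1} := @tofrac {poly k} \o polyC.

Section Cover.
Variable Y : fieldExtType P1.

Definition cover_const : {rmorphism k -> Y} := in_alg Y \o P1_const.

(* v lies over w with ramification index e *)
Definition lies_over (e : nat) (v : place cover_const) (w : place P1_const) :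
    Prop :=
  (0 < e)%N /\ forall b : P1, b != 0 -> v b%:A = e%:Z * w b.

Definition branch_point (w : place P1_const) : Prop :=
  exists (e : nat) (v : place cover_const), lies_over e v w /\ (1 < e)%N.

End Cover.

(* s belongs to the i-th ramification group at v, in lower numbering *)
Definition lower_ramification (Y : splittingFieldType P1)
    (v : place (cover_const Y)) (i : nat) (s : gal_of {:Y}) : Prop :=
  s \in 'Gal({:Y} / 1%VS)%g /\ forall a : Y, vge v 0 a -> vge v i.+1%:Z (s a - a).

Definition ramification_break (Y : splittingFieldType P1)
    (v : place (cover_const Y)) (i : nat) : Prop :=
  (exists2 s, lower_ramification v i s & s != 1%g) /\
  (forall s, lower_ramification v i.+1 s -> s = 1%g).

Definition Zp_cover (p : nat) (Y : splittingFieldType P1) : Prop :=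
  galois 1 {:Y} /\ 'Gal({:Y} / 1%VS)%g \isog Zp p.

Definition one_branch_point (d : nat) (Y : splittingFieldType P1) : Prop :=
  exists w : place P1_const,
    [/\ branch_point Y w,
        forall w', branch_point Y w' -> same_place w' w &
        forall e (v : place (cover_const Y)),
          lies_over e v w -> ramification_break v d].

(* n = a(d) *)
Definition minimal_a_number (p d n : nat) : Prop :=
  (exists Y : splittingFieldType P1,
    [/\ Zp_cover p Y, one_branch_point d Y & a_number (cover_const Y) p n]) /\
  (forall (Y : splittingFieldType P1) (m : nat),
    Zp_cover p Y -> one_branch_point d Y -> a_number (cover_const Y) p m ->
    (n <= m)%N).

(* Y is the function field of y^p - y = f; the degree condition says that this
   equation is irreducible over k(x). *)
Definition artin_schreier_curve (p : nat) (f : {poly k})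
    (Y : fieldExtType P1) : Prop :=
  \dim {:Y} = p /\
  exists y : Y, y ^+ p - y = (tofrac f)%:A /\ <<1; y>>%VS = fullv.

(* The image in k[x] of a polynomial over F_p (p the characteristic of k). *)
Definition from_Fp (p : nat) (f : {poly 'F_p}) : {poly k} :=
  map_poly (fun a : 'F_p => (a : nat)%:R) f.

End Covers.

(* Every inner sum is nonnegative, so starting the maximum at 0 is harmless. *)
Definition L_bound (p d : nat) : int :=
  \big[Num.max/0]_(1 <= j < p) \sum_(j <= i < p)
    (Num.floor ((i * d)%:R / p%:R : rat) -
     Num.floor ((i * d)%:R / p%:R
                - (1 - 1 / p%:R) * ((j * d)%:R / p%:R) : rat)).

(* Main.v *)
(* On Y : y^p - y = f with deg f = d the regular differentials are the
   sum_i g_i(x) y^i dx with p deg g_i + p <= (p-1-i) d (for g_i <> 0).  Expanding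
   y = y^p - f, such a form is killed by the Cartier operator iff, for all l, the
   coefficients at X^(pn+p-1) of sum_i C(i,l) (-f)^(i-l) g_i vanish, so the
   a-number is the nullity of an explicit matrix.  Dropping all the layers
   i > p-1-j leaves so few conditions that the nullity is at least the j-th term
   of L({d}).  Conversely a Z/p-cover of P^1 with a single branch point of
   ramification break d is, in a coordinate with its pole at that point, given by
   a polynomial of degree d.  For p = 3, 5 the maximum over j is attained at
   j = (p+1)/2 and is reached by X^d + X^s (+ X^t) for suitable s = (p+1)d/(2p)
   + O(1) with s = (p+1)d/2 mod p: the conditions with at most two or three terms
   determine the top layers, which vanish, and enough coefficients of the others. *)
From HB Require Import structures.
Require Import Defs.
From mathcomp Require Import all_boot all_order all_algebra all_fingroup all_field.
From mathcomp Require Import fraction generic_quotient cyclic zify ring.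
From Stdlib Require Import Classical ClassicalEpsilon.
Set Implicit Arguments.
Unset Strict Implicit.
Unset Printing Implicit Defensive.
Import Order.TTheory GRing.Theory Num.Theory.
Local Open Scope ring_scope.

(** The a-number refers to all places and to an arbitrary model of the differentials, so both have
    to be produced. Places of Y are built by hand: above a pole of f of order n prime to p by giving
    g y^i the weight p w(g) - n i, at the other points as limits of places of k(x). The former give
    the place at infinity and show that such poles are branch points; the latter force the
    coefficients of a regular form to be polynomials. Since the branch point of a given cover may be
    finite, the lower bound is stated for a coordinate tau, which is x or 1/(x - a); it uses only
    that forms of the right degree are regular, not that they exhaust the regular forms. The Cartier
    operator is constructed for p = 3, 5, where ((a + b)^p - a^p - b^p)/p is written out to reduce
    its value on a^(p-1) da to monomials. The congruence on s makes 0, d, s (for p = 3) or 0, d, 2d,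
    s, d + s (for p = 5) run through all residues mod p, so that every coefficient of an upper layer
    is aimed at by some condition. *)

(** * Valuations *)

Section PlaceTheory.
Variables (k F : fieldType) (c : {rmorphism k -> F}) (v : place c).
Implicit Types (a b : F) (m n : int).

Lemma pval1 : v 1 = 0.
Proof. by rewrite -(rmorph1 c) pval_const // oner_neq0. Qed.

Lemma pvalN a : a != 0 -> v (- a) = v a.
Proof.
move=> a0; rewrite -mulN1r pvalM ?oppr_eq0 ?oner_neq0 //.
by rewrite -(rmorph1 c) -rmorphN pval_const ?add0r // oppr_eq0 oner_neq0.
Qed.

Lemma pvalX a (n : nat) : a != 0 -> v (a ^+ n) = n%:Z * v a.
Proof.
move=> a0; elim: n => [|n IH]; first by rewrite expr0 pval1 mul0r.
by rewrite exprS pvalM ?expf_neq0 // IH; lia.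
Qed.

Lemma pvalV a : a != 0 -> v a^-1 = - v a.
Proof.
move=> a0; have: v (a * a^-1) = 0 by rewrite divff // pval1.
by rewrite pvalM ?invr_eq0 //; lia.
Qed.

Lemma pval_div a b : a != 0 -> b != 0 -> v (a / b) = v a - v b.
Proof. by move=> a0 b0; rewrite pvalM ?invr_eq0 // pvalV. Qed.

Lemma vgeE n a : a != 0 -> vge v n a = (n <= v a).
Proof. by rewrite /vge => /negPf->. Qed.

Lemma vge_0 n : vge v n 0.
Proof. by rewrite /vge eqxx. Qed.

Lemma vge_self a : vge v (v a) a.
Proof. by rewrite /vge lexx orbT. Qed.

Lemma vgeW m n a : m <= n -> vge v n a -> vge v m a.
Proof. by rewrite /vge => mn /orP[->//|na]; rewrite (le_trans mn na) orbT. Qed.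

Lemma vgeD n a b : vge v n a -> vge v n b -> vge v n (a + b).
Proof.
rewrite /vge; have [->|a0] /= := eqVneq a 0; first by rewrite add0r.
have [->|b0] /= := eqVneq b 0; first by rewrite addr0 (negPf a0).
have [//|s0] /= := eqVneq (a + b) 0 => na nb.
by apply: le_trans (pvalD v a0 b0 s0); rewrite le_min na nb.
Qed.

Lemma vgeN n a : vge v n (- a) = vge v n a.
Proof.
rewrite /vge oppr_eq0; have [//|a0] /= := eqVneq a 0; by rewrite pvalN.
Qed.

Lemma vgeB n a b : vge v n a -> vge v n b -> vge v n (a - b).
Proof. by move=> na nb; apply: vgeD; rewrite ?vgeN. Qed.

Lemma vgeM m n a b : vge v m a -> vge v n b -> vge v (m + n) (a * b).
Proof.
rewrite /vge mulf_eq0; have [//|a0] /= := eqVneq a 0.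
have [//|b0] /= := eqVneq b 0; rewrite pvalM //; lia.
Qed.

Lemma vge_sum (I : Type) (r : seq I) (P : pred I) (E : I -> F) n :
  (forall i, P i -> vge v n (E i)) -> vge v n (\sum_(i <- r | P i) E i).
Proof.
by move=> h; elim/big_ind: _ => //; [exact: vge_0 | move=> ? ?; exact: vgeD].
Qed.

Lemma vge_const n z : n <= 0 -> vge v n (c z).
Proof.
move=> n0; have [->|z0] := eqVneq z 0; first by rewrite rmorph0 vge_0.
by rewrite vgeE ?fmorph_eq0 // pval_const.
Qed.

Lemma vge0M a b : vge v 0 a -> vge v 0 b -> vge v 0 (a * b).
Proof. by move=> ha hb; rewrite -[0]addr0; apply: vgeM. Qed.

Lemma vge0X a (n : nat) : vge v 0 a -> vge v 0 (a ^+ n).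
Proof.
move=> ha; elim: n => [|n IH]; last by rewrite exprS vge0M.
by rewrite expr0 vgeE ?oner_neq0 // pval1.
Qed.

(** Nonvanishing of the sum belongs to the conclusion because the value of a place at 0 carries no
    meaning; a + b = 0 would give a and b the same value. *)
Lemma pval_addl a b : a != 0 -> vge v (v a + 1) b ->
  a + b != 0 /\ v (a + b) = v a.
Proof.
move=> a0; rewrite /vge; have [->|b0] /= := eqVneq b 0; first by rewrite addr0.
move=> ab; have s0 : a + b != 0.
  apply/negP => /eqP/eqP; rewrite addr_eq0 => /eqP e.
  by move: ab; rewrite e pvalN //; lia.
split=> //; apply: le_anti; apply/andP; split; last first.
  by apply: le_trans (pvalD v a0 b0 s0); rewrite le_min lexx /= ltW // -lezD1.
rewrite leNgt; apply/negP => lt_as.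
have: vge v (v a + 1) a.
  rewrite -{2}(addrK b a); apply: vgeB; first by rewrite vgeE // lezD1.
  by rewrite vgeE.
by rewrite vgeE // lezD1 ltxx.
Qed.

(* A sum of terms of pairwise distinct values has the least value. *)
Lemma vge_sum_distinct (I : finType) (E : I -> F) n :
  (forall i j, i != j -> E i != 0 -> E j != 0 -> v (E i) != v (E j)) ->
  vge v n (\sum_i E i) -> forall i, vge v n (E i).
Proof.
move=> dist hs i; have [->|Ei] := eqVneq (E i) 0; first exact: vge_0.
case: (@arg_minP _ _ _ i (fun j => E j != 0) (fun j => v (E j)) Ei) => j Ej jmin.
have hj : vge v (v (E j) + 1) (\sum_(l | l != j) E l).
  apply: vge_sum => l lj; rewrite /vge; have [//|El] /= := eqVneq (E l) 0.
  rewrite lezD1 lt_neqAle eq_sym dist //=; exact: jmin.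
move: hs; rewrite (bigD1 j) //=; have [s0 sv] := pval_addl Ej hj.
rewrite vgeE // sv vgeE // => /le_trans; apply; exact: jmin.
Qed.

Lemma sum_distinct_val (I : finType) (E : I -> F) :
  (forall i j, i != j -> E i != 0 -> E j != 0 -> v (E i) != v (E j)) ->
  \sum_i E i != 0 -> exists2 i, E i != 0 & v (\sum_i E i) = v (E i).
Proof.
move=> dist s0.
have [i Ei] : exists i, E i != 0.
  apply/existsP; apply: contraNT s0; rewrite negb_exists => /forallP h.
  by rewrite big1 // => i _; apply/eqP; move: (h i); rewrite negbK.
case: (@arg_minP _ _ _ i (fun j => E j != 0) (fun j => v (E j)) Ei) => j Ej jmin.
have hj : vge v (v (E j) + 1) (\sum_(l | l != j) E l).
  apply: vge_sum => l lj; rewrite /vge; have [//|El] /= := eqVneq (E l) 0.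
  rewrite lezD1 lt_neqAle eq_sym dist //=; exact: jmin.
by exists j => //; rewrite (bigD1 j) //=; have [_ ->] := pval_addl Ej hj.
Qed.

End PlaceTheory.

Section FracField.
Variable R : idomainType.

Lemma fracP (b : {fraction R}) :
  exists n m : R, m != 0 /\ b = tofrac n / tofrac m.
Proof.
pose x := repr b; exists (frac x).1, (frac x).2; split; first exact: denom_ratioP.
apply: (canRL (mulfK _)); first by rewrite tofrac_eq0 denom_ratioP.
rewrite -[b]reprK -/x /tofrac; unlock FracField.tofrac.
rewrite !piE; apply/eqmodP; rewrite /= FracField.equivfE /FracField.mulf.
by rewrite !numden_Ratio ?mulf_neq0 ?oner_neq0 ?denom_ratioP // !mulr1 mulrC.
Qed.
End FracField.

(** * Extension of a valuation from k[x] to k(x) *)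

Section PlaceOfPoly.
Variables (k : fieldType) (u : {poly k} -> int).
Hypothesis uM : forall n m, n != 0 -> m != 0 -> u (n * m) = u n + u m.
Hypothesis uD : forall z n m, n != 0 -> m != 0 -> n + m != 0 ->
  z <= u n -> z <= u m -> z <= u (n + m).
Hypothesis uC : forall z, z != 0 -> u z%:P = 0.
Hypothesis u_unif : exists n m, [/\ n != 0, m != 0 & u n - u m = 1].

Let fracPb (b : P1 k) : exists nm : {poly k} * {poly k},
  (nm.2 != 0) && (b == tofrac nm.1 / tofrac nm.2).
Proof. by have [n [m [m0 ->]]] := fracP b; exists (n, m); rewrite m0 eqxx. Qed.

Definition frac_val (b : P1 k) : int :=
  let nm := xchoose (fracPb b) in u nm.1 - u nm.2.

Lemma frac_valE n m : n != 0 -> m != 0 ->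
  frac_val (tofrac n / tofrac m) = u n - u m.
Proof.
move=> n0 m0; rewrite /frac_val.
case/andP: (xchooseP (fracPb (tofrac n / tofrac m))).
case: (xchoose _) => n' m' /= m'0.
rewrite eqr_div ?tofrac_eq0 // -!tofracM tofrac_eq => /eqP e.
have n'0 : n' != 0.
  apply: contraTneq (mulf_neq0 n0 m'0) => n'0.
  by rewrite e n'0 mul0r eqxx.
by have := congr1 u e; rewrite !uM //; lia.
Qed.

Lemma frac_nz (b : P1 k) : b != 0 ->
  exists n m : {poly k}, [/\ n != 0, m != 0 & b = tofrac n / tofrac m].
Proof.
have [n [m [m0 ->]]] := fracP b => h; exists n, m; split=> //.
by apply: contraNneq h => ->; rewrite rmorph0 mul0r.
Qed.

Let frac_valM (a b : P1 k) : a != 0 -> b != 0 ->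
  frac_val (a * b) = frac_val a + frac_val b.
Proof.
move=> /frac_nz[n [m [n0 m0 ->]]] /frac_nz[n' [m' [n'0 m'0 ->]]].
by rewrite mulf_div -!tofracM !frac_valE ?mulf_neq0 // !uM //; lia.
Qed.

Let frac_valD (a b : P1 k) : a != 0 -> b != 0 -> a + b != 0 ->
  Num.min (frac_val a) (frac_val b) <= frac_val (a + b).
Proof.
move=> /frac_nz[n [m [n0 m0 ->]]] /frac_nz[n' [m' [n'0 m'0 ->]]].
rewrite addf_div ?tofrac_eq0 // -!tofracM -tofracD => h.
have s0 : n * m' + n' * m != 0 by apply: contraNneq h => ->; rewrite rmorph0 mul0r.
rewrite !frac_valE ?mulf_neq0 // (uM m0) //.
rewrite lerBrDr; apply: uD; rewrite ?mulf_neq0 // !uM // -lerBrDr ge_min.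
  by apply/orP; left; lia.
by apply/orP; right; lia.
Qed.

Let frac_valC z : z != 0 -> frac_val (P1_const k z) = 0.
Proof.
move=> z0; rewrite -[P1_const k z]divr1 -tofrac1.
by rewrite frac_valE ?polyC_eq0 ?oner_neq0 // !uC ?oner_neq0.
Qed.

Let frac_val_unif : exists2 t, t != 0 & frac_val t = 1.
Proof.
have [n [m [n0 m0 e]]] := u_unif; exists (tofrac n / tofrac m).
  by rewrite mulf_neq0 ?invr_eq0 ?tofrac_eq0.
by rewrite frac_valE.
Qed.

Definition place_of_poly : place (P1_const k) :=
  Place frac_valM frac_valD frac_valC frac_val_unif.

End PlaceOfPoly.

(** * The valuations of k(x) at a point and at infinity *)

Section PlacesP1.
Variable k : fieldType.

Lemma mup_add z (a : k) n m : n != 0 -> m != 0 -> n + m != 0 ->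
  z <= (mup a n)%:Z -> z <= (mup a m)%:Z -> z <= (mup a (n + m))%:Z.
Proof.
case: z => // z n0 m0 s0; rewrite !lez_nat !mup_geq // => hn hm.
exact: dvdp_add.
Qed.

Lemma mup_const (a z : k) : z != 0 -> (mup a z%:P)%:Z = 0.
Proof. by move=> z0; rewrite mupNroot // rootC. Qed.

Lemma mup_mulz (a : k) n m : n != 0 -> m != 0 ->
  (mup a (n * m))%:Z = (mup a n)%:Z + (mup a m)%:Z.
Proof. by move=> n0 m0; rewrite mupM // PoszD. Qed.

Lemma mup_unif (a : k) : exists n m : {poly k},
  [/\ n != 0, m != 0 & (mup a n)%:Z - (mup a m)%:Z = 1].
Proof.
exists ('X - a%:P), 1; rewrite polyXsubC_eq0 oner_neq0; split=> //.
by rewrite -['X - _]expr1 mup_XsubCX eqxx -polyC1 mup_const ?oner_neq0.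
Qed.

Definition ord_place (a : k) : place (P1_const k) :=
  place_of_poly (@mup_mulz a) (fun z => @mup_add z a) (@mup_const a) (mup_unif a).

Lemma ord_placeE a n m : n != 0 -> m != 0 ->
  ord_place a (tofrac n / tofrac m) = (mup a n)%:Z - (mup a m)%:Z.
Proof. by move=> n0 m0; apply: frac_valE => //; apply: mup_mulz. Qed.

Definition degz (n : {poly k}) : int := - ((size n).-1)%:Z.

Lemma degz_mul n m : n != 0 -> m != 0 -> degz (n * m) = degz n + degz m.
Proof.
move=> n0 m0; rewrite /degz size_mul //.
by move: n0 m0; rewrite -!size_poly_gt0; case: (size n) (size m) => // i [] // j _ _; lia.
Qed.

Lemma degz_add z n m : n != 0 -> m != 0 -> n + m != 0 ->
  z <= degz n -> z <= degz m -> z <= degz (n + m).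
Proof.
rewrite -!size_poly_gt0 /degz => n0 m0 s0 hn hm.
move: n0 m0 s0 hn hm (size_polyD n m).
move: (size n) (size m) (size (n + m)%R) => i j l; rewrite leq_max.
by move=> ? ? ? ? ? /orP[]; lia.
Qed.

Lemma degz_const (z : k) : z != 0 -> degz z%:P = 0.
Proof. by move=> z0; rewrite /degz size_polyC z0. Qed.

Lemma degz_unif : exists n m : {poly k}, [/\ n != 0, m != 0 & degz n - degz m = 1].
Proof.
exists 1, 'X; rewrite oner_neq0 polyX_eq0; split=> //.
by rewrite /degz size_poly1 size_polyX.
Qed.

Definition deg_place : place (P1_const k) :=
  place_of_poly degz_mul degz_add degz_const degz_unif.

Lemma deg_placeE n m : n != 0 -> m != 0 ->
  deg_place (tofrac n / tofrac m) = degz n - degz m.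
Proof. by move=> n0 m0; apply: frac_valE => //; apply: degz_mul. Qed.

End PlacesP1.

(** * Places of the projective line *)

Section EvalAt.
Variables (k F : fieldType) (c : {rmorphism k -> F}) (t : F).

(** Substitution of an arbitrary element for the variable, so that one set of lemmas covers x and
    1/(x - a), both in k(x) and in Y. *)
Definition evt (h : {poly k}) : F := (map_poly c h).[t].

Lemma evt_is_zmod : zmod_morphism evt.
Proof. by move=> g h; rewrite /evt rmorphB hornerD hornerN. Qed.
Lemma evt_is_monoid : monoid_morphism evt.
Proof. by split=> [|g h]; rewrite /evt ?rmorph1 ?hornerC // rmorphM hornerM. Qed.
HB.instance Definition _ := GRing.isZmodMorphism.Build {poly k} F evt evt_is_zmod.
HB.instance Definition _ := GRing.isMonoidMorphism.Build {poly k} F evt evt_is_monoid.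

Lemma evtC z : evt z%:P = c z.
Proof. by rewrite /evt map_polyC hornerC. Qed.

Lemma evtX : evt 'X = t.
Proof. by rewrite /evt map_polyX hornerX. Qed.

Lemma evtZ z h : evt (z *: h) = c z * evt h.
Proof. by rewrite -mul_polyC rmorphM /= evtC. Qed.

Lemma evtE h : evt h = \sum_(i < size h) c h`_i * t ^+ i.
Proof. by rewrite /evt horner_poly; apply: eq_bigr => i _. Qed.

Variable v : place c.

Lemma vge_evt h : vge v 0 t -> vge v 0 (evt h).
Proof.
move=> t0; rewrite evtE; apply: vge_sum => i _.
by apply: vge0M; [apply: vge_const | apply: vge0X].
Qed.

Lemma val_evt_unit h a : vge v 1 (t - c a) -> ~~ root h a ->
  evt h != 0 /\ v (evt h) = 0.
Proof.
move=> ta ha; have t0 : vge v 0 t.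
  rewrite -(subrK (c a) t); apply: vgeD; last exact: vge_const.
  exact: vgeW ta.
have /factor_theorem[q e] : root (h - h.[a]%:P) a.
  by rewrite rootE hornerD hornerN hornerC subrr.
have -> : evt h = c h.[a] + evt q * (t - c a).
  have := congr1 evt e; rewrite rmorphB rmorphM rmorphB /= !evtC evtX => <-.
  by rewrite addrC subrK.
have ha0 : c h.[a] != 0 by rewrite fmorph_eq0.
have va : v (c h.[a]) = 0 by rewrite pval_const.
rewrite -va; apply: pval_addl => //; rewrite va.
by apply: vgeM ta; apply: vge_evt.
Qed.

Lemma val_evt_pos h a : t - c a != 0 -> 0 < v (t - c a) -> h != 0 ->
  evt h != 0 /\ v (evt h) = (mup a h)%:Z * v (t - c a).
Proof.
move=> ta0 ta h0; have [m [q]] := multiplicity_XsubC h a.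
rewrite h0 /= => qa ->; have ta1 : vge v 1 (t - c a) by rewrite vgeE.
have [q0 vq] := val_evt_unit ta1 qa.
have eX : evt ('X - a%:P) = t - c a by rewrite rmorphB /= evtX evtC.
rewrite rmorphM rmorphXn /= eX mulf_neq0 ?expf_neq0 //; split=> //.
by rewrite pvalM ?expf_neq0 // vq add0r pvalX // mupMr // mup_XsubCX eqxx.
Qed.

Lemma val_evt_neg h : t != 0 -> v t < 0 -> h != 0 ->
  evt h != 0 /\ v (evt h) = (size h).-1%:Z * v t.
Proof.
move=> t0 vt; elim/poly_ind: h => [|h z IH]; first by rewrite eqxx.
have [->|h0 _] := eqVneq h 0.
  rewrite mul0r add0r polyC_eq0 => z0.
  by rewrite evtC fmorph_eq0 pval_const // size_polyC z0 mul0r.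
have [e0 ve] := IH h0; rewrite rmorphD rmorphM /= evtC evtX.
have vet : v (evt h * t) = (size h)%:Z * v t.
  rewrite pvalM // ve; have := h0; rewrite -size_poly_gt0.
  by case: (size h) => // i _; lia.
have lead : vge v (v (evt h * t) + 1) (c z).
  apply: vge_const; rewrite vet; have := h0; rewrite -size_poly_gt0.
  by case: (size h) => // i _; nia.
have [s0 sv] := pval_addl (mulf_neq0 e0 t0) lead.
by rewrite s0 sv vet size_MXaddC (negPf h0).
Qed.

End EvalAt.

Section ClosedField.
Variables (k : closedFieldType) (F : fieldType) (c : {rmorphism k -> F}) (t : F).
Variable v : place c.

Lemma val_evt_triv h : (forall a, t - c a != 0 /\ v (t - c a) = 0) -> h != 0 ->
  evt c t h != 0 /\ v (evt c t h) = 0.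
Proof.
move=> triv h0; have [r ->] := closed_field_poly_normal h.
rewrite evtZ; have l0 : c (lead_coef h) != 0 by rewrite fmorph_eq0 lead_coef_eq0.
suff [r0 vr] : evt c t (\prod_(z <- r) ('X - z%:P)) != 0 /\
    v (evt c t (\prod_(z <- r) ('X - z%:P))) = 0.
  by rewrite mulf_neq0 // pvalM // vr addr0 pval_const ?lead_coef_eq0.
elim: r => [|z r [IH0 IH1]]; first by rewrite big_nil rmorph1 oner_neq0 pval1.
rewrite big_cons rmorphM rmorphB /= evtX evtC; have [z0 z1] := triv z.
by rewrite mulf_neq0 // pvalM // z1 add0r.
Qed.

(** If no t - a had positive value, all of them would have value 0, and so would every nonzero
    polynomial in t, since it splits into linear factors over k. *)
Lemma place_residue : (exists2 h, h != 0 & ~ (evt c t h != 0 /\ v (evt c t h) = 0)) ->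
  vge v 0 t -> exists a, vge v 1 (t - c a).
Proof.
move=> [h h0 nh] t0; apply: NNPP => no; apply: nh; apply: val_evt_triv h0 => a.
have ta0 : vge v 0 (t - c a) by apply: vgeB => //; apply: vge_const.
have nz : t - c a != 0 by apply: contra_not_neq no => e; exists a; rewrite e vge_0.
split=> //; move: ta0; rewrite vgeE // => ta0.
apply/eqP; rewrite eq_le ta0 andbT leNgt; apply/negP => lt; apply: no.
by exists a; rewrite vgeE.
Qed.

End ClosedField.

Section ClassifyP1.
Variable k : closedFieldType.
Notation K := (P1 k).
Definition P1_x : K := tofrac 'X.
Implicit Type w : place (P1_const k).

Lemma evt_P1_x (h : {poly k}) : evt (P1_const k) P1_x h = tofrac h.
Proof.
elim/poly_ind: h => [|h z IH]; first by rewrite !rmorph0.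
by rewrite rmorphD rmorphM /= evtC evtX IH rmorphD rmorphM.
Qed.

Lemma P1_x_neq_const a : P1_x - P1_const k a != 0.
Proof. by rewrite -rmorphB /= tofrac_eq0 polyXsubC_eq0. Qed.

Lemma P1_xE a : P1_x - P1_const k a = tofrac ('X - a%:P).
Proof. by rewrite rmorphB. Qed.

(** The normalization of [w] decides: its uniformizer shows that e divides 1. *)
Lemma same_placeP w w' (e : int) : 0 < e -> (forall b, b != 0 -> w b = e * w' b) ->
  e = 1 /\ same_place w w'.
Proof.
move=> e0 we; have [t t0 tw] := pval_uniformizer w.
have e1 : e * w' t = 1 by rewrite -we.
suff E : e = 1 by split=> // b b0; rewrite we // E mul1r.
have -> : e = 1.
  move: (w' t) e0 e1 => z; clear; case: e => // e; case: z => z; last by nia.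
  by rewrite -PoszM => _ [/eqP]; rewrite muln_eq1 => /andP[/eqP->].
by [].
Qed.

Lemma same_ord_place w a : vge w 1 (P1_x - P1_const k a) ->
  w (P1_x - P1_const k a) = 1 /\ same_place w (ord_place a).
Proof.
rewrite vgeE ?P1_x_neq_const // => wa.
suff we b : b != 0 -> w b = w (P1_x - P1_const k a) * ord_place a b.
  by have [-> ?] := same_placeP (w' := ord_place a) wa we.
move=> /frac_nz[n [m [n0 m0 ->]]]; rewrite ord_placeE //.
rewrite pval_div ?tofrac_eq0 // -!evt_P1_x.
have [_ ->] := val_evt_pos (P1_x_neq_const a) wa n0.
by have [_ ->] := val_evt_pos (P1_x_neq_const a) wa m0; lia.
Qed.

Lemma P1_x_neq0 : P1_x != 0. Proof. by rewrite tofrac_eq0 polyX_eq0. Qed.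

Lemma same_deg_place w : w P1_x < 0 -> w P1_x = -1 /\ same_place w (deg_place k).
Proof.
move=> wx; have wx' : 0 < - w P1_x by lia.
suff we b : b != 0 -> w b = - w P1_x * deg_place k b.
  by have [h ?] := same_placeP (w' := deg_place k) wx' we; split=> //; lia.
move=> /frac_nz[n [m [n0 m0 ->]]]; rewrite deg_placeE //.
rewrite pval_div ?tofrac_eq0 // -!evt_P1_x.
have [_ ->] := val_evt_neg P1_x_neq0 wx n0.
by have [_ ->] := val_evt_neg P1_x_neq0 wx m0; rewrite /degz; lia.
Qed.

Lemma place_P1_cases w :
  (w P1_x = -1 /\ same_place w (deg_place k)) \/
  exists a, w (P1_x - P1_const k a) = 1 /\ same_place w (ord_place a).
Proof.
have [lt|ge] := ltrP (w P1_x) 0; first by left; apply: same_deg_place.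
right; have x0 : vge w 0 P1_x by apply/orP; right; exact: ge.
suff H : exists2 h, h != 0 & ~ (evt (P1_const k) P1_x h != 0 /\
    w (evt (P1_const k) P1_x h) = 0).
  by have [a ha] := place_residue H x0; exists a; apply: same_ord_place.
(* Otherwise all nonzero polynomials, hence all quotients, would have value 0, against the existence
   of a uniformizer. *)
apply: NNPP => no; have [u u0 wu] := pval_uniformizer w.
have triv h : h != 0 -> w (tofrac h) = 0.
  move=> h0; apply: NNPP => nh; apply: no; exists h => //.
  by rewrite evt_P1_x => -[].
have [n [m [n0 m0 e]]] := frac_nz u0.
by move: wu; rewrite e pval_div ?tofrac_eq0 // !triv // subr0.
Qed.

End ClassifyP1.

(** * Artin-Schreier extensions and their places *)

Section ArtinSchreierExt.
Variables (K : fieldType) (p : nat) (Y : fieldExtType K) (y : Y) (f : K).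
Hypotheses (p_pr : prime p) (charK : p \in [pchar K]).
Hypotheses (Hy : y ^+ p - y = f%:A) (dimY : \dim {:Y} = p).
Hypothesis genY : <<1; y>>%VS = fullv.

Notation ev := (evt (in_alg Y) y).

Definition as_poly : {poly K} := 'X^p - 'X - f%:P.

Lemma size_as_poly : size as_poly = p.+1.
Proof.
have p1 := prime_gt1 p_pr.
rewrite /as_poly -addrA size_polyDl size_polyXn // -opprD size_polyN.
by rewrite size_XaddC ltnS.
Qed.

Lemma ev_as_poly : ev as_poly = 0.
Proof. by rewrite !rmorphB rmorphXn /= evtX evtC Hy subrr. Qed.

Lemma ev_modp G : ev (G %% as_poly) = ev G.
Proof. by rewrite [in RHS](divp_eq G as_poly) rmorphD rmorphM /= ev_as_poly mulr0 add0r. Qed.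

Lemma size_modp_as (G : {poly K}) : (size (G %% as_poly)%R <= p)%N.
Proof.
by rewrite -ltnS -size_as_poly ltn_modp -size_poly_gt0 size_as_poly.
Qed.

(** The generator y has degree [\dim {:Y}] = p over K, so no nonzero polynomial of smaller degree
    vanishes at it. *)
Lemma ev_inj (G : {poly K}) : (size G <= p)%N -> ev G = 0 -> G = 0.
Proof.
move=> sG eG; apply/eqP; rewrite -(map_poly_eq0 (in_alg Y)).
rewrite -(@root_small_adjoin_poly _ _ 1%AS y) ?alg_polyOver //; first by apply/rootP.
rewrite size_map_poly (leq_trans sG) // -{1}dimY -genY.
by rewrite dim_Fadjoin dimv1 muln1.
Qed.

Lemma coord_exists a : exists G : {poly K}, (size G <= p)%N && (a == ev G).
Proof.
have /Fadjoin1_polyP[G ->] : a \in <<1; y>>%VS by rewrite genY memvf.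
by exists (G %% as_poly); rewrite size_modp_as ev_modp eqxx.
Qed.

(** The coordinates of a in the basis 1, y, ..., y^(p-1), kept as a polynomial so that a product in
    Y becomes a remainder modulo [as_poly]. *)
Definition ycoord a : {poly K} := xchoose (coord_exists a).

Lemma size_coord a : (size (ycoord a) <= p)%N.
Proof. by case/andP: (xchooseP (coord_exists a)). Qed.

Lemma coordK a : ev (ycoord a) = a.
Proof. by case/andP: (xchooseP (coord_exists a)) => _ /eqP/esym. Qed.

Lemma coord_uniq (G : {poly K}) a : (size G <= p)%N -> ev G = a -> ycoord a = G.
Proof.
move=> sG eG; apply/eqP; rewrite -subr_eq0; apply/eqP/ev_inj.
  by rewrite (leq_trans (size_polyD _ _)) // size_polyN geq_max size_coord sG.
by rewrite rmorphB /= coordK eG subrr.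
Qed.

Lemma coord_sum a : a = \sum_(i < p) (ycoord a)`_i *: y ^+ i.
Proof.
rewrite -{1}(coordK a) /evt (@horner_coef_wide _ p) ?size_map_poly ?size_coord //.
by apply: eq_bigr => i _; rewrite coef_map mulr_algl.
Qed.

Lemma coord_ev_mod G : ycoord (ev G) = G %% as_poly.
Proof. by apply: coord_uniq; rewrite ?size_modp_as ?ev_modp. Qed.

Lemma coordD a b : ycoord (a + b) = ycoord a + ycoord b.
Proof.
apply: coord_uniq; last by rewrite rmorphD /= !coordK.
by rewrite (leq_trans (size_polyD _ _)) // geq_max !size_coord.
Qed.

Lemma coord_eq0 a : (ycoord a == 0) = (a == 0).
Proof.
apply/eqP/eqP => [e|->]; first by rewrite -(coordK a) e rmorph0.
by apply: coord_uniq; rewrite ?size_poly0 ?rmorph0.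
Qed.

Lemma coord_mono g i : (i < p)%N -> ycoord (g *: y ^+ i) = g *: 'X^i.
Proof.
move=> ip; apply: coord_uniq.
  by rewrite (leq_trans (size_scale_leq _ _)) // size_polyXn.
by rewrite evtZ rmorphXn /= evtX mulr_algl.
Qed.

Section Derivation.
Variable D0 : {additive K -> K}.
Hypothesis D0M : forall a b, D0 (a * b) = a * D0 b + b * D0 a.

(** Differentiating y^p - y = f in characteristic p forces D y = - D f, hence this formula for an
    extension of [D0] to polynomials in y. *)
Definition der_poly (G : {poly K}) : {poly K} := map_poly D0 G - D0 f *: G^`().

Lemma der_polyD G H : der_poly (G + H) = der_poly G + der_poly H.
Proof. by rewrite /der_poly raddfD derivD /= scalerDr; ring. Qed.

Lemma D0_1 : D0 1 = 0.
Proof. by have := D0M 1 1; rewrite !mul1r -{1}[D0 1]addr0 => /addrI. Qed.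

Lemma map_polyDM G H :
  map_poly D0 (G * H) = G * map_poly D0 H + H * map_poly D0 G.
Proof.
apply/polyP => n; rewrite coef_map coefD (coefM G H) coefM coefMr raddf_sum /=.
by rewrite -big_split; apply: eq_bigr => i _; rewrite !coef_map D0M.
Qed.

Lemma der_polyM G H : der_poly (G * H) = G * der_poly H + H * der_poly G.
Proof.
by rewrite /der_poly map_polyDM derivM -!mul_polyC; ring.
Qed.

(** The derivation kills the defining polynomial and is a derivation, so it preserves the ideal and
    descends to Y. *)
Lemma der_poly_as : der_poly as_poly = 0.
Proof.
have D0X n : map_poly D0 'X^n = 0.
  by apply/polyP=> i; rewrite coef_map coefXn coef0; case: eqP => _; rewrite ?D0_1 ?raddf0.
rewrite /der_poly /as_poly !raddfB /= D0X -['X]expr1 D0X map_polyC /=.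
rewrite !expr1 derivXn derivX derivC -scaler_nat (pcharf0 charK) scale0r.
by rewrite -!mul_polyC; ring.
Qed.

Definition der_ext (a : Y) : Y := ev (der_poly (ycoord a)).

Lemma der_ext_ev G : der_ext (ev G) = ev (der_poly G).
Proof.
rewrite /der_ext coord_ev_mod [in RHS](divp_eq G as_poly) der_polyD der_polyM.
by rewrite der_poly_as mulr0 add0r [RHS]rmorphD rmorphM /= ev_as_poly mul0r add0r.
Qed.

Lemma der_extD a b : der_ext (a + b) = der_ext a + der_ext b.
Proof. by rewrite /der_ext coordD der_polyD rmorphD. Qed.

Lemma der_extM a b : der_ext (a * b) = a * der_ext b + b * der_ext a.
Proof.
rewrite -{1}(coordK a) -{1}(coordK b) -rmorphM /= der_ext_ev der_polyM.
by rewrite rmorphD !rmorphM /= !coordK.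
Qed.

Lemma der_ext_alg g : der_ext g%:A = (D0 g)%:A.
Proof.
rewrite -[g%:A](evtC (in_alg Y) y) der_ext_ev /der_poly map_polyC derivC.
by rewrite scaler0 subr0 evtC.
Qed.

End Derivation.
End ArtinSchreierExt.

(** * The derivation d/dx of k(x) *)

Section DerivationP1.
Variable k : fieldType.
Notation K := (P1 k).

Let fracPb (b : K) : exists nm : {poly k} * {poly k},
  (nm.2 != 0) && (b == tofrac nm.1 / tofrac nm.2).
Proof. by have [n [m [m0 ->]]] := fracP b; exists (n, m); rewrite m0 eqxx. Qed.

Let frac_der_rep (n m : {poly k}) : K :=
  tofrac (n^`() * m - n * m^`()) / tofrac (m ^+ 2).

Definition frac_der (b : K) : K :=
  let nm := xchoose (fracPb b) in frac_der_rep nm.1 nm.2.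

Lemma frac_derE n m : m != 0 -> frac_der (tofrac n / tofrac m) =
  tofrac (n^`() * m - n * m^`()) / tofrac (m ^+ 2).
Proof.
move=> m0; rewrite /frac_der.
case/andP: (xchooseP (fracPb (tofrac n / tofrac m))).
case: (xchoose _) => n1 m1 /= m10.
rewrite eqr_div ?tofrac_eq0 // -!tofracM tofrac_eq => /eqP e.
have de := congr1 (@deriv _) e; rewrite !derivM in de.
apply/eqP; rewrite eqr_div ?tofrac_eq0 ?expf_neq0 // -!tofracM tofrac_eq.
rewrite -subr_eq0; apply/eqP.
(* The cross difference is m1 m times the derivative of the relation n1 m = n m1, minus (m1 m)'
   times the relation itself. *)
transitivity (m1 * m * (n1^`() * m + n1 * m^`() - (n^`() * m1 + n * m1^`()))
  - (m1^`() * m + m1 * m^`()) * (n1 * m - n * m1)); first by ring.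
by rewrite -de -e !subrr !mulr0 subrr.
Qed.

Lemma frac_derM a b : frac_der (a * b) = a * frac_der b + b * frac_der a.
Proof.
have [n [m [m0 ->]]] := fracP a; have [n' [m' [m'0 ->]]] := fracP b.
rewrite mulf_div -!tofracM !frac_derE ?mulf_neq0 // !derivM.
rewrite !mulf_div -!tofracM addf_div ?(tofrac_eq0, mulf_neq0, expf_neq0) //.
apply/eqP; rewrite eqr_div -?tofracM ?(tofrac_eq0, mulf_neq0, expf_neq0) //.
by rewrite -!(tofracM, tofracD); apply/eqP; congr tofrac; ring.
Qed.

Lemma frac_der_is_zmod : zmod_morphism frac_der.
Proof.
move=> a b.
have [n [m [m0 ->]]] := fracP a; have [n' [m' [m'0 ->]]] := fracP b.
have -> : tofrac n / tofrac m - tofrac n' / tofrac m' =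
    tofrac (n * m' - n' * m) / tofrac (m * m') :> K.
  by rewrite -mulNr addf_div ?tofrac_eq0 // mulNr -!tofracM -tofracB.
rewrite !frac_derE ?mulf_neq0 // !derivB !derivM -[- (_ / _)]mulNr -rmorphN /=.
rewrite addf_div ?(tofrac_eq0, mulf_neq0, expf_neq0) //.
apply/eqP; rewrite eqr_div -?tofracM ?(tofrac_eq0, mulf_neq0, expf_neq0) //.
by rewrite -!(tofracM, tofracD); apply/eqP; congr tofrac; ring.
Qed.
HB.instance Definition _ := GRing.isZmodMorphism.Build K K frac_der frac_der_is_zmod.

Lemma frac_der_tofrac n : frac_der (tofrac n) = tofrac n^`().
Proof.
rewrite -[tofrac n]divr1 -tofrac1 frac_derE ?oner_neq0 //.
by rewrite expr1n tofrac1 divr1 -[1 in X in _ - X]polyC1 derivC mulr0 subr0 mulr1.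
Qed.

Lemma frac_der_const z : frac_der (P1_const k z) = 0.
Proof. by rewrite frac_der_tofrac derivC rmorph0. Qed.

End DerivationP1.

(** Modulo p the equation says that p divides n (j - i). This is why monomials g y^i with different
    i < p never have the same value at a ramified point. *)
Lemma distinct_weights (p n i j : nat) (z z' : int) : prime p -> ~~ (p %| n)%N ->
  (i < p)%N -> (j < p)%N ->
  p%:Z * z - n%:Z * i%:Z = p%:Z * z' - n%:Z * j%:Z -> i = j.
Proof.
move=> p_pr pn.
wlog ij : i j z z' / (i <= j)%N => [H ip jp e|ip jp e].
  case/orP: (leq_total i j) => le; first exact: H e.
  by apply/esym; apply: (H j i z' z).
have e1 : ((n * (j - i))%N)%:Z = p%:Z * (z' - z).
  by rewrite PoszM -subzn //; lia.
have : (p %| n * (j - i))%N.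
  by have := dvdz_mulr (z' - z) (dvdzz p%:Z); rewrite -e1.
rewrite Euclid_dvdM // (negPf pn) /= => d; apply/eqP; rewrite eqn_leq ij /=.
by rewrite -subn_eq0; apply: contraTT d => ji; rewrite gtnNdvd ?lt0n //; lia.
Qed.

(** * Artin-Schreier equations over a valued field *)

Section ASvaluation.
Variables (k F : fieldType) (c : {rmorphism k -> F}) (v : place c) (p : nat).
Hypotheses (p_pr : prime p) (charF : p \in [pchar F]).
Implicit Type z : F.

Let p1 : (1 < p)%N := prime_gt1 p_pr.

Lemma val_as_neg z : z != 0 -> v z < 0 ->
  z ^+ p - z != 0 /\ v (z ^+ p - z) = p%:Z * v z.
Proof.
move=> z0 vz; rewrite -pvalX //; apply: pval_addl; first by rewrite expf_neq0.
by rewrite vgeN vgeE // pvalX //; nia.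
Qed.

Lemma vge_as z : vge v 0 (z ^+ p - z) -> vge v 0 z.
Proof.
move=> h; have [->|z0] := eqVneq z 0; first exact: vge_0.
rewrite vgeE // leNgt; apply/negP => vz.
by move: h; have [h1 h2] := val_as_neg z0 vz; rewrite vgeE // h2; nia.
Qed.

(** When z has positive value the term - z dominates z^p, so z^p - z has the value of z. *)
Lemma vge_as_pos z n : vge v 1 z -> vge v n (z ^+ p - z) -> vge v n z.
Proof.
move=> z1 h; have [->|z0] := eqVneq z 0; first exact: vge_0.
rewrite vgeE // in z1; have nz0 : - z != 0 by rewrite oppr_eq0.
have hz : vge v (v (- z) + 1) (z ^+ p).
  by rewrite vgeE ?expf_neq0 // pvalX // pvalN //; nia.
have [h1 h2] := pval_addl nz0 hz.
move: h; rewrite addrC vgeE // h2 pvalN // vgeE //.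
Qed.

Lemma vge_expn z n : vge v 1 z -> vge v n%:Z (z ^+ n).
Proof.
move=> z1; elim: n => [|n IH]; first by rewrite expr0 vgeE ?oner_neq0 // pval1.
by rewrite exprS -addn1 addnC PoszD; apply: vgeM.
Qed.

(* [y = y_N + z_N] with [y_N] in [k[g]] and [z_N ^ p - z_N = g ^ (p ^ N)] *)
Lemma as_approx (y g : F) N : vge v 1 y -> y ^+ p - y = g -> vge v 1 g ->
  vge v (p ^ N)%:Z (y + \sum_(j < N) g ^+ (p ^ j)).
Proof.
move=> y1 yg g1.
have pX (a b : F) : (a + b) ^+ p = a ^+ p + b ^+ p.
  by rewrite exprDn_pchar // pnatE.
have e : (y + \sum_(j < N) g ^+ (p ^ j)) ^+ p - (y + \sum_(j < N) g ^+ (p ^ j))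
    = g ^+ (p ^ N).
  elim: N => [|N IH]; first by rewrite big_ord0 addr0 yg expr1.
  rewrite big_ord_recr /= addrA pX opprD addrACA IH -exprM -expnSr.
  by rewrite addrC subrK.
apply: vge_as_pos; last by rewrite e; apply: vge_expn.
apply: vgeD => //; apply: vge_sum => j _.
apply: (@vgeW _ _ _ _ _ (p ^ j)%:Z); last exact: vge_expn.
by rewrite lez_nat expn_gt0 prime_gt0.
Qed.

Lemma vge_subX (a b : F) n i : vge v 0 a -> vge v 0 b -> vge v n (a - b) ->
  vge v n (a ^+ i - b ^+ i).
Proof.
move=> a0 b0 ab; rewrite subrXX -[n]addr0; apply: vgeM => //.
by apply: vge_sum => j _; apply: vge0M; apply: vge0X.
Qed.

End ASvaluation.

(** * Places of Y seen through a coordinate tau of the line *)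

Section PlacesOfCover.
Variables (k : closedFieldType) (p : nat) (Y : fieldExtType (P1 k)) (y : Y).
Variables (tau : P1 k) (f : {poly k}).
Notation K := (P1 k).
Notation cK := (P1_const k).
Notation c := (cover_const Y).
Notation t := (tau%:A : Y).
Hypotheses (p_pr : prime p) (chark : p \in [pchar k]).
Hypothesis Hy : y ^+ p - y = (evt cK tau f)%:A.
Hypothesis dimY : \dim {:Y} = p.
Hypothesis genY : <<1; y>>%VS = fullv.
Hypothesis tau_inj : forall h : {poly k}, h != 0 -> evt cK tau h != 0.
Hypothesis tau_gen : forall b : K, exists n m : {poly k},
  m != 0 /\ b = evt cK tau n / evt cK tau m.

Notation ycoord := (ycoord p_pr Hy genY).

Lemma pchar_P1 : p \in [pchar K].
Proof. by rewrite (fmorph_pchar cK). Qed.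

Lemma pchar_cover : p \in [pchar Y].
Proof. by rewrite (fmorph_pchar c). Qed.

Lemma evt_cover h : evt c t h = (evt cK tau h)%:A.
Proof.
elim/poly_ind: h => [|h z IH]; first by rewrite !rmorph0 scale0r.
rewrite !rmorphD !rmorphM /= !evtC !evtX IH scalerDl; congr (_ + _).
by rewrite mulr_algl scalerA.
Qed.

Lemma Hy' : y ^+ p - y = evt c t f.
Proof. by rewrite evt_cover. Qed.

Lemma alg_neq0 (b : K) : (b%:A != 0 :> Y) = (b != 0).
Proof. by rewrite -[b%:A]/(in_alg Y b) fmorph_eq0. Qed.

Lemma algX (b : K) n : (b ^+ n)%:A = b%:A ^+ n :> Y.
Proof. exact: (rmorphXn (in_alg Y)). Qed.

Lemma algM (a b : K) : (a * b)%:A = a%:A * b%:A :> Y.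
Proof. exact: (rmorphM (in_alg Y)). Qed.

Lemma tau_neq_const a : t - c a != 0.
Proof.
rewrite -[t]/(in_alg Y tau) -[c a]/(in_alg Y (cK a)) -rmorphB fmorph_eq0.
have := tau_inj (negbT (polyXsubC_eq0 a)).
by rewrite rmorphB /= evtX evtC.
Qed.

Variable v : place c.

(* The values of v on K lie in e Z as soon as they do on the k[tau]. *)
Lemma val_K_multiple (e : int) :
  (forall h, h != 0 -> exists z, v (evt c t h) = e * z) ->
  forall b : K, b != 0 -> exists z, v b%:A = e * z.
Proof.
move=> H b; have [n [m [m0 ->]]] := tau_gen b => b0.
have n0 : n != 0 by apply: contraNneq b0 => ->; rewrite rmorph0 mul0r.
have [z hz] := H n n0; have [z' hz'] := H m m0.
have nz h : h != 0 -> evt c t h != 0 by move=> h0; rewrite evt_cover alg_neq0 tau_inj.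
exists (z - z'); rewrite -[_%:A]/(in_alg Y _) fmorph_div /=.
by rewrite -!evt_cover pval_div ?nz // hz hz'; lia.
Qed.

(** If t is integral at v and has no residue, v is trivial on k(tau); then y is integral by its
    equation, so v is nonnegative on all of Y, against the inverse of a uniformizer. *)
Lemma place_cover_cases : v t < 0 \/ exists a, vge v 1 (t - c a).
Proof.
have [lt|ge] := ltrP (v t) 0; [by left | right].
have t0 : vge v 0 t by apply/orP; right; exact: ge.
suff H : exists2 h, h != 0 & ~ (evt c t h != 0 /\ v (evt c t h) = 0).
  exact: place_residue H t0.
apply: NNPP => no.
have triv h : h != 0 -> v (evt c t h) = 0.
  by move=> h0; apply: NNPP => nh; apply: no; exists h => // -[].
have y0 : vge v 0 y.
  by apply: (vge_as p_pr pchar_cover); rewrite Hy'; apply: vge_evt.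
have K0 (b : K) : vge v 0 b%:A.
  have [->|b0] := eqVneq b 0; first by rewrite scale0r vge_0.
  have [|z hz] := @val_K_multiple 0 _ b b0; first by move=> h /triv ->; exists 0.
  by rewrite vgeE ?alg_neq0 // hz mul0r.
have all0 a : vge v 0 a.
  rewrite (coord_sum p_pr Hy genY a); apply: vge_sum => i _.
  by rewrite -mulr_algl; apply: vge0M => //; apply: vge0X.
have [u u0 vu] := pval_uniformizer v.
by have := all0 u^-1; rewrite vgeE ?invr_eq0 // pvalV // vu.
Qed.

Section FinitePlace.
Variable a : k.
Hypothesis ta : vge v 1 (t - c a).

Let t0 : vge v 0 t.
Proof.
rewrite -(subrK (c a) t); apply: vgeD; last exact: vge_const.
exact: vgeW ta.
Qed.

Lemma vge_y : vge v 0 y.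
Proof. by apply: (vge_as p_pr pchar_cover); rewrite Hy'; apply: vge_evt. Qed.

(** The polynomial X^p - X - f(a) takes at y the value f(t) - f(a), which vanishes at v; it is the
    witness needed to find a residue of y. *)
Lemma residue_y : exists z, vge v 1 (y - c z).
Proof.
apply: place_residue vge_y.
exists ('X^p - 'X - (f.[a])%:P).
  rewrite -size_poly_gt0 -addrA size_polyDl size_polyXn // -opprD size_polyN.
  by rewrite size_XaddC ltnS prime_gt1.
rewrite !rmorphB rmorphXn /= !evtX evtC Hy' -(evtC c t) -rmorphB => -[h0 hv].
have /factor_theorem[q e] : root (f - f.[a]%:P) a.
  by rewrite rootE hornerD hornerN hornerC subrr.
have : vge v 1 (evt c t (f - (f.[a])%:P)).
  rewrite e rmorphM rmorphB /= evtX evtC -[1]add0r; apply: vgeM => //.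
  exact: vge_evt.
by rewrite vgeE // hv.
Qed.

(** A Hensel argument: after subtracting the residue of y, the partial sums of - g - g^p - g^(p^2) -
    ... approximate the root to order p^N. *)
Lemma approx_y (m : int) : exists q : {poly k}, vge v m (y - evt c t q).
Proof.
have [z yz] := residue_y.
pose g := f - (z ^+ p - z)%:P.
have pn : [pchar Y].-nat p by rewrite pnatE // pchar_cover.
have e : (y - c z) ^+ p - (y - c z) = evt c t g.
  rewrite rmorphB /= evtC -Hy' exprDn_pchar // exprNn_pchar // rmorphB rmorphXn /=.
  by ring.
have g1 : vge v 1 (evt c t g).
  rewrite -e; apply: vgeB => //; apply: (@vgeW _ _ _ _ _ p%:Z).
    by rewrite lez_nat prime_gt0.
  exact: vge_expn.
clearbody g; exists (z%:P - \sum_(j < `|m|) g ^+ (p ^ j)).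
apply: (@vgeW _ _ _ _ _ (p ^ `|m|)%:Z).
  have := ltn_expl `|m| (prime_gt1 p_pr); lia.
have := as_approx p_pr pchar_cover `|m| yz e g1.
rewrite rmorphB /= evtC rmorph_sum opprB addrCA addrC.
by under [in X in _ -> vge _ _ X]eq_bigr do rewrite rmorphXn /=.
Qed.

Lemma val_alg_bound (G : {poly K}) : exists z : int, forall i, vge v z (G`_i)%:A.
Proof.
elim/poly_ind: G => [|G b [z IH]].
  by exists 0 => i; rewrite coef0 scale0r vge_0.
exists (Num.min z (v b%:A)) => i; rewrite coefD coefMX coefC.
case: i => [|i] /=.
  by rewrite add0r; apply: vgeW (vge_self _ _); rewrite ge_min lexx orbT.
by rewrite addr0; apply: vgeW (IH i); rewrite ge_min lexx.
Qed.

Lemma approx_Y (m : int) (b : Y) : exists g : K, vge v m (b - g%:A).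
Proof.
have [z hz] := val_alg_bound (ycoord b).
have [q hq] := approx_y (`|m - z|%N)%:Z.
have q0 : vge v 0 (evt c t q) by apply: vge_evt.
exists (\sum_(i < p) (ycoord b)`_i * (evt cK tau q) ^+ i).
rewrite -[_%:A]/(in_alg Y _) rmorph_sum /= {1}(coord_sum p_pr Hy genY b).
rewrite -sumrB; apply: vge_sum => i _.
rewrite algM algX -evt_cover -[_ *: y ^+ i]mulr_algl -mulrBr.
apply: (@vgeW _ _ _ _ _ (z + `|m - z|%N%:Z)); first by lia.
by apply: vgeM => //; apply: vge_subX => //; apply: vge_y.
Qed.

(** By [approx_Y] the field k(tau) is dense in Y for v, so it contains an element of value 1; all
    its values are multiples of v (t - a), which therefore divides 1. *)
Lemma val_finite : v (t - c a) = 1.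
Proof.
have ta' := ta; rewrite vgeE ?tau_neq_const // in ta'.
have [u u0 vu] := pval_uniformizer v.
have [g hg] := approx_Y 2 u.
have hu : vge v (v u + 1) (g%:A - u) by rewrite vu -vgeN opprB.
have [] := pval_addl u0 hu; rewrite addrC subrK alg_neq0 vu => g0 vg.
have [|z] := @val_K_multiple (v (t - c a)) _ g g0.
  move=> h h0; exists (mup a h)%:Z.
  by have [_ ->] := val_evt_pos (tau_neq_const a) ta' h0; rewrite mulrC.
rewrite vg; case: (v _) ta' => // e e0; case: z => z; last by nia.
by rewrite -PoszM => -[/esym/eqP]; rewrite muln_eq1 => /andP[/eqP-> _].
Qed.

End FinitePlace.

Section InfinitePlace.
Variable n : nat.
Hypotheses (sf : size f = n.+1) (n0 : (0 < n)%N) (pn : ~~ (p %| n)%N).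
Hypothesis tneg : v t < 0.

Let tnz : t != 0. Proof. by have := tau_neq_const 0; rewrite rmorph0 subr0. Qed.
Let f0 : f != 0. Proof. by rewrite -size_poly_gt0 sf. Qed.

Lemma y_neq0 : y != 0.
Proof.
apply/negP => /eqP y0; have := Hy'; rewrite y0 expr0n gtn_eqF ?prime_gt0 // subrr.
by move/esym; apply/eqP; rewrite evt_cover alg_neq0 tau_inj.
Qed.

(** Comparing the dominant terms of y^p - y = f(t) gives p v(y) = n v(t), and p is prime to n. *)
Lemma val_infinite_mul : exists e : int, [/\ 0 < e, v t = - e * p%:Z & v y = - e * n%:Z].
Proof.
have [e0 vf] := val_evt_neg tnz tneg f0; rewrite sf /= in vf.
have yneg : v y < 0.
  rewrite ltNge; apply/negP => y0.
  have : vge v 0 (y ^+ p - y).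
    have y0' : vge v 0 y by apply/orP; right; exact: y0.
    by apply: vgeB => //; apply: vge0X.
  by rewrite Hy' vgeE // vf; nia.
have [_] := val_as_neg p_pr pchar_cover y_neq0 yneg; rewrite Hy' vf => e.
have : (p%:Z %| n%:Z * v t)%Z by rewrite e dvdz_mulr.
rewrite Gauss_dvdzr; last by rewrite coprimezE !absz_nat prime_coprime.
move=> /dvdzP[z vt]; exists (- z).
have pp := prime_gt0 p_pr.
rewrite opprK; split=> //; first by move: tneg; rewrite vt; nia.
have : p%:Z * v y = p%:Z * (z * n%:Z) by rewrite -e vt; ring.
by apply: mulfI; case: (p) pp.
Qed.

Lemma val_K_infinite (b : K) : b != 0 -> exists z, v b%:A = v t * z.
Proof.
apply: val_K_multiple => h h0; exists (size h).-1%:Z.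
by have [_ ->] := val_evt_neg tnz tneg h0; rewrite mulrC.
Qed.

Lemma val_mono (b : K) i : b != 0 -> v (b *: y ^+ i) = v b%:A + i%:Z * v y.
Proof.
by move=> b0; rewrite -[_ *: y ^+ i]mulr_algl pvalM ?expf_neq0 ?alg_neq0 ?y_neq0 // pvalX ?y_neq0.
Qed.

Lemma val_coords_distinct (b : Y) (i j : 'I_p) : i != j ->
  (ycoord b)`_i *: y ^+ i != 0 -> (ycoord b)`_j *: y ^+ j != 0 ->
  v ((ycoord b)`_i *: y ^+ i) != v ((ycoord b)`_j *: y ^+ j).
Proof.
rewrite !scaler_eq0 !negb_or => ij /andP[bi yi] /andP[bj yj].
have [e [e0 vt vy]] := val_infinite_mul.
have [z hz] := val_K_infinite bi; have [z' hz'] := val_K_infinite bj.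
apply: contra_neq ij; rewrite !val_mono //.
rewrite hz hz' vt vy => eq; apply/val_inj.
apply: (@distinct_weights p n i j (- z) (- z')) => //.
by apply: (@mulfI _ e); [lia | move: eq; lia].
Qed.

(** The terms of the expansion of a uniformizer in powers of y have distinct values, all divisible
    by e, so e divides 1. *)
Lemma val_infinite : v t = - p%:Z /\ v y = - n%:Z.
Proof.
have [e [e0 vt vy]] := val_infinite_mul.
suff E1 : e = 1 by rewrite vt vy E1 !mulN1r.
have [u u0 vu] := pval_uniformizer v.
have s0 : \sum_(i < p) (ycoord u)`_i *: y ^+ i != 0 by rewrite -coord_sum.
have [i Ei] := sum_distinct_val (@val_coords_distinct u) s0.
rewrite -coord_sum vu; move: Ei; rewrite scaler_eq0 negb_or => /andP[bi yi].
rewrite val_mono //.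
have [z ->] := val_K_infinite bi; rewrite vt vy => E.
have : e * (- p%:Z * z - i%:Z * n%:Z) = 1 by rewrite E; ring.
move: (_ - _) => w; case: (e) e0 => // e' e'0; case: w => w; last by nia.
by rewrite -PoszM => -[/eqP]; rewrite muln_eq1 => /andP[/eqP-> _].
Qed.

Lemma vge_coord_infinite m b : vge v m b ->
  forall i, (i < p)%N -> vge v m ((ycoord b)`_i *: y ^+ i).
Proof.
rewrite {1}(coord_sum p_pr Hy genY b) => h i ip.
exact: (vge_sum_distinct (@val_coords_distinct b) h (Ordinal ip)).
Qed.

End InfinitePlace.
End PlacesOfCover.

Lemma pval_surj (k F : fieldType) (c : {rmorphism k -> F}) (v : place c) (z : int) :
  exists2 g, g != 0 & v g = z.
Proof.
have [u u0 vu] := pval_uniformizer v.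
case: z => n; first by exists (u ^+ n); rewrite ?expf_neq0 // pvalX // vu mulr1.
exists (u ^+ n.+1)^-1; first by rewrite invr_eq0 expf_neq0.
by rewrite pvalV ?expf_neq0 // pvalX // vu mulr1 NegzE.
Qed.

(** The solution tells which monomial g y^i, with g of value z on the base, is a uniformizer at a
    totally ramified point. *)
Lemma bezout_ramified (p n : nat) : prime p -> ~~ (p %| n)%N ->
  exists (i : nat) (z : int), (i < p)%N /\ p%:Z * z - n%:Z * i%:Z = 1.
Proof.
move=> p_pr pn; have pp := prime_gt0 p_pr.
have /coprimezP[[u v] /= uv] : coprimez p%:Z n%:Z.
  by rewrite coprimezE !absz_nat prime_coprime.
have p0 : p%:Z != 0 by lia.
have h0 := modz_ge0 (- v) p0; have h1 := ltz_pmod (- v) (_ : 0 < p%:Z).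
have e := divz_eq (- v) p%:Z.
exists `|((- v) %% p%:Z)%Z|%N, (u - ((- v) %/ p%:Z)%Z * n%:Z).
have := h1 pp; split; first by lia.
rewrite gez0_abs //; have -> : ((- v) %% p%:Z)%Z = - v - ((- v) %/ p%:Z)%Z * p%:Z.
  by rewrite {2}e addrC addKr.
by rewrite -uv; ring.
Qed.

(** * Construction of the totally ramified place above a pole of f *)

Section RamifiedPlace.
Variables (k : fieldType) (p : nat) (Y : fieldExtType (P1 k)) (y : Y) (f : P1 k).
Notation K := (P1 k).
Hypotheses (p_pr : prime p) (Hy : y ^+ p - y = f%:A).
Hypotheses (dimY : \dim {:Y} = p) (genY : <<1; y>>%VS = fullv).
Variables (w : place (P1_const k)) (n : nat).
Hypotheses (f0 : f != 0) (wf : w f = - n%:Z) (pn : ~~ (p %| n)%N).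

Notation ycoord := (ycoord p_pr Hy genY).

(** The weight p w(g) - n i is the only value g y^i can have: base values are multiplied by the
    index p, and y gets a pole of order n. *)
Definition wge (m : int) (i : nat) (g : K) :=
  (g == 0) || (m <= p%:Z * w g - n%:Z * i%:Z).

Definition Vge (m : int) (a : Y) := forall i, (i < p)%N -> wge m i (ycoord a)`_i.

Lemma wgeD m i g h : wge m i g -> wge m i h -> wge m i (g + h).
Proof.
rewrite /wge; have [->|g0] /= := eqVneq g 0; first by rewrite add0r.
have [->|h0] /= := eqVneq h 0; first by rewrite addr0 (negPf g0).
have [//|s0] /= := eqVneq (g + h) 0 => wg wh.
have := pvalD w g0 h0 s0; rewrite ge_min => /orP[] le.
  by apply: le_trans wg _; rewrite lerD2r ler_wpM2l.
by apply: le_trans wh _; rewrite lerD2r ler_wpM2l.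
Qed.

Lemma wgeW m m' i g : m <= m' -> wge m' i g -> wge m i g.
Proof. by rewrite /wge => le /orP[->//|h]; rewrite (le_trans le h) orbT. Qed.

Lemma Vge_0 m : Vge m 0.
Proof.
move=> i _; have /eqP -> : ycoord 0 == 0 by rewrite coord_eq0.
by rewrite coef0 /wge eqxx.
Qed.

Lemma VgeD m a b : Vge m a -> Vge m b -> Vge m (a + b).
Proof. by move=> ha hb i ip; rewrite coordD // coefD; apply: wgeD; auto. Qed.

Lemma Vge_sum m (I : Type) (r : seq I) (P : pred I) (E : I -> Y) :
  (forall i, P i -> Vge m (E i)) -> Vge m (\sum_(i <- r | P i) E i).
Proof.
by move=> h; elim/big_ind: _ => //; [exact: Vge_0 | move=> ? ?; exact: VgeD].
Qed.

Lemma Vge_mono m g i : (i < p)%N -> wge m i g -> Vge m (g *: y ^+ i).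
Proof.
move=> ip hg j jp; rewrite coord_mono // coefZ coefXn.
by case: eqP => [->|_]; rewrite ?mulr1 // mulr0 /wge eqxx.
Qed.

Lemma VgeN m a : Vge m a -> Vge m (- a).
Proof.
move=> ha; rewrite (coord_sum p_pr Hy genY a) -sumrN; apply: Vge_sum => i _.
rewrite -scaleNr; apply: Vge_mono => //; have := ha i (ltn_ord i).
by rewrite /wge oppr_eq0; have [//|h] /= := eqVneq _ 0; rewrite pvalN.
Qed.

Lemma monoM g h i j : (g *: y ^+ i) * (h *: y ^+ j) = (g * h) *: y ^+ (i + j).
Proof. by rewrite -scalerAl -scalerAr scalerA exprD. Qed.

Lemma mono_reduce g i : (p <= i)%N ->
  g *: y ^+ i = g *: y ^+ (i - p).+1 + (g * f) *: y ^+ (i - p).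
Proof.
move=> pi; have yp : y ^+ p = y + f%:A by rewrite -Hy addrC subrK.
rewrite -{1}(subnK pi) exprD yp mulrDr scalerDr -exprSr; congr (_ + _).
by rewrite mulrC mulr_algl scalerA.
Qed.

Lemma wgeM m m' i j g h : wge m i g -> wge m' j h -> wge (m + m') (i + j) (g * h).
Proof.
rewrite /wge mulf_eq0; have [//|g0] /= := eqVneq g 0.
have [//|h0] /= := eqVneq h 0; rewrite (pvalM w g0 h0).
by move: (w g) (w h) => u v; lia.
Qed.

(** Reducing y^p to y + f respects weights: trading y^p for y can only raise the weight, and trading
    it for f, in [wge_wrapf], preserves it because w f = - n. *)
Lemma wge_wrap m s g : (p <= s)%N -> wge m s g -> wge m (s - p).+1 g.
Proof.
move=> ps; rewrite /wge => /orP[->//|le]; apply/orP; right; apply: le_trans le _.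
rewrite lerD2l lerN2 -!PoszM lez_nat leq_mul2l; apply/orP; right.
by have := prime_gt0 p_pr; lia.
Qed.

Lemma wge_wrapf m s g : (p <= s)%N -> wge m s g -> wge m (s - p) (g * f).
Proof.
move=> ps; rewrite /wge mulf_eq0 (negPf f0) orbF; have [//|g0] /= := eqVneq g 0.
move=> le; rewrite (pvalM w g0 f0) wf -(subzn ps); apply: le_trans le _.
by move: (w g) => u; rewrite le_eqVlt; apply/orP; left; apply/eqP; ring.
Qed.

Lemma VgeM m m' a b : Vge m a -> Vge m' b -> Vge (m + m') (a * b).
Proof.
move=> ha hb; rewrite {1}(coord_sum p_pr Hy genY a) {1}(coord_sum p_pr Hy genY b).
rewrite mulr_suml; apply: Vge_sum => i _; rewrite mulr_sumr; apply: Vge_sum => j _.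
rewrite monoM; have wij := wgeM (ha i (ltn_ord i)) (hb j (ltn_ord j)).
have [lt|ge] := ltnP (i + j) p; first exact: Vge_mono.
have ip := ltn_ord i; have jp := ltn_ord j.
rewrite mono_reduce //; apply: VgeD; (apply: Vge_mono; first by lia).
  exact: wge_wrap.
exact: wge_wrapf.
Qed.

Definition rval (a : Y) : int :=
  if [pick i : 'I_p | (ycoord a)`_i != 0] is Some i0 then
    let i := [arg min_(j < i0 | (ycoord a)`_j != 0)
      (p%:Z * w (ycoord a)`_j - n%:Z * (j : nat)%:Z)]%O in
    p%:Z * w (ycoord a)`_i - n%:Z * (i : nat)%:Z
  else 0.

Lemma rvalP a : a != 0 -> exists i : 'I_p, [/\ (ycoord a)`_i != 0,
  rval a = p%:Z * w (ycoord a)`_i - n%:Z * (i : nat)%:Z & Vge (rval a) a].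
Proof.
move=> a0; rewrite /rval; case: pickP => [i0 i00|none].
  case: arg_minP => // i i_0 imin; exists i; split=> // j jp.
  rewrite /wge; have [//|j0] /= := eqVneq _ 0.
  exact: (imin (Ordinal jp)).
case/eqP: a0; rewrite (coord_sum p_pr Hy genY a) big1 // => i _.
by move/negbFE/eqP: (none i) => ->; rewrite scale0r.
Qed.

Lemma rval_ge m a : a != 0 -> (m <= rval a) <-> Vge m a.
Proof.
move=> a0; have [i [ai ei ha]] := rvalP a0; split=> [le j jp|hm].
  exact: wgeW le (ha j jp).
by have := hm i (ltn_ord i); rewrite /wge (negPf ai) -ei.
Qed.

Lemma rval_lead a : a != 0 -> exists (i : 'I_p) (g : K), [/\ g != 0,
  rval a = p%:Z * w g - n%:Z * (i : nat)%:Z & Vge (rval a + 1) (a - g *: y ^+ i)].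
Proof.
move=> a0; have [i [ai ei ha]] := rvalP a0; exists i, (ycoord a)`_i; split=> //.
rewrite {2}(coord_sum p_pr Hy genY a) (bigD1 i) //= [X in Vge _ X]addrC addKr.
apply: Vge_sum => j ji; apply: Vge_mono => //.
have := ha j (ltn_ord j); rewrite /wge; have [//|aj] /= := eqVneq _ 0.
rewrite lezD1 lt_neqAle => ->; rewrite andbT ei; apply: contra_neq ji => e.
by apply/val_inj/esym; apply: (distinct_weights p_pr pn _ _ e).
Qed.

(** [VgeM] gives one inequality. For the other, all products except that of the two leading
    monomials have larger weight, and that one, reduced if i + j >= p, still contains a monomial
    whose weight is exactly the sum. *)
Lemma rvalM a b : a != 0 -> b != 0 -> rval (a * b) = rval a + rval b.
Proof.
move=> a0 b0; have ab0 : a * b != 0 by rewrite mulf_neq0.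
apply: le_anti; apply/andP; split; last first.
  by apply/rval_ge => //; apply: VgeM; apply/rval_ge.
rewrite leNgt -lezD1; apply/negP => /(rval_ge _ ab0) hab.
have [i [g [g0 eg hg]]] := rval_lead a0; have [j [h [h0 eh hh]]] := rval_lead b0.
have hm : Vge (rval a + rval b + 1) ((g *: y ^+ i) * (h *: y ^+ j)).
  have -> : (g *: y ^+ i) * (h *: y ^+ j) = a * b
     - ((a - g *: y ^+ i) * b + (g *: y ^+ i) * (b - h *: y ^+ j)) by ring.
  apply: VgeD => //; apply: VgeN; apply: VgeD.
    rewrite [X in Vge X _]addrAC.
    by apply: VgeM => //; apply/rval_ge.
  rewrite -addrA; apply: VgeM => //; apply: Vge_mono => //.
  by rewrite /wge -eg lexx orbT.
have ip := ltn_ord i; have jp := ltn_ord j.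
move: hm; rewrite monoM; have [lt|ge] := ltnP (i + j) p.
  move/(_ _ lt); rewrite coord_mono // coefZ coefXn eqxx mulr1 /wge.
  rewrite mulf_eq0 (negPf g0) (negPf h0) /= (pvalM w g0 h0) eg eh.
  by move: (w g) (w h) => u v; lia.
have lt : (i + j - p < p)%N by lia.
have lt' : ((i + j - p).+1 < p)%N by lia.
move/(_ _ lt); rewrite mono_reduce // coordD // coefD !coord_mono //.
rewrite !coefZ !coefXn eqxx mulr1 ltn_eqF // mulr0 add0r /wge.
have gh0 := mulf_neq0 g0 h0.
rewrite !mulf_eq0 (negPf g0) (negPf h0) (negPf f0) /=.
rewrite (pvalM w gh0 f0) (pvalM w g0 h0) wf eg eh -(subzn ge) PoszD.
by move: (w g) (w h) => u v; lia.
Qed.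

Lemma rvalD a b : a != 0 -> b != 0 -> a + b != 0 ->
  Num.min (rval a) (rval b) <= rval (a + b).
Proof.
move=> a0 b0 s0; apply/rval_ge => //.
apply: VgeD; apply/(rval_ge _ _) => //; rewrite ge_min.
  by apply/orP; left.
by apply/orP; right.
Qed.

Lemma rval_mono g i : (i < p)%N -> g != 0 ->
  rval (g *: y ^+ i) = p%:Z * w g - n%:Z * i%:Z.
Proof.
move=> ip g0; have a0 : g *: y ^+ i != 0.
  by rewrite -(coord_eq0 p_pr Hy dimY genY) coord_mono // scaler_eq0 (negPf g0) -size_poly_eq0 size_polyXn.
have [j [+ ->]] := rvalP a0; rewrite coord_mono // coefZ coefXn.
by have [->|] := eqVneq (j : nat) i; rewrite ?mulr1 // mulr0 eqxx.
Qed.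

Lemma rval_alg (b : K) : b != 0 -> rval b%:A = p%:Z * w b.
Proof.
by move=> b0; rewrite -[1](expr0 y) rval_mono ?prime_gt0 // mulr0 subr0.
Qed.

Lemma rval_const z : z != 0 -> rval (cover_const Y z) = 0.
Proof.
move=> z0; have c0 : P1_const k z != 0 by rewrite fmorph_eq0.
by rewrite -[cover_const Y z]/((P1_const k z)%:A) (rval_alg c0) (pval_const w z0) mulr0.
Qed.

Lemma rval_uniformizer : exists2 u, u != 0 & rval u = 1.
Proof.
have [i [z [ip e]]] := bezout_ramified p_pr pn.
have [g g0 wg] := pval_surj w z; exists (g *: y ^+ i); last first.
  by rewrite rval_mono // wg.
by rewrite -(coord_eq0 p_pr Hy dimY genY) coord_mono // scaler_eq0 (negPf g0) -size_poly_eq0 size_polyXn.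
Qed.

Definition ram_place : place (cover_const Y) :=
  Place rvalM rvalD rval_const rval_uniformizer.

Lemma ram_place_lies_over : lies_over p ram_place w.
Proof. by split=> [|b b0]; [exact: prime_gt0 | exact: rval_alg]. Qed.

End RamifiedPlace.

(* At an unramified point x = a, y = z the place is b |-> lim_N ord_a(b(q_N)), where the
   approximate root q_N = z - sum_(j < N) g^(p^j) of y^p - y = f replaces y. *)
Definition eventually (P : nat -> Prop) := exists N0, forall N, (N0 <= N)%N -> P N.

Lemma eventually_and P Q : eventually P -> eventually Q -> eventually (fun N => P N /\ Q N).
Proof.
move=> [N0 hP] [N1 hQ]; exists (maxn N0 N1) => N; rewrite geq_max => /andP[h0 h1].
by split; auto.
Qed.

Lemma eventuallyW (P Q : nat -> Prop) : (forall N, P N -> Q N) -> eventually P -> eventually Q.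
Proof. by move=> PQ [N0 hP]; exists N0 => N /hP /PQ. Qed.

Lemma eventually_ex P : eventually P -> exists N, P N.
Proof. by move=> [N0 hP]; exists N0; apply: hP. Qed.

Lemma eventually_expn p (m : int) : (1 < p)%N -> eventually (fun N => m <= (p ^ N)%:Z).
Proof.
move=> p1; exists `|m|%N => N mN; have := ltn_expl N p1; lia.
Qed.

Section UnramifiedPlace.
Variables (k : closedFieldType) (p : nat) (Y : fieldExtType (P1 k)) (y : Y) (f : {poly k}).
Notation K := (P1 k).
Notation cK := (P1_const k).
Hypotheses (p_pr : prime p) (chark : p \in [pchar k]).
Hypothesis Hy : y ^+ p - y = (tofrac f : K)%:A.
Hypotheses (dimY : \dim {:Y} = p) (genY : <<1; y>>%VS = fullv).
Variables (a z : k).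
Hypothesis za : z ^+ p - z = f.[a].

Notation ycoord := (ycoord p_pr Hy genY).
Notation w := (ord_place a).
Notation asp := (as_poly p (tofrac f : K)).

Let g : {poly k} := f - (z ^+ p - z)%:P.
Definition approx_root N : {poly k} := z%:P - \sum_(j < N) g ^+ (p ^ j).
Notation q N := (tofrac (approx_root N) : K).

Lemma vge_tofrac (h : {poly k}) : vge w 0 (tofrac h : K).
Proof.
have [->|h0] := eqVneq h 0; first by rewrite rmorph0 vge_0.
rewrite vgeE ?tofrac_eq0 // -[tofrac h]divr1 -tofrac1 ord_placeE ?oner_neq0 //.
by rewrite mup_const ?oner_neq0 // subr0.
Qed.

Lemma vge_xa : vge w 1 (P1_x k - cK a).
Proof.
rewrite P1_xE vgeE ?tofrac_eq0 ?polyXsubC_eq0 // -[tofrac _]divr1 -tofrac1.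
rewrite ord_placeE ?oner_neq0 ?polyXsubC_eq0 // mup_const ?oner_neq0 // subr0.
by rewrite -['X - _]expr1 mup_XsubCX eqxx.
Qed.

Lemma vge_tofrac_root (h : {poly k}) : root h a -> vge w 1 (tofrac h : K).
Proof.
move=> /factor_theorem[r ->]; rewrite rmorphM /= -P1_xE -[1]add0r.
by apply: vgeM vge_xa; apply: vge_tofrac.
Qed.

Lemma g_root : root g a.
Proof. by rewrite rootE /g za hornerD hornerN hornerC subrr. Qed.

Lemma vge_gX N : vge w (p ^ N)%:Z (tofrac (g ^+ (p ^ N)) : K).
Proof.
rewrite tofracXn; apply: vge_expn; apply: vge_tofrac_root g_root. Qed.

Lemma approx_rootS N : approx_root N.+1 = approx_root N - g ^+ (p ^ N).
Proof. by rewrite /approx_root big_ord_recr /= opprD addrA. Qed.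

Lemma as_poly_approx N : asp.[q N] = - tofrac (g ^+ (p ^ N)).
Proof.
rewrite /as_poly !hornerD !hornerN hornerC hornerXn hornerX.
rewrite -tofracXn -!tofracB -tofracN; congr tofrac.
have pn : [pchar {poly k}].-nat p by rewrite pnatE // (fmorph_pchar polyC).
elim: N => [|N IH].
  rewrite /approx_root big_ord0 subr0 expn0 expr1 /g -rmorphXn rmorphB /=; ring.
rewrite approx_rootS exprDn_pchar // exprNn_pchar // -exprM -expnSr.
transitivity ((approx_root N ^+ p - approx_root N - f) + g ^+ (p ^ N)
  - g ^+ (p ^ N.+1)); first by ring.
by rewrite IH; ring.
Qed.

Lemma coef_bound (G : {poly K}) : exists m : int, forall i, vge w m G`_i.
Proof.
elim/poly_ind: G => [|G b [m IH]]; first by exists 0 => i; rewrite coef0 vge_0.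
exists (Num.min m (w b)) => i; rewrite coefD coefMX coefC.
case: i => [|i] /=.
  by rewrite add0r; apply: vgeW (vge_self _ _); rewrite ge_min lexx orbT.
by rewrite addr0; apply: vgeW (IH i); rewrite ge_min lexx.
Qed.

Lemma horner_bound (G : {poly K}) : exists m : int, forall N, vge w m G.[q N].
Proof.
have [m hm] := coef_bound G; exists m => N; rewrite horner_coef; apply: vge_sum => i _.
by rewrite -[m]addr0; apply: vgeM => //; apply: vge0X; apply: vge_tofrac.
Qed.

Lemma horner_step (G : {poly K}) : exists m : int,
  forall N, vge w (m + (p ^ N)%:Z) (G.[q N.+1] - G.[q N]).
Proof.
have [m hm] := coef_bound G; exists m => N; rewrite !horner_coef -sumrB.
apply: vge_sum => i _; rewrite -mulrBr; apply: vgeM => //.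
apply: vge_subX; [exact: vge_tofrac | exact: vge_tofrac |].
by rewrite -tofracB approx_rootS addrAC subrr add0r tofracN vgeN; apply: vge_gX.
Qed.

Definition uapp N (b : Y) : K := (ycoord b).[q N].

Lemma uappD N b b' : uapp N (b + b') = uapp N b + uapp N b'.
Proof. by rewrite /uapp coordD // hornerD. Qed.

Lemma uapp_alg N (b : K) : uapp N b%:A = b.
Proof.
rewrite /uapp -[1](expr0 y) coord_mono ?prime_gt0 // expr0.
by rewrite -mul_polyC mulr1 hornerC.
Qed.

Lemma uapp1 N : uapp N 1 = 1.
Proof. by have := uapp_alg N 1; rewrite scale1r. Qed.

Lemma uapp_y N : uapp N y = q N.
Proof.
have /(congr1 (fun G : {poly K} => G.[q N])) := coord_mono p_pr Hy dimY genY 1 (prime_gt1 p_pr).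
by rewrite scale1r expr1 /uapp scale1r expr1 hornerX.
Qed.

(** Evaluation at the approximate root fails to be multiplicative only by a multiple of the defining
    polynomial at that root, which vanishes to order at least p^N. *)
Lemma uappM b b' : exists m : int,
  forall N, vge w (m + (p ^ N)%:Z) (uapp N (b * b') - uapp N b * uapp N b').
Proof.
pose G := ycoord b * ycoord b'.
have e : ycoord (b * b') = G %% asp.
  by rewrite -(coord_ev_mod p_pr Hy dimY genY) rmorphM /= !coordK.
have [m hm] := horner_bound (G %/ asp); exists m => N.
rewrite /uapp -hornerM -/G e {2}(divp_eq G asp) hornerD hornerM opprD addrCA subrr addr0.
by rewrite vgeN as_poly_approx; apply: vgeM => //; rewrite vgeN; apply: vge_gX.
Qed.

Definition ulim (b : Y) (m : int) :=
  eventually (fun N => uapp N b != 0 /\ w (uapp N b) = m).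

Lemma ulim_uniq b m m' : ulim b m -> ulim b m' -> m = m'.
Proof. by move=> h h'; have [N [[_ <-] [_ <-]]] := eventually_ex (eventually_and h h'). Qed.

Let evp (m : int) : eventually (fun N => m <= (p ^ N)%:Z).
Proof. exact: eventually_expn (prime_gt1 p_pr). Qed.

(** The approximations of b^-1 have poles of bounded order, and their products with those of b are
    close to 1; this bounds the orders of the approximations of b from above. Once p^N exceeds the
    bound, the next correction no longer changes the order. *)
Lemma ulim_exists b : b != 0 -> exists m, ulim b m.
Proof.
move=> b0; have [m1 h1] := uappM b b^-1.
have [m2 h2] := horner_bound (ycoord b^-1).
have [m3 h3] := horner_step (ycoord b).
have [N0 hN] := eventually_and (evp (1 - m1)) (evp (1 - m2 - m3)).
have H N : (N0 <= N)%N -> uapp N b != 0 /\ w (uapp N b) <= - m2.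
  move=> /hN[l1 l2]; have := h1 N; rewrite divff // uapp1.
  move=> hv; have one0 := oner_neq0 K.
  have hv' : vge w (w 1 + 1) (uapp N b * uapp N b^-1 - 1).
    by rewrite pval1 add0r -opprB vgeN; apply: vgeW hv; lia.
  have [] := pval_addl one0 hv'; rewrite addrC subrK mulf_eq0 negb_or pval1.
  move=> /andP[u0 u1]; rewrite (pvalM w u0 u1) => e; split; first exact: u0.
  have := h2 N; rewrite -/(uapp N b^-1) (vgeE _ _ u1).
  by move: (w _) (w _) e => i j; lia.
exists (w (uapp N0 b)); exists N0 => N /subnK <-.
elim: (N - N0)%N => [|j [u0 uv]]; first by split; [have [] := H N0 (leqnn _) | ].
have le := leq_addl j N0; have [l1 l2] := hN _ le; have [_ le2] := H _ le.
have hs : vge w (w (uapp (j + N0) b) + 1)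
    ((ycoord b).[q (j + N0).+1] - uapp (j + N0) b).
  by apply: vgeW (h3 _); move: (w _) le2 => i; lia.
have [u1 uv1] := pval_addl u0 hs.
rewrite subrKC in u1 uv1; rewrite addSn; split; first exact: u1.
by rewrite -uv; exact: uv1.
Qed.

Definition uval (b : Y) : int := epsilon (inhabits 0) (ulim b).

Lemma uvalP b : b != 0 -> ulim b (uval b).
Proof. by move=> /ulim_exists h; apply: epsilon_spec. Qed.

Lemma uvalE b m : ulim b m -> uval b = m.
Proof.
move=> h; apply: (@ulim_uniq b) => //; apply: epsilon_spec; by exists m.
Qed.

Let uvalM b b' : b != 0 -> b' != 0 -> uval (b * b') = uval b + uval b'.
Proof.
move=> /uvalP h /uvalP h'; apply: uvalE; have [m hm] := uappM b b'.
have := eventually_and (eventually_and h h') (evp (uval b + uval b' - m + 1)).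
apply: eventuallyW => N [[[u0 uv] [u0' uv']] le].
have p0 := mulf_neq0 u0 u0'.
have hs : vge w (w (uapp N b * uapp N b') + 1) (uapp N (b * b') - uapp N b * uapp N b').
  by apply: vgeW (hm N); rewrite (pvalM w u0 u0') uv uv'; lia.
by have [] := pval_addl p0 hs; rewrite subrKC (pvalM w u0 u0') uv uv'.
Qed.

Let uvalD b b' : b != 0 -> b' != 0 -> b + b' != 0 ->
  Num.min (uval b) (uval b') <= uval (b + b').
Proof.
move=> /uvalP h /uvalP h' /uvalP h''.
have [N [[[u0 <-] [u0' <-]] [u0'' <-]]] :=
  eventually_ex (eventually_and (eventually_and h h') h'').
rewrite uappD in u0'' *; exact: (pvalD w u0 u0' u0'').
Qed.

Lemma uval_alg (b : K) : b != 0 -> uval b%:A = w b.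
Proof. by move=> b0; apply: uvalE; exists 0%N => N _; rewrite uapp_alg. Qed.

Let uval_const e : e != 0 -> uval (cover_const Y e) = 0.
Proof.
move=> e0; have c0 : cK e != 0 by rewrite fmorph_eq0.
by rewrite -[cover_const Y e]/((cK e)%:A) (uval_alg c0) (pval_const w e0).
Qed.

Let uval_unif : exists2 u, u != 0 & uval u = 1.
Proof.
have [u u0 wu] := pval_uniformizer w; exists u%:A; last by rewrite uval_alg.
by rewrite -[u%:A]/(in_alg Y u) fmorph_eq0.
Qed.

Definition unram_place : place (cover_const Y) := Place uvalM uvalD uval_const uval_unif.

Lemma unram_place_alg (b : K) : b != 0 -> unram_place b%:A = w b.
Proof. exact: uval_alg. Qed.

Lemma unram_place_y : vge unram_place 1 (y - cover_const Y z).
Proof.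
have [//|b0] := eqVneq (y - cover_const Y z) 0; first by move=> ->; apply: vge_0.
rewrite vgeE //= ; have [N [u0 <-]] := eventually_ex (uvalP b0).
rewrite -vgeE // -[- cover_const Y z]rmorphN uappD uapp_y uapp_alg.
rewrite [cK _]rmorphN -rmorphB /= /approx_root addrAC subrr add0r rmorphN vgeN.
rewrite rmorph_sum; apply: vge_sum => j _; apply: vgeW (vge_gX j).
by rewrite lez_nat expn_gt0 prime_gt0.
Qed.

End UnramifiedPlace.

(** * The Cartier operator *)

Section PBasis.
Variables (F : fieldType) (p : nat) (s : F).
Hypotheses (p_pr : prime p) (charF : p \in [pchar F]).
Implicit Types a : F.

Definition pbasis a := exists b : 'I_p -> F, a = \sum_(i < p) b i ^+ p * s ^+ i.

Lemma frobD (a b : F) : (a + b) ^+ p = a ^+ p + b ^+ p.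
Proof. by rewrite exprDn_pchar // pnatE. Qed.

Lemma frob_nat n : n%:R ^+ p = n%:R :> F.
Proof. exact: (pFrobenius_aut_nat charF n). Qed.

Lemma pbasisD a b : pbasis a -> pbasis b -> pbasis (a + b).
Proof.
move=> [u ->] [v ->]; exists (fun i => u i + v i).
by rewrite -big_split; apply: eq_bigr => i _; rewrite /= frobD mulrDl.
Qed.

Lemma pbasis0 : pbasis 0.
Proof.
exists (fun=> 0); rewrite big1 // => i _.
by rewrite expr0n gtn_eqF ?prime_gt0 // mul0r.
Qed.

Lemma pbasis_mono a i : pbasis (a ^+ p * s ^+ i).
Proof.
have ip : (i %% p < p)%N by rewrite ltn_mod prime_gt0.
exists (fun j => if j == Ordinal ip then a * s ^+ (i %/ p) else 0).
rewrite (bigD1 (Ordinal ip)) //= eqxx big1 ?addr0 => [|j /negPf ->].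
  by rewrite exprMn -exprM -mulrA -exprD -divn_eq.
by rewrite expr0n gtn_eqF ?prime_gt0 // mul0r.
Qed.

Lemma pbasis_frob a : pbasis (a ^+ p).
Proof. by have := pbasis_mono a 0; rewrite expr0 mulr1. Qed.

Lemma pbasis_sum (I : Type) (r : seq I) (P : pred I) (E : I -> F) :
  (forall i, P i -> pbasis (E i)) -> pbasis (\sum_(i <- r | P i) E i).
Proof. by move=> h; elim/big_ind: _ => //; [exact: pbasis0 | move=> ? ?; exact: pbasisD]. Qed.

Lemma pbasisM a b : pbasis a -> pbasis b -> pbasis (a * b).
Proof.
move=> [u ->] [v ->]; rewrite mulr_suml; apply: pbasis_sum => i _.
rewrite mulr_sumr; apply: pbasis_sum => j _.
by rewrite mulrACA -exprMn -exprD; apply: pbasis_mono.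
Qed.

Lemma pbasis1 : pbasis 1.
Proof. by have := pbasis_frob 1; rewrite expr1n. Qed.

Lemma pbasis_s : pbasis s.
Proof. by have := pbasis_mono 1 1; rewrite expr1n mul1r. Qed.

Lemma pbasisX a n : pbasis a -> pbasis (a ^+ n).
Proof.
by move=> ha; elim: n => [|n IH]; [exact: pbasis1 | rewrite exprS; exact: pbasisM].
Qed.

Lemma pbasisV a : pbasis a -> pbasis a^-1.
Proof.
move=> ha; have [->|a0] := eqVneq a 0; first by rewrite invr0; apply: pbasis0.
have -> : a^-1 = a^-1 ^+ p * a ^+ p.-1.
  have := prime_gt0 p_pr; case: (p) => // q _ /=.
  by rewrite exprSr mulrC mulrA -exprMn divff // expr1n mul1r.
by apply: pbasisM; [exact: pbasis_frob | exact: pbasisX].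
Qed.

End PBasis.

(** * The Cartier operator attached to a p-basis *)

Section CartierOperator.
Variables (k F : fieldType) (c : {rmorphism k -> F}) (p : nat) (s : F) (D : F -> F^o).
Hypotheses (p_pr : prime p) (charF : p \in [pchar F]).
Hypotheses (HD : derivation c D) (Ds : D s = 1).
Hypothesis pb : forall a, pbasis p s a.

Let DD a b : D (a + b) = D a + D b. Proof. exact: derivationD HD a b. Qed.
Let DM a b : D (a * b) = a * D b + b * D a. Proof. exact: derivationM HD a b. Qed.

Lemma der0 : D 0 = 0.
Proof. by have := DD 0 0; rewrite addr0 -{1}[D 0]addr0 => /addrI. Qed.

Lemma der_sum (I : Type) (r : seq I) (P : pred I) (E : I -> F) :
  D (\sum_(i <- r | P i) E i) = \sum_(i <- r | P i) D (E i).
Proof. by apply: (big_morph D DD der0). Qed.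

Lemma derX a n : D (a ^+ n) = n%:R * a ^+ n.-1 * D a.
Proof.
elim: n => [|n IH].
  rewrite expr0 !mul0r; have := DM 1 1; rewrite !mul1r -{1}[D 1]addr0 => /addrI.
  by move=> <-.
rewrite exprS DM IH /= -[n.+1]addn1 natrD.
by case: n {IH} => [|n] /=; rewrite ?exprS; ring.
Qed.

Lemma der_frob a : D (a ^+ p) = 0.
Proof. by rewrite derX (pcharf0 charF) !mul0r. Qed.

Lemma der_frobM a b : D (a ^+ p * b) = a ^+ p * D b.
Proof. by rewrite DM der_frob mulr0 addr0. Qed.

Lemma natr_neq0 n : (0 < n < p)%N -> n%:R != 0 :> F.
Proof.
move=> /andP[n0 np]; rewrite -(dvdn_pcharf charF); apply/negP => d.
by have := dvdn_leq n0 d; rewrite leqNgt np.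
Qed.

Lemma der_nat n : D n%:R = 0.
Proof. by rewrite -(rmorph_nat c) (derivation_const HD). Qed.

(** Applying D turns a relation with n + 1 terms into one with n terms, whose new factors i + 1 < p
    are invertible. Constants of D, rather than p-th powers, keep the induction simple. *)
Lemma der_const_indep n (u : nat -> F) : (n <= p)%N -> (forall i, D (u i) = 0) ->
  \sum_(i < n) u i * s ^+ i = 0 -> forall i, (i < n)%N -> u i = 0.
Proof.
elim: n u => // n IH u np Du e.
have De : \sum_(i < n) (u i.+1 * i.+1%:R) * s ^+ i = 0.
  have := congr1 D e; rewrite der_sum der0 big_ord_recl /= expr0 mulr1 Du add0r => e'.
  rewrite -[RHS]e'; apply: eq_bigr => i _.
  by rewrite /bump leq0n add1n DM Du mulr0 addr0 derX Ds mulr1 mulrA.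
have H i : (i < n)%N -> u i.+1 = 0.
  move=> lt; have D0 j : D (u j.+1 * j.+1%:R) = 0.
    by rewrite DM der_nat Du !mulr0 addr0.
  have /eqP := IH (fun i => u i.+1 * i.+1%:R) (ltnW np) D0 De i lt.
  have lt' : (0 < i.+1 < p)%N by rewrite /= (leq_trans _ np).
  by rewrite mulf_eq0 (negPf (natr_neq0 lt')) orbF => /eqP.
case=> [_|i]; last by rewrite ltnS; apply: H.
move: e; rewrite big_ord_recl big1 ?addr0 ?expr0 ?mulr1 // => i _.
by rewrite lift0 H ?mul0r.
Qed.

Lemma pbasis_uniq (b b' : 'I_p -> F) :
  \sum_(i < p) b i ^+ p * s ^+ i = \sum_(i < p) b' i ^+ p * s ^+ i -> b =1 b'.
Proof.
move=> e; pose d (j : nat) : F := if insub j is Some i then b i - b' i else 0.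
have dE (i : 'I_p) : d i = b i - b' i by rewrite /d valK.
move=> i; apply/eqP; rewrite -subr_eq0 -dE; suff : d i ^+ p == 0.
  by rewrite expf_eq0 prime_gt0.
apply/eqP; apply: (@der_const_indep p (fun j => d j ^+ p)) => //.
  by move=> j; apply: der_frob.
transitivity (\sum_(i < p) b i ^+ p * s ^+ i - \sum_(i < p) b' i ^+ p * s ^+ i);
  last by rewrite e subrr.
rewrite -sumrB; apply: eq_bigr => j _; rewrite dE -mulrBl; congr (_ * _).
by rewrite frobD // exprNn_pchar // pnatE.
Qed.

Lemma pb_exists a : exists b : {ffun 'I_p -> F},
  a == \sum_(i < p) b i ^+ p * s ^+ i.
Proof.
have [b ->] := pb a; exists [ffun i => b i]; apply/eqP.
by apply: eq_bigr => i _; rewrite ffunE.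
Qed.

Definition pcoord a : {ffun 'I_p -> F} := xchoose (pb_exists a).

Lemma pcoordE a : a = \sum_(i < p) pcoord a i ^+ p * s ^+ i.
Proof. exact/eqP/(xchooseP (pb_exists a)). Qed.

Lemma pcoord_uniq a (b : 'I_p -> F) :
  a = \sum_(i < p) b i ^+ p * s ^+ i -> pcoord a =1 b.
Proof. by move=> e; apply: pbasis_uniq; rewrite -pcoordE. Qed.

Let last_lt : (p.-1 < p)%N. Proof. by rewrite prednK ?prime_gt0. Qed.
Let last := Ordinal last_lt.

(** A function stands for its multiple of ds. As [pcoord] already holds p-th roots, this is the
    classical rule: the p-th root of the coefficient of s^(p-1). *)
Definition cartier_op (om : F^o) : F^o := pcoord om last.

Lemma cartier_opD om om' : cartier_op (om + om') = cartier_op om + cartier_op om'.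
Proof.
apply: (pcoord_uniq (b := fun i => pcoord om i + pcoord om' i)).
rewrite {1}(pcoordE om) {1}(pcoordE om') -big_split.
by apply: eq_bigr => i _; rewrite /= frobD // mulrDl.
Qed.

Lemma cartier_opZ (a : F) om : cartier_op (a ^+ p *: om) = a *: cartier_op om.
Proof.
apply: (pcoord_uniq (b := fun i => a * pcoord om i)).
rewrite {1}(pcoordE om) [LHS]mulr_sumr; apply: eq_bigr => i _.
by rewrite exprMn mulrA.
Qed.

Lemma cartier_op0 : cartier_op 0 = 0.
Proof. by have := cartier_opZ 0 0; rewrite scaler0 scale0r. Qed.

Lemma cartier_op_sum (I : Type) (r : seq I) (P : pred I) (E : I -> F) :
  cartier_op (\sum_(i <- r | P i) E i) = \sum_(i <- r | P i) cartier_op (E i).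
Proof. by apply: (big_morph cartier_op cartier_opD cartier_op0). Qed.

Lemma cartier_op_mono a (i : 'I_p) :
  cartier_op (a ^+ p * s ^+ i) = if i == last then a else 0.
Proof.
rewrite /cartier_op (@pcoord_uniq _ (fun j => if j == i then a else 0)).
  by rewrite eq_sym.
rewrite (bigD1 i) //= eqxx big1 ?addr0 // => j /negPf ->.
by rewrite expr0n gtn_eqF ?prime_gt0 // mul0r.
Qed.

Lemma cartier_op_exact a : cartier_op (D a) = 0.
Proof.
rewrite {1}(pcoordE a) der_sum cartier_op_sum big1 // => -[[|i] ip] _ /=.
  by rewrite expr0 mulr1 der_frob cartier_op0.
have ip' := ltnW ip; rewrite der_frobM derX Ds mulr1 /=.
set u := pcoord a _; have -> : u ^+ p * (i.+1%:R * s ^+ i)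
    = (i.+1%:R * u) ^+ p * s ^+ (Ordinal ip') by rewrite exprMn (frob_nat charF) /=; ring.
rewrite cartier_op_mono; case: eqP => // /(congr1 val) /= ei.
by have := ip; rewrite {1}ei prednK ?prime_gt0 // ltnn.
Qed.

Hypothesis p35 : p = 3%N \/ p = 5%N.

Let L a : F := a ^+ p.-1 * D a.

(* [((a + b) ^ p - a ^ p - b ^ p) / p] is an integral polynomial. *)
Lemma log_add_exact a b : exists e, L (a + b) = L a + L b + D e.
Proof.
case: p35 => pE; rewrite /L pE /=.
  by exists (a ^+ 2 * b + a * b ^+ 2); rewrite !(DD, DM, derX) /=; ring.
exists (a ^+ 4 * b + (a ^+ 3 * b ^+ 2 + a ^+ 3 * b ^+ 2)
  + (a ^+ 2 * b ^+ 3 + a ^+ 2 * b ^+ 3) + a * b ^+ 4).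
by rewrite !(DD, DM, derX) /=; ring.
Qed.

(** Exact forms being killed, [log_add_exact] makes the claim additive in a, which leaves the
    monomials u^p s^i. *)
Lemma cartier_op_log a : cartier_op (a ^+ p.-1 *: D a) = D a.
Proof.
change (cartier_op (L a) = D a).
have addP u v : cartier_op (L u) = D u -> cartier_op (L v) = D v ->
    cartier_op (L (u + v)) = D (u + v).
  move=> hu hv; have [e ->] := log_add_exact u v.
  by rewrite !cartier_opD hu hv cartier_op_exact addr0 DD.
have L0 : cartier_op (L 0) = D 0 by rewrite /L der0 mulr0 cartier_op0.
rewrite (pcoordE a); elim/big_rec: _ => [//|i u _ hu]; apply: addP => //.
rewrite /L der_frobM exprMn.
have pS (x : F) : x ^+ p = x ^+ p.-1 * x by rewrite -exprSr prednK ?prime_gt0.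
have -> : (pcoord a i ^+ p) ^+ p.-1 * (s ^+ i) ^+ p.-1 * (pcoord a i ^+ p * D (s ^+ i))
    = (pcoord a i ^+ p) ^+ p * ((s ^+ i) ^+ p.-1 * D (s ^+ i)).
  by rewrite [in RHS](pS (pcoord a i ^+ p)); ring.
rewrite [LHS]cartier_opZ; congr (_ * _); rewrite derX Ds mulr1.
case: i => [[|i] ip] /=; first by rewrite !mul0r mulr0 cartier_op0.
have -> : (s ^+ i.+1) ^+ p.-1 * (i.+1%:R * s ^+ i) = (i.+1%:R * s ^+ i) ^+ p * s ^+ last.
  rewrite exprMn (frob_nat charF) -mulrA mulrCA; congr (_ * _).
  rewrite -!exprM -!exprD /=; congr (s ^+ _).
  by have := prime_gt0 p_pr; case: (p) => // q _; rewrite /= mulnS mulSn; lia.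
by rewrite cartier_op_mono eqxx.
Qed.

Lemma cartier_op_cartier : cartier D p cartier_op.
Proof.
exact: Cartier cartier_opD cartier_opZ cartier_op_exact cartier_op_log.
Qed.

End CartierOperator.

Section PthRoot.
Variables (k : closedFieldType) (p : nat).
Hypothesis p_pr : prime p.

Lemma proot_exists (z : k) : exists r, r ^+ p == z.
Proof.
have : size ('X^p - z%:P : {poly k}) != 1%N.
  rewrite size_polyDl size_polyXn ?eqSS -?lt0n ?prime_gt0 //.
  by rewrite size_polyN (leq_ltn_trans (size_polyC_leq1 _)) // ltnS prime_gt0.
move=> /closed_rootP[r]; rewrite rootE hornerD hornerN hornerC hornerXn subr_eq0.
by exists r.
Qed.

Definition proot (z : k) : k := xchoose (proot_exists z).

Lemma prootK z : proot z ^+ p = z.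
Proof. exact/eqP/(xchooseP (proot_exists z)). Qed.

Lemma proot_eq0 z : (proot z == 0) = (z == 0).
Proof. by rewrite -{2}(prootK z) expf_eq0 prime_gt0. Qed.

Definition cartier_poly (P : {poly k}) : {poly k} :=
  \poly_(n < size P) proot P`_(p * n + p.-1).

Lemma cartier_poly_eq0 P :
  cartier_poly P = 0 <-> forall n, P`_(p * n + p.-1) = 0.
Proof.
split=> [e n|h]; last first.
  apply/polyP => n; rewrite coef_poly coef0 h; case: ifP => // _.
  by apply/eqP; rewrite proot_eq0.
have [lt|ge] := ltnP n (size P); last first.
  apply: nth_default; apply: leq_trans ge _.
  by apply: leq_trans (leq_addr _ _); rewrite leq_pmull ?prime_gt0.
have /(congr1 (fun q : {poly k} => q`_n)) := e.
by rewrite coef_poly lt coef0 => /eqP; rewrite proot_eq0 => /eqP.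
Qed.

End PthRoot.

(** * The Cartier operator on forms with polynomial coefficients *)

Section CartierOfForms.
Variables (k : closedFieldType) (F : fieldType) (c : {rmorphism k -> F}) (p : nat).
Variables (t y : F) (f : {poly k}).
Hypotheses (p_pr : prime p) (charF : p \in [pchar F]).
Hypothesis Hy : y ^+ p - y = evt c t f.
Notation ev := (evt c t).

Definition form (g : nat -> {poly k}) : F := \sum_(i < p) ev (g i) * y ^+ i.

Definition frob_part (g : nat -> {poly k}) (l : nat) : {poly k} :=
  \sum_(i < p) ((- f) ^+ (i - l) * g i) *+ 'C(i, l).

Lemma form_frob g : form g = \sum_(l < p) (y ^+ l) ^+ p * ev (frob_part g l).
Proof.
have yE : y = - ev f + y ^+ p by rewrite -Hy; ring.
under [RHS]eq_bigr => l _ do rewrite rmorph_sum mulr_sumr.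
rewrite exchange_big /=; apply: eq_bigr => i _.
rewrite {1}yE exprDn mulr_sumr (big_ord_widen _ (fun l => ev (g i) *
  ((- ev f) ^+ (i - l) * y ^+ p ^+ l *+ 'C(i, l))) (ltn_ord i)) big_mkcond /=.
apply: eq_bigr => l _; rewrite rmorphMn rmorphM rmorphXn rmorphN /= ltnS.
case: leqP => [li|lt]; last by rewrite bin_small // mulr0n mulr0.
by rewrite -!exprM (mulnC p) !mulrnAr; congr (_ *+ _); ring.
Qed.

Variables (Om : lmodType F) (d : F -> Om) (C : Om -> Om).
Hypotheses (Hd : derivation c d) (HC : cartier d p C).

Lemma derivation_X (a : F) n : d (a ^+ n) = (n%:R * a ^+ n.-1) *: d a.
Proof.
elim: n => [|n IH].
  by rewrite expr0 -(rmorph1 c) (derivation_const Hd) mul0r scale0r.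
rewrite exprS (derivationM Hd) IH scalerA -scalerDl /=; congr (_ *: _).
by case: n {IH} => [|n] /=; rewrite -?natr1 ?exprS; ring.
Qed.

Lemma derivation_cZ z a : d (c z * a) = c z *: d a.
Proof. by rewrite (derivationM Hd) (derivation_const Hd) scaler0 addr0. Qed.

Lemma C0 : C 0 = 0.
Proof. by have := cartierZ HC 0 0; rewrite scaler0 scale0r. Qed.

Lemma C_sum (I : Type) (r : seq I) (P : pred I) (E : I -> Om) :
  C (\sum_(i <- r | P i) E i) = \sum_(i <- r | P i) C (E i).
Proof. by apply: (big_morph C (cartierD HC) C0). Qed.

Lemma cartier_mono n : C (t ^+ n *: d t) =
  if (n %% p == p.-1)%N then t ^+ (n %/ p)%N *: d t else 0.
Proof.
rewrite {1}(divn_eq n p) exprD exprM -scalerA (cartierZ HC).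
have [->|np] := eqVneq; first by rewrite (cartier_log HC).
have np' : (0 < (n %% p).+1%N < p)%N.
  rewrite /= ltn_neqAle ltn_mod prime_gt0 // andbT; apply: contra_neq np => e.
  by rewrite -[in RHS]e.
have n0 := natr_neq0 charF np'.
have -> : t ^+ (n %% p)%N *: d t = d (c ((n %% p).+1%N%:R)^-1 * t ^+ (n %% p).+1%N).
  rewrite derivation_cZ derivation_X scalerA mulrA fmorphV rmorph_nat mulVf //.
  by rewrite mul1r.
by rewrite (cartier_exact HC) scaler0.
Qed.

Lemma cartier_evt P : C (ev P *: d t) = ev (cartier_poly p_pr P) *: d t.
Proof.
rewrite [ev P]evtE scaler_suml C_sum.
have E i : C ((c P`_i * t ^+ i) *: d t) = if (i %% p == p.-1)%N
    then (c (proot p_pr P`_i) * t ^+ (i %/ p)%N) *: d t else 0.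
  rewrite -scalerA -{1}(prootK p_pr P`_i) rmorphXn (cartierZ HC) cartier_mono.
  by case: ifP => _; rewrite ?scaler0 // scalerA.
under eq_bigr => i _ do rewrite E.
have pp := prime_gt0 p_pr.
transitivity (\sum_(n < size P) (c (proot p_pr P`_(p * n + p.-1)) * t ^+ n) *: d t).
  pose G i : Om := (c (proot p_pr P`_i) * t ^+ (i %/ p)%N) *: d t.
  have G0 i : (size P <= i)%N -> G i = 0.
    move=> le; have /eqP r0 : proot p_pr P`_i == 0 by rewrite proot_eq0 nth_default.
    by rewrite /G r0 rmorph0 mul0r scale0r.
  transitivity (\sum_(i < size P) \sum_(n < size P)
      if (i : nat) == (p * n + p.-1)%N then G i else 0).
    apply: eq_bigr => i _; case: ifPn => [/eqP ip|ip].
      have lt : (i %/ p < size P)%N by apply: leq_ltn_trans (leq_div _ _) (ltn_ord i).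
      have ei : (i : nat) = (p * (i %/ p) + p.-1)%N by rewrite {1}(divn_eq i p) ip mulnC.
      rewrite (bigD1 (Ordinal lt)) //= -ei eqxx big1 ?addr0 //.
      move=> n nn; case: eqP => // e; case/eqP: nn; apply/val_inj => /=.
      by rewrite e mulnC divnMDl // divn_small ?addn0 // prednK.
    rewrite big1 // => n _; case: eqP => // e; case/eqP: ip.
    by rewrite e mulnC modnMDl modn_small // prednK.
  rewrite exchange_big /=; apply: eq_bigr => n _.
  have En : ((p * n + p.-1) %/ p)%N = n.
    by rewrite mulnC divnMDl // divn_small ?addn0 // prednK.
  transitivity (G (p * n + p.-1)%N); last by rewrite /G En.
  have [lt|ge] := ltnP (p * n + p.-1) (size P); last first.
    rewrite G0 // big1 // => i _; case: eqP => // e.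
    by move: (ltn_ord i); rewrite e ltnNge ge.
  rewrite (bigD1 (Ordinal lt)) //= eqxx big1 ?addr0 // => i ni.
  by case: eqP => // e; case/eqP: ni; apply/val_inj.
rewrite -scaler_suml; congr (_ *: _).
rewrite /evt (@horner_coef_wide _ (size P)); last first.
  by rewrite size_map_poly size_poly.
by apply: eq_bigr => n _; rewrite coef_map coef_poly ltn_ord.
Qed.

Lemma cartier_form g : C (form g *: d t) =
  (\sum_(l < p) y ^+ l * ev (cartier_poly p_pr (frob_part g l))) *: d t.
Proof.
rewrite form_frob scaler_suml C_sum scaler_suml; apply: eq_bigr => l _.
by rewrite -scalerA (cartierZ HC) cartier_evt scalerA.
Qed.

End CartierOfForms.

(** * Regular differentials *)

Lemma scale_regular1 (F : fieldType) (a : F) : a *: (1 : F^o) = a.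
Proof. exact: mulr1. Qed.

Lemma scale_regular (F : fieldType) (a : F) (b : F^o) : a *: b = a * b.
Proof. by []. Qed.

Section DerivationTheory.
Variables (k F : fieldType) (c : {rmorphism k -> F}).
Variables (Om : lmodType F) (d : F -> Om).
Hypothesis Hd : derivation c d.

Lemma derivation0 : d 0 = 0.
Proof. by rewrite -(rmorph0 c) (derivation_const Hd). Qed.

Lemma derivation1 : d 1 = 0.
Proof. by rewrite -(rmorph1 c) (derivation_const Hd). Qed.

Lemma derivationN a : d (- a) = - d a.
Proof. by apply/eqP; rewrite -addr_eq0 -(derivationD Hd) addNr derivation0. Qed.

Lemma derivationB a b : d (a - b) = d a - d b.
Proof. by rewrite (derivationD Hd) derivationN. Qed.

Lemma derivation_sum (I : Type) (r : seq I) (P : pred I) (E : I -> F) :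
  d (\sum_(i <- r | P i) E i) = \sum_(i <- r | P i) d (E i).
Proof. by apply: (big_morph d (derivationD Hd) derivation0). Qed.

Lemma derivationV a : a != 0 -> d a^-1 = - a^-1 ^+ 2 *: d a.
Proof.
move=> a0; have : a^-1 *: d (a * a^-1) = 0 by rewrite divff // derivation1 scaler0.
rewrite (derivationM Hd) scalerDr !scalerA mulVf // scale1r => /eqP.
by rewrite addr_eq0 => /eqP ->; rewrite expr2 scaleNr.
Qed.

Lemma derivation_evt t h : d (evt c t h) = evt c t h^`() *: d t.
Proof.
elim/poly_ind: h => [|h z IH]; first by rewrite deriv0 !rmorph0 derivation0 scale0r.
rewrite derivD derivM derivX derivC addr0 mulr1 !rmorphD !rmorphM /= evtC !evtX.
rewrite (derivationD Hd) (derivation_const Hd) addr0 (derivationM Hd) IH.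
by rewrite scalerA -scalerDl addrC [t * _]mulrC.
Qed.

Variable D : F -> F^o.
Variable t : F.
Hypotheses (HD : derivation c D) (Dt : D t = 1).

(** The set of such a contains k[t] and is closed under the field operations, so the property is
    checked on generators of Y. *)
Definition spanned a := d a = D a *: d t.

End DerivationTheory.

Section Spanned.
Variables (k F : fieldType) (c : {rmorphism k -> F}).
Variables (Om : lmodType F) (d : F -> Om) (D : F -> F^o) (t : F).
Hypotheses (Hd : derivation c d) (HD : derivation c D) (Dt : D t = 1).
Notation spn := (spanned d D t).

Lemma spannedD a b : spn a -> spn b -> spn (a + b).
Proof.
by rewrite /spn (derivationD Hd) (derivationD HD) scalerDl => -> ->.
Qed.

Lemma spannedM a b : spn a -> spn b -> spn (a * b).
Proof.
rewrite /spn (derivationM Hd) (derivationM HD) => -> ->.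
by rewrite !scalerA -scalerDl.
Qed.

Lemma spannedV a : spn a -> spn a^-1.
Proof.
rewrite /spanned; have [->|a0] := eqVneq a 0; first by rewrite invr0.
by move=> e; rewrite (derivationV Hd) // (derivationV HD) // e scalerA.
Qed.

Lemma spanned_evt h : spn (evt c t h).
Proof.
by rewrite /spn (derivation_evt Hd) (derivation_evt HD) Dt scale_regular1.
Qed.

Lemma spanned_sum (I : Type) (r : seq I) (P : pred I) (E : I -> F) :
  (forall i, P i -> spn (E i)) -> spn (\sum_(i <- r | P i) E i).
Proof.
move=> h; elim/big_ind: _ => //; last by move=> ? ?; exact: spannedD.
by rewrite /spn (derivation0 Hd) (derivation0 HD) scale0r.
Qed.

Lemma spannedX a n : spn a -> spn (a ^+ n).
Proof.
move=> ha; elim: n => [|n IH]; last by rewrite exprS; apply: spannedM.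
by rewrite /spanned expr0 (derivation1 Hd) (derivation1 HD) scale0r.
Qed.

End Spanned.

(** * Regularity at the pole of the coordinate *)

Section RegularForms.
Variables (k : closedFieldType) (p : nat) (Y : fieldExtType (P1 k)) (y : Y).
Variables (tau : P1 k) (f : {poly k}) (n : nat).
Notation K := (P1 k).
Notation cK := (P1_const k).
Notation c := (cover_const Y).
Notation t := (tau%:A : Y).
Notation ev := (evt c t).
Hypotheses (p_pr : prime p) (chark : p \in [pchar k]).
Hypothesis Hy : y ^+ p - y = (evt cK tau f)%:A.
Hypothesis dimY : \dim {:Y} = p.
Hypothesis genY : <<1; y>>%VS = fullv.
Hypothesis tau_inj : forall h : {poly k}, h != 0 -> evt cK tau h != 0.
Hypothesis tau_gen : forall b : K, exists n m : {poly k},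
  m != 0 /\ b = evt cK tau n / evt cK tau m.
Hypotheses (sf : size f = n.+1) (n0 : (0 < n)%N) (pn : ~~ (p %| n)%N).
Variable D : Y -> Y^o.
Hypotheses (HD : derivation c D) (Dt : D t = 1).

Let Hy' : y ^+ p - y = ev f. Proof. by rewrite evt_cover. Qed.
Let charY : p \in [pchar Y] := pchar_cover Y chark.

Lemma ev_neq0 h : h != 0 -> ev h != 0.
Proof. by move=> h0; rewrite evt_cover alg_neq0 tau_inj. Qed.

Section GeneralOm.
Variables (Om : lmodType Y) (d : Y -> Om).
Hypothesis Hd : derivation c d.

Lemma derivation_y : d y = - (ev f^`() *: d t).
Proof.
rewrite -(derivation_evt Hd) -Hy' (derivationB Hd) (derivation_X Hd).
by rewrite (pcharf0 charY) mul0r scale0r sub0r opprK.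
Qed.

End GeneralOm.

Lemma D_y : D y = - ev f^`().
Proof. by rewrite (derivation_y HD) Dt scale_regular1. Qed.

Lemma D_ev h : D (ev h) = ev h^`().
Proof. by rewrite (derivation_evt HD) Dt scale_regular1. Qed.

Lemma alg_ev (b : K) : exists n m : {poly k}, m != 0 /\ b%:A = ev n / ev m :> Y.
Proof.
have [u [m [m0 ->]]] := tau_gen b; exists u, m; split=> //.
by rewrite !evt_cover -[_%:A]/(in_alg Y _) fmorph_div.
Qed.

Lemma derivation_spanned (Om : lmodType Y) (d : Y -> Om) : derivation c d ->
  forall b, d b = D b *: d t.
Proof.
move=> Hd b; rewrite -/(spanned d D t b).
rewrite (coord_sum p_pr Hy genY b); apply: (spanned_sum Hd HD) => i _.
rewrite -[_ *: y ^+ i]mulr_algl; apply: (spannedM Hd HD).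
  have [u [m [m0 ->]]] := alg_ev (ycoord p_pr Hy genY b)`_i.
  apply: (spannedM Hd HD); first exact: spanned_evt.
  by apply: (spannedV Hd HD); apply: spanned_evt.
apply: (spannedX Hd HD).
by rewrite /spanned (derivation_y Hd) D_y scaleNr.
Qed.

Variable v : place c.

Section Infinite.
Hypothesis tneg : v t < 0.

Let vt : v t = - p%:Z.
Proof. by have [] := val_infinite p_pr chark Hy dimY genY tau_inj tau_gen sf n0 pn tneg. Qed.
Let vy : v y = - n%:Z.
Proof. by have [] := val_infinite p_pr chark Hy dimY genY tau_inj tau_gen sf n0 pn tneg. Qed.
Let t0 : t != 0.
Proof. by have := tau_neq_const Y tau_inj 0; rewrite rmorph0 subr0. Qed.
Let y0 : y != 0.
Proof. by apply: (y_neq0 p_pr Hy tau_inj sf). Qed.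

Lemma val_ev h : h != 0 -> v (ev h) = - (p%:Z * (size h).-1%:Z).
Proof.
by move=> h0; have [_ ->] := val_evt_neg t0 tneg h0; rewrite vt mulrN mulrC.
Qed.

Lemma size_deriv_f : f^`() != 0 /\ (size f^`()).-1 = n.-1.
Proof.
have lf : f^`()`_n.-1 != 0.
  rewrite coef_deriv prednK // -mulr_natr mulf_neq0 //.
    by rewrite -[n]/(n.+1.-1) -sf -lead_coefE lead_coef_eq0 -size_poly_gt0 sf.
  by rewrite -(dvdn_pcharf chark).
have d0 : f^`() != 0 by apply: contraNneq lf => ->; rewrite coef0.
split=> //; apply/eqP; rewrite eqn_leq; apply/andP; split.
  have f0 : f != 0 by rewrite -size_poly_gt0 sf.
  by have := lt_size_deriv f0; rewrite sf ltnS; clear -n0; move: (size _) => m; lia.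
rewrite leqNgt; apply: contraNN lf => lt; rewrite nth_default //.
by move: lt; rewrite -size_poly_gt0 in d0; case: (size _) d0 => // m _; lia.
Qed.

(** W = v(f') - v(y) is the value of the logarithmic derivative of y, the least amount by which D
    shifts values here. Then - (1 + W) = (p - 1)(n - 1) - 2 is the order of dt, the canonical
    degree. *)
Let W : int := n%:Z - p%:Z * n.-1%:Z.

Let Wp : W < p%:Z.
Proof. by rewrite /W; have := prime_gt1 p_pr; case: (n) n0 => // m _; nia. Qed.

Lemma vge_ev_deriv h : h != 0 -> vge v (v (ev h) + p%:Z) (ev h^`()).
Proof.
move=> h0; have [->|d0] := eqVneq h^`() 0; first by rewrite rmorph0 vge_0.
rewrite vgeE ?ev_neq0 // !val_ev //.
have := lt_size_deriv h0; move: d0 h0; rewrite -!size_poly_gt0.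
by move: (size h) (size h^`()) => i j; case: i => // i; case: j => // j _ _; nia.
Qed.

Lemma vge_D_alg (b : K) : b != 0 -> vge v (v b%:A + p%:Z) (D b%:A).
Proof.
have [u [m [m0 e]]] := alg_ev b; rewrite -(alg_neq0 Y) e => b0.
have u0 : u != 0 by apply: contraNneq b0 => ->; rewrite rmorph0 mul0r.
have eu := ev_neq0 u0; have em := ev_neq0 m0; have em' : (ev m)^-1 != 0 by rewrite invr_eq0.
rewrite pval_div // (derivationM HD) (derivationV HD) // !D_ev.
have hm : vge v p%:Z ((ev m)^-1 * ev m^`()).
  rewrite (_ : p%:Z = - v (ev m) + (v (ev m) + p%:Z)); last by ring.
  by apply: vgeM; [rewrite vgeE // pvalV | exact: vge_ev_deriv].
rewrite !scale_regular; apply: vgeD.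
  rewrite (_ : _ * _ = ev u / ev m * - ((ev m)^-1 * ev m^`())); last by ring.
  by apply: vgeM; [rewrite vgeE ?mulf_neq0 // pval_div | rewrite vgeN].
rewrite (_ : v (ev u) - v (ev m) + p%:Z = - v (ev m) + (v (ev u) + p%:Z)); last by ring.
by apply: vgeM; [rewrite vgeE // pvalV | exact: vge_ev_deriv].
Qed.

Lemma vge_nat m : vge v 0 (m%:R : Y).
Proof. by rewrite -(rmorph_nat c); apply: vge_const. Qed.

Lemma vge_D_infinite m b : vge v m b -> vge v (m + W) (D b).
Proof.
move=> hb; rewrite (coord_sum p_pr Hy genY b) (derivation_sum HD).
apply: vge_sum => i _.
have hi := vge_coord_infinite p_pr chark Hy dimY genY tau_inj tau_gen sf n0 pn tneg hb (ltn_ord i).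
have [->|bi] := eqVneq (ycoord p_pr Hy genY b)`_i 0.
  by rewrite scale0r (derivation0 HD) vge_0.
move: (ycoord _ _ _ _)`_i bi hi => bi bi0; rewrite -[_ *: y ^+ i]mulr_algl => hi.
have bA : bi%:A != 0 :> Y by rewrite alg_neq0.
rewrite (derivationM HD) (derivation_X HD) D_y; apply: vgeD.
  case: (nat_of_ord i) hi => [|j] hi; first by rewrite mul0r scale0r scaler0 vge_0.
  rewrite /= !scale_regular.
  rewrite (_ : _ * _ = j.+1%:R * (bi%:A * y ^+ j.+1) * (y^-1 * - ev f^`())); last first.
    by rewrite exprS; field.
  apply: vgeM; first by rewrite -[m]add0r; apply: vgeM => //; apply: vge_nat.
  rewrite /W; apply: vgeM; first by rewrite vgeE ?invr_eq0 // pvalV // vy opprK.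
  have [d0 sd] := size_deriv_f.
  by rewrite vgeN vgeE ?ev_neq0 // val_ev // sd.
rewrite scale_regular.
apply: (@vgeW _ _ _ _ _ (i%:Z * v y + (v bi%:A + p%:Z))).
  move: hi; rewrite vgeE ?mulf_neq0 ?expf_neq0 // pvalM ?expf_neq0 // pvalX //.
  by move=> le; apply: le_trans (lerD le (ltW Wp)) _; rewrite [X in X + _]addrC -addrA.
by apply: vgeM; [rewrite vgeE ?expf_neq0 // pvalX | exact: vge_D_alg].
Qed.

(** For u = y^i / t^z with p z - n i = 1, the logarithmic derivative is - (i f'/y + z/t); the first
    term has value W and dominates the second, of value at least p > W. *)
Lemma uniformizer_infinite : exists u, [/\ u != 0, v u = 1, D u != 0 & v (D u) = 1 + W].
Proof.
have [i [z [ip e]]] := bezout_ramified p_pr pn.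
have p1 := prime_gt1 p_pr.
have i0 : (0 < i)%N.
  case: i ip e => // _; rewrite mulr0 subr0 => e.
  by have := dvdz_mulr z (dvdzz p%:Z); rewrite e dvdz1 absz_nat => /eqP pE; rewrite pE in p1.
have z0 : 0 < z.
  rewrite ltNge; apply/negP => zle.
  have h1 : p%:Z * z <= 0 by rewrite pmulr_rle0 // ltz_nat ltnW.
  by move: e; rewrite -PoszM; lia.
case: i ip e i0 => // j ip e _; case: z e z0 => // -[//|z] e _.
pose u := y ^+ j.+1 / t ^+ z.+1.
have u0 : u != 0 by rewrite mulf_neq0 ?invr_eq0 ?expf_neq0.
have vu : v u = 1.
  by rewrite pval_div ?expf_neq0 // !pvalX // vy vt; lia.
have Du : D u = u * - (j.+1%:R * ev f^`() / y + z.+1%:R / t).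
  rewrite (derivationM HD) (derivationV HD) ?expf_neq0 // !(derivation_X HD) D_y Dt.
  rewrite !scale_regular /u /= !exprS; field.
  by rewrite y0 t0 expf_neq0.
have [d0 sd] := size_deriv_f.
have jn : j.+1%:R != 0 :> Y by apply: (natr_neq0 charY); rewrite /= ip.
have vj : v j.+1%:R = 0 by rewrite -(rmorph_nat c) pval_const // -(fmorph_eq0 c) rmorph_nat.
have q0 : j.+1%:R * ev f^`() / y != 0 by rewrite !mulf_neq0 ?invr_eq0 ?ev_neq0.
have vq : v (j.+1%:R * ev f^`() / y) = W.
  rewrite pval_div ?mulf_neq0 ?ev_neq0 // pvalM ?ev_neq0 // vj val_ev // vy sd /W.
  by ring.
have hz : vge v (v (j.+1%:R * ev f^`() / y) + 1) (z.+1%:R / t).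
  rewrite vq; apply: (@vgeW _ _ _ _ _ (0 + p%:Z)); first by rewrite add0r lezD1.
  apply: vgeM; first exact: vge_nat.
  by rewrite vgeE ?invr_eq0 // pvalV // vt opprK.
have [s0 vs] := pval_addl q0 hz.
exists u; split=> //; first by rewrite Du mulf_neq0 ?oppr_eq0.
by rewrite Du pvalM ?oppr_eq0 // pvalN // vs vq vu.
Qed.

Lemma regular_at_infinite (Om : lmodType Y) (d : Y -> Om) b : derivation c d ->
  vge v (1 + W) b -> regular_at d v (b *: d t).
Proof.
move=> Hd hb; have [u [u0 vu Du vDu]] := uniformizer_infinite.
exists u, (b / D u); split=> //; last first.
  by rewrite (derivation_spanned Hd u) scalerA mulfVK.
rewrite -[0](subrr (1 + W)); apply: vgeM => //.
by rewrite vgeE ?invr_eq0 // pvalV // vDu.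
Qed.

Lemma regular_at_infinite_inv (b : Y^o) : regular_at D v b -> vge v (1 + W) b.
Proof.
move=> [u [g [u0 vu g0 ->]]]; rewrite scale_regular -[1 + W]add0r.
by apply: vgeM => //; apply: vge_D_infinite; rewrite vgeE // vu.
Qed.

Lemma vge_mono_infinite h i : (i < p)%N -> h != 0 ->
  vge v (1 + W) (ev h * y ^+ i) = (size h * p <= (p.-1 - i) * n)%N.
Proof.
move=> ip h0; rewrite vgeE ?mulf_neq0 ?expf_neq0 ?ev_neq0 //.
rewrite pvalM ?expf_neq0 ?ev_neq0 // pvalX // val_ev // vy /W.
move: h0; rewrite -size_poly_gt0; case: (size h) => // s _ /=.
have [j ej] : exists j, p = (i + j).+1.
  by exists (p - i.+1)%N; rewrite -addSn subnKC.
have -> : (p.-1 - i = j)%N by rewrite ej /= addKn.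
(* The values give a strict inequality; equality is impossible since p divides neither n nor any j
   with 0 < j < p, so the weak inequality of the statement is equivalent. *)
have ne : (s.+1 * p)%N != (j * n)%N.
  apply/negP => /eqP e; have : (p %| j * n)%N by rewrite -e dvdn_mull.
  rewrite Euclid_dvdM // (negPf pn) orbF => d.
  have : j = 0%N.
    apply/eqP; rewrite -leqn0 leqNgt; apply/negP => j0.
    by have := dvdn_leq j0 d; lia.
  by move=> j0; move: e; rewrite j0 mul0n; have := prime_gt0 p_pr; lia.
case: (n) n0 ne => // m _ ne /=.
have e1 : (s.+1 * p)%N%:Z = s%:Z * p%:Z + p%:Z by rewrite PoszM; lia.
have e2 : (j * m.+1)%N%:Z = (p%:Z - 1 - i%:Z) * m.+1%:Z by rewrite PoszM ej; lia.
have e3 : (s.+1 * p <= j * m.+1)%N = ((s.+1 * p)%N%:Z + 1 <= (j * m.+1)%N%:Z).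
  by rewrite lezD1 ltz_nat ltn_neqAle ne.
rewrite e3 e1 e2; apply/idP/idP; lia.
Qed.

End Infinite.
End RegularForms.

Section LocalRingsP1.
Variable k : closedFieldType.
Notation K := (P1 k).
Notation cK := (P1_const k).

Lemma frac_coprime (b : K) : exists n m : {poly k},
  [/\ m != 0, coprimep n m & b = tofrac n / tofrac m].
Proof.
have [n [m [m0 ->]]] := fracP b; pose g := gcdp n m.
have g0 : g != 0 by rewrite gcdp_eq0 negb_and m0 orbT.
exists (n %/ g), (m %/ g).
have En : n = n %/ g * g by rewrite divpK // dvdp_gcdl.
have Em : m = m %/ g * g by rewrite divpK // dvdp_gcdr.
have m'0 : m %/ g != 0 by apply: contraNneq m0 => e; rewrite Em e mul0r.
split=> //; first by apply: coprimep_div_gcd; rewrite m0 orbT.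
rewrite {1}En {1}Em !tofracM -mulf_div divff ?mulr1 //.
by rewrite tofrac_eq0.
Qed.

Lemma coprimep_nroot (n m : {poly k}) a : coprimep n m -> root m a -> ~~ root n a.
Proof.
move=> nm ma; apply/negP => na.
have : root (gcdp n m) a by rewrite root_gcd na ma.
by move: nm; rewrite /coprimep => /size_poly1P[z z0 ->]; rewrite rootC (negPf z0).
Qed.

Lemma ord_place_pole (n m : {poly k}) a : m != 0 -> coprimep n m -> root m a ->
  n != 0 /\ ord_place a (tofrac n / tofrac m) = - (mup a m)%:Z.
Proof.
move=> m0 nm ma; have na := coprimep_nroot nm ma.
have n0 : n != 0 by apply: contraNneq na => ->; rewrite root0.
by rewrite ord_placeE // mupNroot // sub0r.
Qed.

Lemma mup_gt0 (m : {poly k}) a : m != 0 -> root m a -> (0 < mup a m)%N.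
Proof. by move=> m0 ma; rewrite -XsubC_dvd // dvdp_XsubCl. Qed.

Lemma vge_ord_nroot (n m : {poly k}) a : m != 0 -> coprimep n m ->
  vge (ord_place a) 0 (tofrac n / tofrac m : K) -> ~~ root m a.
Proof.
move=> m0 nm h; apply/negP => ma; have [n0 e] := ord_place_pole m0 nm ma.
have nz : tofrac n / tofrac m != 0 :> K by rewrite mulf_neq0 ?invr_eq0 ?tofrac_eq0.
by move: h; rewrite vgeE // e; have := mup_gt0 m0 ma; lia.
Qed.

Lemma residue_K (b : K) a : vge (ord_place a) 0 b ->
  exists r, vge (ord_place a) 1 (b - cK r).
Proof.
have [n [m [m0 nm ->]]] := frac_coprime b => h; have ma := vge_ord_nroot m0 nm h.
exists (n.[a] / m.[a]); have m1 : tofrac m != 0 :> K by rewrite tofrac_eq0.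
have -> : tofrac n / tofrac m - cK (n.[a] / m.[a])
    = tofrac (n - (n.[a] / m.[a]) *: m) * (tofrac m)^-1.
  by rewrite tofracB mulrBl -mul_polyC tofracM mulfK.
rewrite -[1]addr0; apply: vgeM.
  by apply: vge_tofrac_root; rewrite rootE !hornerE divfK ?subrr.
rewrite vgeE ?invr_eq0 // pvalV // -[tofrac m]divr1 -tofrac1.
by rewrite ord_placeE ?oner_neq0 // mupNroot // mup_const ?oner_neq0.
Qed.

Lemma integral_K (b : K) : (forall a, vge (ord_place a) 0 b) -> exists h, b = tofrac h.
Proof.
have [n [m [m0 nm ->]]] := frac_coprime b => h.
have : size m == 1%N.
  apply: contraTT isT => /closed_rootP[a ma].
  by case/negP: (vge_ord_nroot m0 nm (h a)).
case/size_poly1P => z z0 ->; exists (z^-1 *: n).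
have z1 : tofrac z%:P != 0 :> K by rewrite tofrac_eq0 polyC_eq0.
by apply: (canLR (mulfK z1)); rewrite -tofracM -mul_polyC mulrAC -polyCM mulVf // mul1r.
Qed.

End LocalRingsP1.

(** * Regularity at finite points *)

Section FiniteRegularity.
Variables (k : closedFieldType) (p : nat) (Y : fieldExtType (P1 k)) (y : Y).
Variables (tau : P1 k) (f : {poly k}) (n : nat).
Notation K := (P1 k).
Notation cK := (P1_const k).
Notation c := (cover_const Y).
Notation t := (tau%:A : Y).
Notation ev := (evt c t).
Hypotheses (p_pr : prime p) (chark : p \in [pchar k]).
Hypothesis Hy : y ^+ p - y = (evt cK tau f)%:A.
Hypothesis dimY : \dim {:Y} = p.
Hypothesis genY : <<1; y>>%VS = fullv.
Hypothesis tau_inj : forall h : {poly k}, h != 0 -> evt cK tau h != 0.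
Hypothesis tau_gen : forall b : K, exists n m : {poly k},
  m != 0 /\ b = evt cK tau n / evt cK tau m.
Hypotheses (sf : size f = n.+1) (n0 : (0 < n)%N) (pn : ~~ (p %| n)%N).
Variable D : Y -> Y^o.
Hypotheses (HD : derivation c D) (Dt : D t = 1).

Let charY : p \in [pchar Y] := pchar_cover Y chark.

Section OneDerivation.
Variables (Om : lmodType Y) (d : Y -> Om).
Hypothesis Hd : derivation c d.

Lemma regular_at_finite (v : place c) a b : vge v 1 (t - c a) -> vge v 0 b ->
  regular_at d v (b *: d t).
Proof.
move=> ta hb; exists (t - c a), b; split=> //.
- exact: tau_neq_const.
- exact: (val_finite p_pr chark Hy dimY genY tau_inj tau_gen ta).
by rewrite (derivationB Hd) (derivation_const Hd) subr0.
Qed.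

Lemma form_regular (g : nat -> {poly k}) :
  (forall i, (i < p)%N -> (size (g i) * p <= (p.-1 - i) * n)%N) ->
  Defs.regular c d (form c p t y g *: d t).
Proof.
move=> hg v; case: (place_cover_cases p_pr chark Hy dimY genY tau_inj tau_gen v).
  move=> tneg; apply: (regular_at_infinite p_pr chark Hy dimY genY tau_inj tau_gen
    sf n0 pn HD Dt tneg Hd).
  apply: vge_sum => i _; have [->|gi] := eqVneq (g i) 0.
    by rewrite rmorph0 mul0r vge_0.
  by rewrite (vge_mono_infinite p_pr chark Hy dimY genY tau_inj tau_gen sf n0 pn tneg) ?hg.
move=> [a ta]; apply: (regular_at_finite ta); apply: vge_sum => i _.
have t0 : vge v 0 t.
  rewrite -(subrK (c a) t); apply: vgeD; last exact: vge_const.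
  exact: vgeW ta.
apply: vge0M; first exact: vge_evt.
by apply: vge0X; apply: (vge_y p_pr chark Hy ta).
Qed.

End OneDerivation.

Lemma pbasis_const (s : Y) z : pbasis p s (c z).
Proof. by rewrite -(prootK p_pr z) rmorphXn; apply: pbasis_frob. Qed.

Lemma pbasis_cover a b : pbasis p (t - c a) b.
Proof.
have pt : pbasis p (t - c a) t.
  rewrite -{2}(subrK (c a) t); apply: pbasisD => //; last exact: pbasis_const.
  exact: pbasis_s.
have pev h : pbasis p (t - c a) (ev h).
  rewrite evtE; apply: (pbasis_sum p_pr charY) => i _; apply: (pbasisM p_pr charY).
    exact: pbasis_const.
  exact: (pbasisX p_pr charY).
have py : pbasis p (t - c a) y.
  have -> : y = y ^+ p - ev f by rewrite evt_cover -Hy; ring.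
  apply: (pbasisD p_pr charY); first exact: pbasis_frob.
  by have := pev (- f); rewrite rmorphN.
rewrite (coord_sum p_pr Hy genY b); apply: (pbasis_sum p_pr charY) => i _.
rewrite -[_ *: y ^+ i]mulr_algl; apply: (pbasisM p_pr charY).
  have [u [m [m0 ->]]] := alg_ev Y tau_gen (ycoord p_pr Hy genY b)`_i.
  by apply: (pbasisM p_pr charY) => //; apply: (pbasisV p_pr charY).
exact: (pbasisX p_pr charY).
Qed.

(** Expand b as a sum of u_i^p s^i with s = t - a a uniformizer. The values p v(u_i) + i are
    distinct, so every term is integral, hence so is each u_i; D acts only on the powers of s. *)
Lemma vge_D_finite (v : place c) a b : vge v 1 (t - c a) -> vge v 0 b -> vge v 0 (D b).
Proof.
move=> ta hb; have vs := val_finite p_pr chark Hy dimY genY tau_inj tau_gen ta.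
have s0 := tau_neq_const Y tau_inj a.
have Ds : D (t - c a) = 1.
  by rewrite (derivationB HD) (derivation_const HD) subr0.
have [u e] := pbasis_cover a b; move: vs s0 Ds e; set s := t - c a => vs s0 Ds e.
have val i : u i != 0 -> v (u i ^+ p * s ^+ i) = p%:Z * v (u i) + i%:Z.
  by move=> ui; rewrite pvalM ?expf_neq0 // !pvalX // vs mulr1.
have h i : vge v 0 (u i ^+ p * s ^+ i).
  apply: (@vge_sum_distinct _ _ _ v _ (fun i : 'I_p => u i ^+ p * s ^+ i)); last by rewrite -e.
  move=> i1 i2 ne; rewrite !mulf_eq0 !expf_eq0 (prime_gt0 p_pr) !negb_or /=.
  move=> /andP[u1 _] /andP[u2 _]; rewrite !val //; apply: contra_neq ne => E.
  apply/val_inj; apply: (@distinct_weights p 1 i1 i2 (- v (u i1)) (- v (u i2))) => //.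
    by rewrite dvdn1 gtn_eqF // prime_gt1.
  by rewrite !mulrN !mul1r -!opprD E.
rewrite e (derivation_sum HD); apply: vge_sum => i _.
rewrite (derivationM HD) (derivation_X HD (u i)) (pcharf0 charY) mul0r scale0r scaler0 addr0.
rewrite (derivation_X HD) Ds scale_regular1 scale_regular mulrCA.
apply: vge0M; first by rewrite -(rmorph_nat c); apply: vge_const.
apply: vge0M; last by apply: vge0X; rewrite vgeE // vs.
apply: vge0X; have [->|ui] := eqVneq (u i) 0; first exact: vge_0.
have := h i; rewrite !vgeE ?mulf_neq0 ?expf_neq0 // val //.
by have := ltn_ord i; move: (nat_of_ord i) (v _) => j w; nia.
Qed.

Lemma regular_at_finite_inv (v : place c) a (b : Y^o) : vge v 1 (t - c a) ->
  regular_at D v b -> vge v 0 b.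
Proof.
move=> ta [u [g [u0 vu g0 ->]]]; rewrite scale_regular; apply: vge0M => //.
by apply: (vge_D_finite ta); rewrite vgeE // vu.
Qed.

End FiniteRegularity.

(** * Regular differentials have polynomial coefficients *)

Section RegularFormsAreForms.
Variables (k : closedFieldType) (p : nat) (Y : fieldExtType (P1 k)) (y : Y).
Variables (f : {poly k}) (n : nat).
Notation K := (P1 k).
Notation cK := (P1_const k).
Notation c := (cover_const Y).
Notation x := (P1_x k).
Notation t := (x%:A : Y).
Notation ev := (evt c t).
Hypotheses (p_pr : prime p) (chark : p \in [pchar k]).
Hypothesis Hy : y ^+ p - y = (tofrac f : K)%:A.
Hypothesis dimY : \dim {:Y} = p.
Hypothesis genY : <<1; y>>%VS = fullv.
Hypotheses (sf : size f = n.+1) (n0 : (0 < n)%N) (pn : ~~ (p %| n)%N).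

Lemma x_inj (h : {poly k}) : h != 0 -> evt cK x h != 0.
Proof. by move=> h0; rewrite evt_P1_x tofrac_eq0. Qed.

Lemma x_gen (b : K) : exists u m : {poly k}, m != 0 /\ b = evt cK x u / evt cK x m.
Proof. by have [u [m [m0 ->]]] := fracP b; exists u, m; rewrite !evt_P1_x. Qed.

Lemma Hyx : y ^+ p - y = (evt cK x f)%:A.
Proof. by rewrite evt_P1_x. Qed.

Let charY : p \in [pchar Y] := pchar_cover Y chark.
Notation ycoordY := (ycoord p_pr Hy genY).

Section OnePoint.
Variable a : k.
Notation w := (ord_place a).
Notation uplace za := (unram_place p_pr chark Hy dimY genY za).

Lemma pbasis_root : exists z : k, z ^+ p - z = f.[a].
Proof.
have : size ('X^p - 'X - (f.[a])%:P : {poly k}) != 1%N.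
  rewrite -addrA size_polyDl size_polyXn ?eqSS -?lt0n ?prime_gt0 //.
  by rewrite -opprD size_polyN size_XaddC ltnS prime_gt1.
move=> /closed_rootP[r]; rewrite rootE !hornerD !hornerN hornerC hornerXn hornerX.
by rewrite subr_eq0 => /eqP <-; exists r.
Qed.

Lemma unram_place_x z (za : z ^+ p - z = f.[a]) : vge (uplace za) 1 (t - c a).
Proof.
rewrite -[t]/(in_alg Y x) -[c a]/(in_alg Y (cK a)) -rmorphB.
have xa := P1_x_neq_const a; rewrite vgeE ?fmorph_eq0 //.
rewrite (unram_place_alg p_pr chark Hy dimY genY za xa).
by have := vge_xa a; rewrite vgeE.
Qed.

Lemma vge_unram_alg z (za : z ^+ p - z = f.[a]) m (b : K) :
  vge w m b -> vge (uplace za) m b%:A.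
Proof.
have [->|b0] := eqVneq b 0; first by move=> _; rewrite scale0r; apply: vge_0.
by rewrite !vgeE ?alg_neq0 // (unram_place_alg p_pr chark Hy dimY genY za b0).
Qed.

(** At the points above a the residue of y runs through all p roots of z^p - z = f(a), so the
    polynomial with coefficients r, of degree below p, has p roots. *)
Lemma residues_vanish (r : 'I_p -> k) :
  (forall z (za : z ^+ p - z = f.[a]), vge (uplace za) 1 (\sum_i c (r i) * y ^+ i)) ->
  forall i, r i = 0.
Proof.
move=> h; pose R : {poly k} := \sum_(i < p) r i *: 'X^i.
have sR : (size R <= p)%N.
  apply: (leq_trans (size_sum _ _ _)); apply/bigmax_leqP => i _.
  by rewrite (leq_trans (size_scale_leq _ _)) // size_polyXn.
have rootR z (za : z ^+ p - z = f.[a]) : root R z.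
  set v := uplace za; have yz : vge v 1 (y - c z).
    exact: (unram_place_y p_pr chark Hy dimY genY za).
  have y0 : vge v 0 y.
    by rewrite -(subrK (c z) y); apply: vgeD; [apply: vgeW yz | apply: vge_const].
  have : vge v 1 (c R.[z]).
    have -> : c R.[z] = \sum_(i < p) c (r i) * y ^+ i
        - \sum_(i < p) c (r i) * (y ^+ i - c z ^+ i).
      rewrite -sumrB horner_sum rmorph_sum; apply: eq_bigr => i _.
      by rewrite hornerZ hornerXn rmorphM rmorphXn /=; ring.
    apply: vgeB; first exact: h.
    apply: vge_sum => i _; rewrite -[1]add0r; apply: vgeM; first exact: vge_const.
    by apply: vge_subX; [exact: y0 | exact: vge_const | exact: yz].
  rewrite rootE; apply: contraTT => Rz.
  by rewrite vgeE ?fmorph_eq0 // pval_const.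
have R0 : R = 0.
  apply/eqP; apply: contraTT isT => R0.
  have [z za] := pbasis_root.
  have := max_poly_roots R0 (_ : all (root R) [seq z + (j : nat)%:R | j <- iota 0 p]) _.
  rewrite size_map size_iota => H.
  have pn' : [pchar k].-nat p by rewrite pnatE.
  suff : (p < size R)%N by rewrite ltnNge sR.
  apply: H.
    apply/allP => _ /mapP[j _ ->]; apply: rootR.
    rewrite exprDn_pchar // (frob_nat chark); rewrite -za; ring.
  rewrite map_inj_in_uniq ?iota_uniq // => i j; rewrite !mem_iota !add0n /=.
  move=> ip jp /addrI; wlog ij : i j ip jp / (i <= j)%N => [W|] e.
    by case/orP: (leq_total i j) => le; [apply: W | apply/esym; apply: W].
  apply/eqP; rewrite eqn_leq ij -subn_eq0 /=; apply: contraTT isT => d.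
  have ji : (0 < j - i < p)%N by rewrite lt0n d /=; lia.
  by have := natr_neq0 chark ji; rewrite natrB // e subrr eqxx.
move=> i; have := congr1 (fun q : {poly k} => q`_i) R0.
rewrite coef0 /R coef_sum (bigD1 i) //= coefZ coefXn eqxx mulr1 big1 ?addr0 // => j ji.
rewrite coefZ coefXn; case: eqP => [/val_inj e|_]; rewrite ?mulr0 //.
by rewrite e eqxx in ji.
Qed.

(** Descent on a common bound m + 1 for the pole orders of the coordinates: after multiplication by
    (x - a)^(m+1) they are integral and their residues vanish, so m already bounds the pole
    orders. *)
Lemma coord_integral b :
  (forall z (za : z ^+ p - z = f.[a]), vge (uplace za) 0 b) ->
  forall i, vge w 0 (ycoordY b)`_i.
Proof.
move=> hb; have [m0 hm0] := coef_bound a (ycoordY b).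
have : forall i, vge w (- `|m0|%N%:Z) (ycoordY b)`_i.
  by move=> i; apply: vgeW (hm0 i); lia.
elim: `|m0|%N => [//|m IH] hm; apply: IH => i.
pose e : K := (x - cK a) ^+ m.+1.
have xa0 := P1_x_neq_const a; have e0 : e != 0 by rewrite expf_neq0.
have xa1 : w (x - cK a) = 1.
  by have [] := same_ord_place (vge_xa a).
have we : w e = m.+1%:Z by rewrite (pvalX w m.+1 xa0) xa1 mulr1.
have eint j : vge w 0 (e * (ycoordY b)`_j).
  rewrite -[0](subrr m.+1%:Z); apply: vgeM; last exact: hm.
  by rewrite (vgeE _ _ e0) we lexx.
have [r hr] := fin_all_exists (fun j : 'I_p => residue_K (eint j)).
have r0 : forall j, r j = 0.
  apply: residues_vanish => z za; set v := uplace za.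
  have y0 : vge v 0 y by apply: (vge_y p_pr chark Hyx (unram_place_x za)).
  have -> : \sum_j c (r j) * y ^+ j = e%:A * b
      - \sum_(j < p) (e * (ycoordY b)`_j - cK (r j))%:A * y ^+ j.
    rewrite {1}(coord_sum p_pr Hy genY b) mulr_sumr -sumrB; apply: eq_bigr => j _.
    have -> : (e * (ycoordY b)`_j - cK (r j))%:A
        = e%:A * ((ycoordY b)`_j)%:A - c (r j) :> Y by rewrite scalerBl algM.
    by rewrite -[_ *: y ^+ j]mulr_algl; ring.
  apply: vgeB.
    rewrite -[1]addr0; apply: vgeM; last exact: hb.
    by apply: vge_unram_alg; rewrite (vgeE _ _ e0) we.
  apply: vge_sum => j _; rewrite -[1]addr0; apply: vgeM; last exact: vge0X.
  exact: vge_unram_alg.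
have [lt|ge] := ltnP i p; last first.
  rewrite nth_default ?vge_0 //.
  by apply: leq_trans ge; apply: size_coord.
have := hr (Ordinal lt); rewrite r0 rmorph0 subr0 /=.
have [->|bi] := eqVneq (ycoordY b)`_i 0; first by rewrite vge_0.
rewrite (vgeE _ _ (mulf_neq0 e0 bi)) (vgeE _ _ bi) (pvalM w e0 bi) we.
by move: (w _) => u; lia.
Qed.

End OnePoint.

Variable D : Y -> Y^o.
Hypotheses (HD : derivation c D) (Dt : D t = 1).

Lemma alg_tofrac h : (tofrac h : K)%:A = ev h :> Y.
Proof. by rewrite evt_cover evt_P1_x. Qed.

Lemma regular_is_form (om : Y^o) : (exists v : place c, v t < 0) ->
  Defs.regular c D om ->
  exists2 g : nat -> {poly k}, om = form c p t y g &
    forall i, (i < p)%N -> (size (g i) * p <= (p.-1 - i) * n)%N.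
Proof.
move=> [v tneg] reg.
have int i a : vge (ord_place a) 0 (ycoordY om)`_i.
  apply: coord_integral => z za.
  exact: (regular_at_finite_inv p_pr chark Hyx dimY genY x_inj x_gen sf n0 pn HD Dt
    (unram_place_x za) (reg _)).
have [g hg] := fin_all_exists (fun i : 'I_p => integral_K (int i)).
pose g' i := if insub i is Some j then g j else 0.
have g'E (i : 'I_p) : g' i = g i by rewrite /g' valK.
have omE : om = form c p t y g'.
  rewrite {1}(coord_sum p_pr Hy genY om); apply: eq_bigr => i _.
  by rewrite g'E hg -[_ *: y ^+ i]mulr_algl alg_tofrac.
exists g' => // i ip; have [->|gi] := eqVneq (g' i) 0; first by rewrite size_poly0.
rewrite -(vge_mono_infinite p_pr chark Hyx dimY genY x_inj x_gen sf n0 pn tneg ip gi).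
have hom := regular_at_infinite_inv p_pr chark Hyx dimY genY x_inj x_gen sf n0 pn HD Dt tneg (reg v).
have := vge_coord_infinite p_pr chark Hyx dimY genY x_inj x_gen sf n0 pn tneg hom ip.
(* [ycoord] depends on the proof of the equation; uniqueness of coordinates identifies the versions
   for [tofrac f] and for f evaluated at x. *)
have -> : ycoord p_pr Hyx genY om = ycoordY om.
  apply: (coord_uniq p_pr Hyx dimY genY); first exact: size_coord.
  exact: coordK.
by rewrite (hg (Ordinal ip)) -(g'E (Ordinal ip)) -[_ *: y ^+ i]mulr_algl alg_tofrac.
Qed.

End RegularFormsAreForms.

(** * The a-number as the nullity of a matrix *)

Section CartierMatrix.
Variables (k : closedFieldType) (p n : nat) (f : {poly k}).
Hypothesis p_pr : prime p.

Definition dim_bound i := ((p.-1 - i) * n %/ p)%N.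

Definition form_index : finType := {x : ('I_p * 'I_n)%type | (x.2 < dim_bound x.1)%N}.
Definition cond_index : finType := ('I_p * 'I_n)%type.

(* The contribution of the form X^a y^i dt, x = (i, a), to the condition s = (l, b). *)
Definition cartier_coef (x : ('I_p * 'I_n)%type) (s : cond_index) : k :=
  ((- f) ^+ (x.1 - s.1) * 'X^(x.2))`_(p * s.2 + p.-1) *+ 'C(x.1, s.1).

Definition fidx (r : 'I_#|form_index|) : ('I_p * 'I_n)%type := val (enum_val r).

Definition cartier_mx : 'M[k]_(#|form_index|, #|cond_index|) :=
  \matrix_(r, s) cartier_coef (fidx r) (enum_val s).

Definition nullity : nat := \rank (kermx cartier_mx).

Definition poly_of_row (u : 'rV[k]_#|form_index|) (i : nat) : {poly k} :=
  \sum_(r < #|form_index|) (if (fidx r).1 == i :> nat then u 0 r *: 'X^((fidx r).2) else 0).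

Lemma size_poly_of_row u i : (i < p)%N -> (size (poly_of_row u i) * p <= (p.-1 - i) * n)%N.
Proof.
move=> ip; rewrite -leq_divRL ?prime_gt0 //.
apply: (leq_trans (size_sum _ _ _)); apply/bigmax_leqP => r _.
case: eqP => [e|_]; last by rewrite size_poly0.
apply: (leq_trans (size_scale_leq _ _)); rewrite size_polyXn.
by have := valP (enum_val r); rewrite /dim_bound e.
Qed.

Lemma poly_of_rowP (g : nat -> {poly k}) :
  (forall i, (i < p)%N -> (size (g i) * p <= (p.-1 - i) * n)%N) ->
  exists u, forall i, (i < p)%N -> poly_of_row u i = g i.
Proof.
move=> hg; exists (\row_r (g (fidx r).1)`_(fidx r).2) => i ip.
apply/polyP => a; rewrite coef_sum.
transitivity (\sum_(r < #|form_index|) (if ((fidx r).1 == i :> nat)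
    && ((fidx r).2 == a :> nat) then (g i)`_a else 0)).
  apply: eq_bigr => r _; case: eqP => [e|_] /=; last by rewrite coef0.
  by rewrite coefZ coefXn mxE e eq_sym; case: eqP => [->|]; rewrite ?mulr1 ?mulr0.
have [ha|ha] := boolP (a < dim_bound i)%N; last first.
  rewrite big1 => [|r _].
    by rewrite nth_default // leqNgt; apply: contra ha; move/leq_trans; apply; rewrite leq_divRL ?prime_gt0 ?hg.
  case: andP => // -[/eqP e1 /eqP e2]; case/negP: ha.
  by have := valP (enum_val r); rewrite e1 e2.
have an : (a < n)%N.
  apply: leq_trans ha _; rewrite /dim_bound -(@leq_pmul2r p) ?prime_gt0 //.
  apply: leq_trans (leq_trunc_div _ _) _; rewrite mulnC leq_mul2l; apply/orP; right.
  by have := prime_gt0 p_pr; lia.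
pose x0 : form_index := Sub (Ordinal ip, Ordinal an) ha.
rewrite (bigD1 (enum_rank x0)) //= /fidx enum_rankK /= !eqxx big1 ?addr0 // => r rx.
case: andP => // -[/eqP e1 /eqP e2]; case/eqP: rx; apply: (canRL (enum_valK)).
apply/val_inj; change (fidx r = (Ordinal ip, Ordinal an)).
by rewrite [LHS]surjective_pairing; congr (_, _); apply/val_inj.
Qed.

Lemma poly_of_rowD u v i : poly_of_row (u + v) i = poly_of_row u i + poly_of_row v i.
Proof.
rewrite /poly_of_row -big_split; apply: eq_bigr => r _ /=.
by rewrite mxE; case: ifP => _; rewrite ?addr0 // scalerDl.
Qed.

Lemma poly_of_rowZ z u i : poly_of_row (z *: u) i = z *: poly_of_row u i.
Proof.
rewrite /poly_of_row scaler_sumr; apply: eq_bigr => r _ /=.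
by rewrite mxE; case: ifP => _; rewrite ?scaler0 // scalerA.
Qed.

Lemma poly_of_row_inj u : (forall i, (i < p)%N -> poly_of_row u i = 0) -> u = 0.
Proof.
move=> h; apply/rowP => r; rewrite mxE.
have := h _ (ltn_ord (fidx r).1).
move/(congr1 (fun q : {poly k} => q`_(fidx r).2)).
rewrite coef0 coef_sum (bigD1 r) //= eqxx coefZ coefXn eqxx mulr1 big1 ?addr0 // => r' rr.
case: eqP => [e|_]; last by rewrite coef0.
rewrite coefZ coefXn; case: eqP => [e'|_]; last by rewrite mulr0.
case/eqP: rr; apply: enum_val_inj; apply/val_inj.
change (fidx r' = fidx r).
rewrite [LHS]surjective_pairing [RHS]surjective_pairing.
by congr (_, _); apply/val_inj.
Qed.

Lemma frob_part_row u (s : cond_index) :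
  (frob_part p f (poly_of_row u) s.1)`_(p * s.2 + p.-1) = (u *m cartier_mx) 0 (enum_rank s).
Proof.
rewrite mxE /frob_part coef_sum.
under eq_bigr => i _ do rewrite coefMn /poly_of_row mulr_sumr coef_sum -sumrMnl.
rewrite exchange_big /=; apply: eq_bigr => r _.
rewrite (bigD1 (fidx r).1) //= eqxx big1 ?addr0 => [|i ir]; last first.
  case: eqP => [/val_inj e|_]; first by rewrite e eqxx in ir.
  by rewrite mulr0 coef0 mul0rn.
by rewrite mxE enum_rankK /cartier_coef -scalerAr coefZ mulrnAr.
Qed.

Hypothesis sf : (size f <= n.+1)%N.

(** The matrix records only the conditions with j < n; for j >= n the exponent p j + p - 1 exceeds
    the degree of every term, by the size bounds on the layers. *)
Lemma kernel_row u : u *m cartier_mx = 0 <->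
  forall l, (l < p)%N -> forall j, (frob_part p f (poly_of_row u) l)`_(p * j + p.-1) = 0.
Proof.
split=> [e l lp j|h]; last first.
  by apply/rowP => s; rewrite [RHS]mxE -(enum_valK s) -frob_part_row h.
have [jn|jn] := ltnP j n.
  by rewrite (frob_part_row u (Ordinal lp, Ordinal jn)) e mxE.
rewrite nth_default //; apply: leq_trans (_ : (p * n <= _)%N); last first.
  by apply: leq_trans (leq_addr _ _); rewrite leq_mul2l jn orbT.
apply: (leq_trans (size_sum _ _ _)); apply/bigmax_leqP => i _.
rewrite -mulr_natr -polyC_natr mulrC mul_polyC; apply: leq_trans (size_scale_leq _ _) _.
have [->|g0] := eqVneq (poly_of_row u i) 0; first by rewrite mulr0 size_poly0.
have ip := ltn_ord i; have sg := size_poly_of_row u ip.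
apply: leq_trans (size_polyMleq _ _) _.
have se : (size ((- f) ^+ (i - l)) <= ((i - l) * n).+1)%N.
  apply: leq_trans (size_poly_exp_leq _ _) _; rewrite size_polyN ltnS mulnC leq_mul2l.
  by apply/orP; right; case: (size f) sf => // q; rewrite ltnS.
have le : (size (poly_of_row u i) <= (p.-1 - i) * n)%N.
  by apply: leq_trans sg; rewrite leq_pmulr ?prime_gt0.
apply: (@leq_trans ((i - l) * n + (p.-1 - i) * n)%N).
  move: se le; move: ((i - l) * n)%N ((p.-1 - i) * n)%N (size _) (size _) => a b a' b'.
  by clear; lia.
rewrite -mulnDl leq_mul2r; apply/orP; right; lia.
Qed.

End CartierMatrix.

(** * Comparison of the a-number with the nullity *)

Section ANumber.
Variables (k : closedFieldType) (p : nat) (Y : fieldExtType (P1 k)) (y : Y).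
Variables (tau : P1 k) (f : {poly k}) (n : nat).
Notation K := (P1 k).
Notation cK := (P1_const k).
Notation c := (cover_const Y).
Notation t := (tau%:A : Y).
Notation ev := (evt c t).
Hypotheses (p_pr : prime p) (chark : p \in [pchar k]).
Hypothesis Hy : y ^+ p - y = (evt cK tau f)%:A.
Hypothesis dimY : \dim {:Y} = p.
Hypothesis genY : <<1; y>>%VS = fullv.
Hypothesis tau_inj : forall h : {poly k}, h != 0 -> evt cK tau h != 0.
Hypothesis tau_gen : forall b : K, exists n m : {poly k},
  m != 0 /\ b = evt cK tau n / evt cK tau m.
Hypotheses (sf : size f = n.+1) (n0 : (0 < n)%N) (pn : ~~ (p %| n)%N).

Let charY : p \in [pchar Y] := pchar_cover Y chark.

Lemma Hy_ev : y ^+ p - y = ev f. Proof. by rewrite evt_cover. Qed.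

(** The extension of d/dx to Y is rescaled to take the value 1 at t, whichever coordinate tau is
    used. *)
Lemma exists_derivation : frac_der tau != 0 ->
  exists2 D : Y -> Y^o, derivation c D & D t = 1.
Proof.
move=> dt0; have cp := pchar_P1 chark.
pose D0 := der_ext p_pr Hy genY (@frac_der k : {additive K -> K}).
have D0t : D0 t = (frac_der tau)%:A.
  exact: (der_ext_alg p_pr cp Hy dimY genY (@frac_derM k)).
have D0D a b : D0 (a + b) = D0 a + D0 b by exact: der_extD.
have D0M a b : D0 (a * b) = a * D0 b + b * D0 a.
  exact: (der_extM p_pr cp Hy dimY genY (@frac_derM k)).
have D0c z : D0 (c z) = 0.
  have E : D0 (c z) = (frac_der (cK z))%:A.
    exact: (der_ext_alg p_pr cp Hy dimY genY (@frac_derM k) (cK z)).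
  by rewrite E frac_der_const scale0r.
have t0 : D0 t != 0 by rewrite D0t alg_neq0.
clearbody D0; exists (fun a => (D0 t)^-1 * D0 a); last by rewrite mulVf.
split=> [a b|a b|z].
- by rewrite D0D mulrDr.
- by rewrite D0M mulrDr (mulrCA _ a) (mulrCA _ b).
by rewrite D0c mulr0.
Qed.

Lemma ev_indep (h : nat -> {poly k}) :
  \sum_(i < p) ev (h i) * y ^+ i = 0 -> forall i, (i < p)%N -> h i = 0.
Proof.
move=> e i ip; apply: contraTeq (isT) => hi; apply/negP => _.
have := tau_inj hi; apply/negP; rewrite negbK.
pose G : {poly K} := \poly_(i < p) evt cK tau (h i).
suff G0 : G = 0.
  by have := congr1 (fun q : {poly K} => q`_i) G0; rewrite coef_poly ip coef0 => ->.
apply: (ev_inj dimY genY); first exact: size_poly.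
rewrite /evt (@horner_coef_wide _ p); last by rewrite size_map_poly size_poly.
rewrite -[RHS]e; apply: eq_bigr => j _.
by rewrite coef_map coef_poly ltn_ord evt_cover.
Qed.

Notation A := (cartier_mx p n f).
Notation Phi u := (form c p t y (poly_of_row u)).

Lemma form_ext g h : (forall i, (i < p)%N -> g i = h i) ->
  form c p t y g = form c p t y h.
Proof. by move=> e; apply: eq_bigr => i _; rewrite e. Qed.

Lemma PhiD (u v : 'rV[k]_#|form_index p n|) : Phi (u + v) = Phi u + Phi v.
Proof.
rewrite -big_split; apply: eq_bigr => i _ /=.
by rewrite poly_of_rowD rmorphD mulrDl.
Qed.

Lemma PhiZ z (u : 'rV[k]_#|form_index p n|) : Phi (z *: u) = c z * Phi u.
Proof.
rewrite /form mulr_sumr; apply: eq_bigr => i _.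
by rewrite poly_of_rowZ evtZ mulrA.
Qed.

Lemma Phi0 : Phi (0 : 'rV[k]_#|form_index p n|) = 0.
Proof. by have := PhiZ 0 0; rewrite scale0r rmorph0 mul0r. Qed.

Lemma Phi_mul r (z : 'rV[k]_r) (B : 'M[k]_(r, #|form_index p n|)) :
  Phi (z *m B) = \sum_i c (z 0 i) * Phi (row i B).
Proof.
rewrite mulmx_sum_row (big_morph (fun u => Phi u) PhiD Phi0).
by apply: eq_bigr => i _; rewrite PhiZ.
Qed.

Lemma Phi_inj (u : 'rV[k]_#|form_index p n|) : Phi u = 0 -> u = 0.
Proof. by move=> /ev_indep h; apply: poly_of_row_inj => i ip; apply: h. Qed.

Lemma sf_le : (size f <= n.+1)%N. Proof. by rewrite sf. Qed.

Section Differentials.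
Variables (Om : lmodType Y) (d : Y -> Om) (C : Om -> Om).
Hypotheses (Hd : derivation c d) (HC : cartier d p C).
Hypothesis dt0 : d t != 0.

Lemma form_mul_inj a : a *: d t = 0 -> a = 0.
Proof. by move/eqP; rewrite scaler_eq0 (negPf dt0) orbF => /eqP. Qed.

Lemma cartier_Phi u : C (Phi u *: d t) = 0 <-> u *m A = 0.
Proof.
rewrite (cartier_form p_pr charY Hy_ev Hd HC) (kernel_row p_pr sf_le).
split=> [/form_mul_inj e l lp j|h].
  have := @ev_indep (fun l => cartier_poly p_pr (frob_part p f (poly_of_row u) l)).
  rewrite /= => /(_ _ l lp) H.
  apply: (cartier_poly_eq0 p_pr _).1; apply: H; rewrite -[RHS]e.
  by apply: eq_bigr => i _; rewrite mulrC.
rewrite big1 ?scale0r // => l _; have /cartier_poly_eq0 E := h l (ltn_ord l).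
by rewrite (E p_pr) rmorph0 mulr0.
Qed.

End Differentials.

Lemma kernel_basis_row i : row i (row_base (kermx A)) *m A = 0.
Proof. by apply/sub_kermxP; apply: submx_trans (row_sub _ _) _; rewrite eq_row_base. Qed.

Variable D : Y -> Y^o.
Hypotheses (HD : derivation c D) (Dt : D t = 1).

(** The kernel of the matrix injects into the space of regular forms killed by C, in whatever model
    of the differentials is given, and m elements span that space. *)
Lemma nullity_le_a_number m : a_number c p m -> (nullity p n f <= m)%N.
Proof.
move=> [Om [d [C [e [[Hd univ] HC [eS _ espan]]]]]].
(* The derivation D factors through d by universality, and D t = 1. *)
have dt0 : d t != 0.
  have [phi hphi _] := univ _ _ HD; apply: contra_neq (oner_neq0 Y) => dt0.
  by rewrite -[1]Dt hphi dt0 linear0.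
pose B := row_base (kermx A).
have hS i : Defs.regular c d (Phi (row i B) *: d t) /\ C (Phi (row i B) *: d t) = 0.
  split; last by apply/(cartier_Phi Hd HC dt0); apply: kernel_basis_row.
  apply: (form_regular p_pr chark Hy dimY genY tau_inj tau_gen sf n0 pn HD Dt Hd) => j jp.
  exact: size_poly_of_row.
have [Z hZ] := fin_all_exists (fun i => espan _ (hS i)).
rewrite leqNgt; apply/negP => lt.
(* More rows than columns yield a linear relation between the forms of the kernel basis, hence
   between its rows. *)
pose M : 'M[k]_(_, m) := \matrix_(i, j) Z i j.
have : kermx M != 0.
  by rewrite kermx_eq0 /row_free neq_ltn (leq_ltn_trans (rank_leq_col M)).
case/rowV0Pn => z /sub_kermxP zM /negP; apply; apply/eqP.
have zB : z *m B = 0.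
  apply: Phi_inj; apply: (form_mul_inj dt0); rewrite Phi_mul scaler_suml.
  under eq_bigr => i _ do rewrite -scalerA hZ scaler_sumr.
  rewrite exchange_big big1 // => j _.
  have := congr1 (fun N : 'rV[k]_m => c (N 0 j)) zM; rewrite !mxE rmorph_sum rmorph0 /= => zj.
  transitivity ((\sum_i c (z 0 i * M i j)) *: e j); last by rewrite zj scale0r.
  by rewrite scaler_suml; apply: eq_bigr => i _; rewrite mxE rmorphM scalerA.
by apply: (row_free_inj (row_base_free (kermx A))); rewrite mul0mx.
Qed.

(** Every derivation is D followed by scaling its value at t, so Y with D is itself a model of the
    Kaehler differentials. *)
Lemma kaehler_D : kaehler c D.
Proof.
split=> // M D' HD'.
have lin : linear (fun a : Y^o => a *: D' t) by move=> a b b'; rewrite scalerDl scalerA.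
pose phi := GRing.isLinear.Build _ _ _ _ _ lin.
pose Phi' : {linear Y^o -> M} := HB.pack (fun a : Y^o => a *: D' t) phi.
exists Phi'.
  exact: (derivation_spanned p_pr chark Hy genY tau_gen HD Dt HD').
move=> psi hpsi a /=.
by rewrite (hpsi t) Dt -[a in LHS](scale_regular1) linearZ.
Qed.

End ANumber.

Section ANumberAffine.
Variables (k : closedFieldType) (p : nat) (Y : fieldExtType (P1 k)) (y : Y).
Variables (f : {poly k}) (n : nat).
Notation K := (P1 k).
Notation c := (cover_const Y).
Hypotheses (p_pr : prime p) (chark : p \in [pchar k]) (p35 : p = 3%N \/ p = 5%N).
Hypothesis Hy : y ^+ p - y = (tofrac f : K)%:A.
Hypothesis dimY : \dim {:Y} = p.
Hypothesis genY : <<1; y>>%VS = fullv.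
Hypotheses (sf : size f = n.+1) (n0 : (0 < n)%N) (pn : ~~ (p %| n)%N).

Lemma deg_place_f : deg_place k (tofrac f : K) = - n%:Z.
Proof.
have f0 : f != 0 by rewrite -size_poly_gt0 sf.
rewrite -[tofrac f]divr1 -tofrac1 deg_placeE ?oner_neq0 // /degz sf size_poly1 /=.
by rewrite subr0.
Qed.

Lemma place_at_infinity : exists v : place c, lies_over p v (deg_place k).
Proof.
have f0 : tofrac f != 0 :> K by rewrite tofrac_eq0 -size_poly_gt0 sf.
exists (ram_place p_pr Hy dimY genY f0 deg_place_f pn).
exact: ram_place_lies_over.
Qed.

Lemma deg_place_x : deg_place k (P1_x k) = -1.
Proof.
rewrite -[P1_x k]divr1 -tofrac1 deg_placeE ?oner_neq0 ?polyX_eq0 //.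
by rewrite /degz size_polyX size_poly1.
Qed.

Lemma frac_der_x : frac_der (P1_x k) = 1.
Proof. by rewrite frac_der_tofrac derivX tofrac1. Qed.

(** Spanning is the new point compared with [nullity_le_a_number]: every regular form comes from a
    row vector. The place above infinity supplies the pole of x that [regular_is_form] asks for. *)
Lemma a_number_nullity : a_number c p (nullity p n f).
Proof.
have Hx := Hyx Hy.
have [|D HD Dt] := exists_derivation p_pr chark Hx dimY genY.
  by rewrite frac_der_x oner_neq0.
have charY := pchar_cover Y chark.
pose s : Y := (P1_x k)%:A - c 0.
have Ds : D s = 1 by rewrite (derivationB HD) (derivation_const HD) subr0.
have pb := pbasis_cover p_pr chark Hx genY (@x_gen k) 0.
pose C := cartier_op p_pr pb.
have HC : cartier D p C by apply: (cartier_op_cartier p_pr charY HD Ds pb p35).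
have dt0 : D (P1_x k)%:A != 0 by rewrite Dt oner_neq0.
pose B := row_base (kermx (cartier_mx p n f)).
pose e i : Y^o := form c p (P1_x k)%:A y (poly_of_row (row i B)).
exists (Y^o : lmodType Y), D, C, e; split=> //.
  exact: (kaehler_D p_pr chark Hx genY (@x_gen k) HD Dt).
have eE i : e i = e i *: D (P1_x k)%:A by rewrite Dt scale_regular1.
split.
- move=> i; rewrite eE; split.
    apply: (form_regular p_pr chark Hx dimY genY (@x_inj k) (@x_gen k) sf n0 pn HD Dt HD) => j jp.
    exact: size_poly_of_row.
  by apply/(cartier_Phi p_pr chark Hx dimY genY (@x_inj k) sf HD HC dt0); apply: kernel_basis_row.
- move=> z hz i.
  have : (\row_i z i) *m B = 0.
    apply: (Phi_inj dimY genY (@x_inj k)); rewrite Phi_mul -[RHS]hz.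
    by apply: eq_bigr => j _; rewrite mxE.
  move=> zB; have : (\row_i z i) = 0 by apply: (row_free_inj (row_base_free _)); rewrite mul0mx.
  by move/rowP/(_ i); rewrite !mxE.
move=> om [reg Com].
have [v [_ vlies]] := place_at_infinity.
have vneg : v (P1_x k)%:A < 0.
  by rewrite vlies ?P1_x_neq0 // deg_place_x; have := prime_gt0 p_pr; lia.
have [g omE hg] := regular_is_form p_pr chark Hy dimY genY sf n0 pn HD Dt (ex_intro _ v vneg) reg.
have [u hu] := poly_of_rowP p_pr hg.
have omu : om = form c p (P1_x k)%:A y (poly_of_row u).
  by rewrite omE; apply: form_ext => i ip; rewrite hu.
have uA : u *m cartier_mx p n f = 0.
  apply/(cartier_Phi p_pr chark Hx dimY genY (@x_inj k) sf HD HC dt0).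
  by rewrite -omu Dt scale_regular1.
have /submxP[z uz] : (u <= B)%MS by rewrite eq_row_base; apply/sub_kermxP.
exists (fun i => z 0 i); rewrite omu uz Phi_mul.
by apply: eq_bigr => i _.
Qed.

End ANumberAffine.

(** * Artin-Schreier theory and ramification *)

Section ArtinSchreierRoots.
Variables (F : fieldType) (p : nat).
Hypotheses (p_pr : prime p) (charF : p \in [pchar F]).

Lemma uniq_translates (y : F) : uniq [seq y + (j : nat)%:R | j <- iota 0 p].
Proof.
rewrite map_inj_in_uniq ?iota_uniq // => i j; rewrite !mem_iota !add0n /=.
move=> ip jp /addrI; wlog ij : i j ip jp / (i <= j)%N => [W|] e.
  by case/orP: (leq_total i j) => le; [apply: W | apply/esym; apply: W].
apply/eqP; rewrite eqn_leq ij -subn_eq0 /=; apply: contraTT isT => d.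
have ji : (0 < j - i < p)%N by rewrite lt0n d /=; lia.
by have := natr_neq0 charF ji; rewrite natrB // e subrr eqxx.
Qed.

Lemma size_as (a : F) : size ('X^p - 'X - a%:P) = p.+1.
Proof.
rewrite -addrA size_polyDl size_polyXn // -opprD size_polyN.
by rewrite size_XaddC ltnS prime_gt1.
Qed.

Lemma as_factor (y : F) : 'X^p - 'X - (y ^+ p - y)%:P =
  \prod_(z <- [seq y + (j : nat)%:R | j <- iota 0 p]) ('X - z%:P).
Proof.
have sp := size_as (y ^+ p - y).
rewrite {1}[LHS](@all_roots_prod_XsubC _ _ [seq y + (j : nat)%:R | j <- iota 0 p]).
- rewrite (_ : lead_coef _ = 1) ?scale1r // lead_coefE sp /= !coefB coefXn eqxx.
  by rewrite coefX coefC gtn_eqF ?prime_gt1 // gtn_eqF ?prime_gt0 // !subr0.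
- by rewrite sp size_map size_iota.
- apply/allP => _ /mapP[j _ ->]; rewrite rootE !hornerD !hornerN hornerC hornerXn hornerX.
  rewrite exprDn_pchar ?pnatE // (frob_nat charF); apply/eqP; ring.
by rewrite uniq_rootsE uniq_translates.
Qed.

Lemma frob_fixed (a : F) : a ^+ p = a -> exists2 j, (j < p)%N & a = j%:R.
Proof.
move=> ap; have := congr1 (fun q : {poly F} => q.[a]) (as_factor 0).
rewrite !hornerD !hornerN hornerC hornerXn hornerX ap !subrr.
rewrite expr0n gtn_eqF ?prime_gt0 // subrr oppr0 addr0 => /esym/eqP.
rewrite -[_ == 0]/(root _ a) root_prod_XsubC => /mapP[j]; rewrite mem_iota add0n /= => jp.
by rewrite add0r; exists j.
Qed.

Lemma sum_translates (s : seq F) (y : F) : all (mem [seq y + (j : nat)%:R | j <- iota 0 p]) s ->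
  exists m, \sum_(z <- s) z = (size s)%:R * y + m%:R.
Proof.
elim: s => [|z s IH] /=; first by exists 0%N; rewrite big_nil mul0r addr0.
case/andP => /mapP[j _ ->] /IH[m e]; exists (j + m)%N.
by rewrite big_cons e natrD -natr1; ring.
Qed.

End ArtinSchreierRoots.

(** * Irreducibility of Artin-Schreier polynomials *)

Section ASIrreducible.
Variables (K : fieldType) (p : nat) (f : K).
Hypotheses (p_pr : prime p) (charK : p \in [pchar K]).

Lemma irreducible_factor (q : {poly K}) : (1 < size q)%N ->
  exists2 r, irreducible_poly r & r %| q.
Proof.
have [m] := ubnP (size q); elim: m q => // m IH q; rewrite ltnS => le q1.
have [irr|nirr] := classic (irreducible_poly q); first by exists q.
have [r [r1 rq nr]] : exists r : {poly K}, [/\ size r != 1%N, r %| q & ~~ (r %= q)].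
  apply: NNPP => no; apply: nirr; split=> // r r1 rq.
  by apply/negPn/negP => nr; apply: no; exists r.
have q0 : q != 0 by rewrite -size_poly_gt0 ltnW.
have r0 : r != 0 by apply: contraTneq rq => ->; rewrite dvd0p.
have lt : (size r < size q)%N.
  rewrite ltn_neqAle dvdp_leq // andbT; apply: contra nr => /eqP e.
  by rewrite -dvdp_size_eqp // e.
have [||s si sr] := IH r; first exact: leq_trans lt le.
  by rewrite ltn_neqAle eq_sym r1 size_poly_gt0.
by exists s => //; apply: dvdp_trans rq.
Qed.

Hypothesis noroot : forall y : K, y ^+ p - y != f.

(** Over an extension containing a root z, the roots of any factor are translates z + j with j in
    the prime field. If the number r of these roots is below p, their sum r z + m lies in K, and so
    does z. *)
Lemma as_irreducible : irreducible_poly (as_poly p f).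
Proof.
have sm := size_as_poly f p_pr.
have [|q qi qm] := irreducible_factor (q := as_poly p f).
  by rewrite sm ltnS prime_gt0.
have [L dimL [z rz genL]] := irredp_FAdjoin qi.
have charL : p \in [pchar L] by rewrite (fmorph_pchar (in_alg L)).
have [q1 _] := qi.
pose iL := map_poly (in_alg L).
have mz : root (iL (as_poly p f)) z.
  by rewrite -dvdp_XsubCl (dvdp_trans (_ : _ %| iL q)) ?dvdp_XsubCl // dvdp_map.
have Em : iL (as_poly p f) = 'X^p - 'X - (f%:A)%:P.
  by rewrite /iL /as_poly !rmorphB /= map_polyXn map_polyX map_polyC.
have zf : z ^+ p - z = f%:A.
  move: mz; rewrite Em rootE !hornerD !hornerN hornerC hornerXn hornerX subr_eq0.
  by move/eqP.
have qL : iL q %| \prod_(w <- [seq z + (j : nat)%:R | j <- iota 0 p]) ('X - w%:P).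
  by rewrite -as_factor // zf -Em dvdp_map.
have [b qb] := dvdp_prod_XsubC qL; move: qb; set s := mask _ _ => qb.
have sq : size s = (size q).-1.
  by rewrite -(size_map_poly (in_alg L)) (eqp_size qb) size_prod_XsubC.
suff : ~~ (size s < p)%N.
  rewrite -leqNgt sq => le.
  have : q %= as_poly p f.
    rewrite -dvdp_size_eqp // sm eqn_leq -ltnS -(ltn_predK q1) !ltnS.
    apply/andP; split; last exact: le.
    by rewrite -ltnS (ltn_predK q1) -sm dvdp_leq // -size_poly_gt0 sm.
  case: qi => _ irr e; split; first by rewrite sm ltnS prime_gt0.
  by move=> r r1 rm; rewrite -(eqp_rtrans e) irr // (eqp_dvdr _ e).
apply/negP => lt.
have s0 : (0 < size s)%N by rewrite sq -ltnS (ltn_predK q1).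
have allS : all (mem [seq z + (j : nat)%:R | j <- iota 0 p]) s.
  by apply/allP => w /mem_mask.
have [m Esum] := sum_translates allS.
have lq0 : lead_coef q != 0 by rewrite lead_coef_eq0 -size_poly_gt0 ltnW.
have Eq : iL ((lead_coef q)^-1 *: q) = \prod_(w <- s) ('X - w%:P).
  apply/eqP; rewrite -eqp_monic ?monic_prod_XsubC //.
    by rewrite /iL map_polyZ (eqp_trans _ qb) //; apply: eqp_scale; rewrite fmorph_eq0 invr_eq0.
  by rewrite monicE lead_coef_map lead_coefZ mulVf //= scale1r.
have sz := natr_neq0 charL (_ : 0 < size s < p)%N.
have {sz}sz : (size s)%:R != 0 :> L by apply: sz; rewrite s0.
(* The sum of the roots of q, read off from the coefficient below the leading one. *)
pose u : K := - ((lead_coef q)^-1 *: q)`_(size s).-1.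
have uE : u%:A = (size s)%:R * z + m%:R.
  rewrite -Esum /u -[_%:A]/(in_alg L _) rmorphN -coef_map -/iL Eq.
  by rewrite coefPn_prod_XsubC ?opprK // -lt0n.
have zE : z = ((u - m%:R) / (size s)%:R)%:A.
  rewrite -[_%:A]/(in_alg L _) fmorph_div rmorphB !rmorph_nat /= uE addrK mulrAC.
  by rewrite divff // mul1r.
case/eqP: (noroot ((u - m%:R) / (size s)%:R)); apply: (fmorph_inj (in_alg L)).
by rewrite rmorphB rmorphXn /= -zE.
Qed.

End ASIrreducible.

Section ASSplitting.
Variables (K : fieldType) (p : nat).
Hypotheses (p_pr : prime p) (charK : p \in [pchar K]).

Lemma as_splittingFor (L : fieldExtType K) (y : L) (f : K) :
  y ^+ p - y = f%:A -> <<1; y>>%VS = fullv ->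
  [/\ 'X^p - 'X - (f%:A)%:P \is a polyOver (1%VS : {vspace L}),
      separable_poly ('X^p - 'X - (f%:A)%:P : {poly L}) &
      splittingFieldFor 1 ('X^p - 'X - (f%:A)%:P) {:L}].
Proof.
have charL : p \in [pchar L] by rewrite (fmorph_pchar (in_alg L)).
move=> Hy genY; split.
- rewrite !rpredB ?rpredX ?polyOverX // polyOverC.
  by apply: rpredZ; apply: mem1v.
- rewrite -Hy as_factor // separable_prod_XsubC.
  exact: uniq_translates.
exists [seq y + (j : nat)%:R | j <- iota 0 p].
  by rewrite -Hy as_factor // eqpxx.
apply/eqP; rewrite eqEsubv subvf -genY sub_adjoin1v.
apply: seqv_sub_adjoin; apply/mapP; exists 0%N; last by rewrite addr0.
by rewrite mem_iota add0n /= prime_gt0.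
Qed.

Lemma exists_as_ext (f : K) : (forall y : K, y ^+ p - y != f) ->
  exists (Y : splittingFieldType K) (y : Y),
    [/\ y ^+ p - y = f%:A, \dim {:Y} = p & <<1; y>>%VS = fullv].
Proof.
move=> /(as_irreducible p_pr charK)/irredp_FAdjoin[L dimL [z rz genL]].
rewrite size_as_poly // in dimL.
have zf : z ^+ p - z = f%:A.
  move: rz; rewrite /as_poly !rmorphB /= map_polyXn map_polyX map_polyC.
  by rewrite rootE !hornerD !hornerN hornerC hornerXn hornerX subr_eq0 => /eqP.
have [ov _ split] := as_splittingFor zf genL.
have ax : splitting_field_axiom L by exists ('X^p - 'X - (f%:A)%:P).
pose Y : splittingFieldType K :=
  HB.pack (FieldExt.sort L) L (FieldExt_isSplittingField.Build K L ax).
by exists Y, z.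
Qed.

Variable Y : splittingFieldType K.

Section FromRoot.
Variables (y : Y) (f : K).
Hypotheses (Hy : y ^+ p - y = f%:A) (dimY : \dim {:Y} = p) (genY : <<1; y>>%VS = fullv).

Lemma as_galois : galois 1 {:Y}.
Proof.
apply/splitting_galoisField; exists ('X^p - 'X - (f%:A)%:P).
exact: (as_splittingFor Hy genY).
Qed.

Lemma as_card : #|'Gal({:Y} / 1%VS)%g| = p.
Proof. by rewrite -galois_dim ?as_galois // dimv1 divn1. Qed.

Lemma as_isog : 'Gal({:Y} / 1%VS)%g \isog Zp p.
Proof.
have cyc : cyclic 'Gal({:Y} / 1%VS)%g by rewrite prime_cyclic // as_card.
rewrite (isog_cyclic_card _ cyc) as_card card_Zp ?prime_gt0 // eqxx andbT.
by rewrite prime_cyclic // card_Zp ?prime_gt0.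
Qed.

End FromRoot.

Hypothesis galY : galois 1 {:Y}.
Hypothesis isoY : 'Gal({:Y} / 1%VS)%g \isog Zp p.

Lemma card_gal : #|'Gal({:Y} / 1%VS)%g| = p.
Proof. by rewrite (card_isog isoY) card_Zp // prime_gt0. Qed.

(* Additive Hilbert 90: [y] below satisfies [s y = y + 1] for a generator [s]. *)
Lemma as_generator : exists (y : Y) (f : K),
  [/\ y ^+ p - y = f%:A, \dim {:Y} = p & <<1; y>>%VS = fullv].
Proof.
have charY : p \in [pchar Y] by rewrite (fmorph_pchar (in_alg Y)).
have cyc : cyclic 'Gal({:Y} / 1%VS)%g by rewrite prime_cyclic // card_gal.
have [s Gs] := cyclicP cyc.
have os : #[s]%g = p by rewrite /order -Gs card_gal.
(* Linear independence of automorphisms provides an element of nonzero trace. *)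
have [th _ tr0] : exists2 a, a \in {:Y}%VS & \sum_(x in 'Gal({:Y} / 1%VS)%g) 1 * x a != 0.
  by apply: (gal_independent_contra (x := 1%g)); rewrite ?group1 ?oner_neq0.
pose a i := (s ^+ i)%g th.
have sa i : s (a i) = a i.+1 by rewrite /a expgSr galM ?memvf.
have ap : a p = a 0%N by rewrite /a -os expg_order expg0.
pose T := \sum_(i < p) a i.
have T0 : T != 0.
  apply: contraNneq tr0 => T0; under eq_bigr do rewrite mul1r.
  pose r := [seq (s ^+ i)%g | i <- iota 0 p].
  have ur : uniq r.
    rewrite map_inj_in_uniq ?iota_uniq // => i j; rewrite !mem_iota !add0n /= => ip jp /eqP.
    by rewrite eq_expg_mod_order os !modn_small // => /eqP.
  have -> : \sum_(x in 'Gal({:Y} / 1%VS)%g) x th = \sum_(x <- r) x th.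
    rewrite [RHS]big_uniq //; apply: eq_bigl => x; rewrite Gs.
    apply/cycleP/mapP => [[i ->]|[i _ ->]]; last by exists i.
    exists (i %% p)%N; first by rewrite mem_iota add0n ltn_mod prime_gt0.
    by apply/eqP; rewrite eq_expg_mod_order os modn_mod.
  by apply/eqP; rewrite big_map -[RHS]T0 /T -(big_mkord xpredT a) /index_iota subn0.
have sT : s T = T.
  rewrite /T rmorph_sum /=; under eq_bigr do rewrite sa.
  have := prime_gt0 p_pr; case: (p) ap => // q ap _.
  by rewrite big_ord_recr big_ord_recl /= ap addrC.
(* Applying s shifts the indices by one, which subtracts one trace T; the wrapped term has
   coefficient p = 0. Hence - S / T is translated by 1. *)
pose S := \sum_(i < p) (i : nat)%:R * a i.
have sS : s S = S - T.
  rewrite /S rmorph_sum /=.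
  under eq_bigr do rewrite rmorphM rmorph_nat /= sa.
  have -> : \sum_(i < p) i%:R * a i.+1 =
      \sum_(i < p) (i : nat).+1%:R * a i.+1 - \sum_(i < p) a i.+1.
    by rewrite -sumrB; apply: eq_bigr => i _; rewrite -natr1; ring.
  have -> : \sum_(i < p) a i.+1 = T.
    by rewrite -[RHS]sT /T rmorph_sum; apply: eq_bigr => i _; rewrite /= sa.
  congr (_ - _); have := prime_gt0 p_pr; have p0 := pcharf0 charY.
  case: (p) p0 => // q p0 _.
  by rewrite big_ord_recr [in RHS]big_ord_recl /= p0 !mul0r addr0 add0r.
pose y := - (T^-1 * S).
have sy : s y = y + 1.
  rewrite /y rmorphN rmorphM fmorphV /= sT sS mulrBr mulVf //; ring.
have yn1 : y \notin 1%VS.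
  apply/negP => /vlineP[z yz]; have := sy.
  rewrite yz linearZ /= rmorph1 -[X in X = _]addr0 => /addrI/esym/eqP.
  by rewrite oner_eq0.
have sF : s (y ^+ p - y) = y ^+ p - y.
  rewrite rmorphB rmorphXn /= sy exprDn_pchar ?pnatE // expr1n; ring.
have /vlineP[f yf] : y ^+ p - y \in 1%VS.
  rewrite -(galois_fixedField galY); apply/fixedFieldP; rewrite ?memvf // => x.
  rewrite Gs => /cycleP[i ->]; elim: i => [|i IH]; first by rewrite expg0 gal_id.
  by rewrite expgSr galM ?memvf // IH.
have dimY : \dim {:Y} = p.
  by have := galois_dim galY; rewrite dimv1 divn1 card_gal.
exists y, f; split=> //.
apply/eqP; rewrite -(dimv_leqif_eq (subvf _)) dimY.
have : (\dim <<1; y>> %| p)%N.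
  by rewrite -dimY; apply: (field_dimS (F := <<1; y>>%AS) (E := {:Y}%AS)); apply: subvf.
case/primeP: (p_pr) => _ H /H/orP[|//] /eqP d1.
case/negP: yn1; have : (<<1; y>> <= 1)%VS.
  by rewrite -(dimv_leqif_sup (sub1v <<1; y>>%AS)) dimv1 d1.
by move/subvP; apply; apply: memv_adjoin.
Qed.

End ASSplitting.

Lemma ramification_break_uniq (k : fieldType) (Y : splittingFieldType (P1 k))
  (v : place (cover_const Y)) i j :
  ramification_break v i -> ramification_break v j -> i = j.
Proof.
wlog ij : i j / (i <= j)%N => [W|] hi hj.
  by case/orP: (leq_total i j) => le; [apply: W | apply/esym; apply: W].
apply/eqP; rewrite eqn_leq ij leqNgt; apply/negP => lt.
have [_ triv] := hi; have [[s [Gs hs] /eqP s1] _] := hj; apply: s1; apply: triv.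
by split=> // a /hs; apply: vgeW; rewrite lez_nat.
Qed.

(** * The ramification break at the pole of the coordinate *)

Section Ramification.
Variables (k : closedFieldType) (p : nat) (Y : splittingFieldType (P1 k)) (y : Y).
Variables (tau : P1 k) (f : {poly k}) (n : nat).
Notation K := (P1 k).
Notation cK := (P1_const k).
Notation c := (cover_const Y).
Notation t := (tau%:A : Y).
Hypotheses (p_pr : prime p) (chark : p \in [pchar k]).
Hypothesis Hy : y ^+ p - y = (evt cK tau f)%:A.
Hypothesis dimY : \dim {:Y} = p.
Hypothesis genY : <<1; y>>%VS = fullv.
Hypothesis tau_inj : forall h : {poly k}, h != 0 -> evt cK tau h != 0.
Hypothesis tau_gen : forall b : K, exists n m : {poly k},
  m != 0 /\ b = evt cK tau n / evt cK tau m.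
Hypotheses (sf : size f = n.+1) (n0 : (0 < n)%N) (pn : ~~ (p %| n)%N).

Let charY : p \in [pchar Y] := pchar_cover Y chark.
Notation G := 'Gal({:Y} / 1%VS)%g.

Lemma gal_shift (s : gal_of {:Y}) : exists j : k, s y = y + c j.
Proof.
have e : (s y - y) ^+ p = s y - y.
  have := congr1 s Hy; rewrite rmorphB rmorphXn /= linearZ /= rmorph1 -Hy => E.
  rewrite exprDn_pchar ?pnatE // exprNn_pchar ?pnatE //.
  apply/eqP; rewrite -subr_eq0; apply/eqP.
  by transitivity ((s y ^+ p - s y) - (y ^+ p - y)); [ring | rewrite E subrr].
have [j _ ej] := frob_fixed p_pr charY e.
by exists j%:R; rewrite rmorph_nat -ej addrC subrK.
Qed.

Lemma gal_alg (s : gal_of {:Y}) (b : K) : s b%:A = b%:A.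
Proof. by rewrite linearZ /= rmorph1. Qed.

Lemma gal_fix_y (s : gal_of {:Y}) : s \in G -> s y = y -> s = 1%g.
Proof.
move=> Gs sy; apply/eqP; apply/gal_eqP => a _; rewrite gal_id.
rewrite (coord_sum p_pr Hy genY a) rmorph_sum /=; apply: eq_bigr => i _.
by rewrite linearZ /= rmorphXn /= sy.
Qed.

Lemma gal_mem_1 (s : gal_of {:Y}) : s \in G.
Proof.
rewrite gal_kHom ?sub1v // k1HomE; apply/ahom_inP; split=> [a b _ _|].
  by rewrite rmorphM.
by rewrite rmorph1.
Qed.

Variable v : place c.
Hypothesis tneg : v t < 0.

Let vt : v t = - p%:Z.
Proof. by have [] := val_infinite p_pr chark Hy dimY genY tau_inj tau_gen sf n0 pn tneg. Qed.
Let vy : v y = - n%:Z.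
Proof. by have [] := val_infinite p_pr chark Hy dimY genY tau_inj tau_gen sf n0 pn tneg. Qed.
Let t0 : t != 0.
Proof. by have := tau_neq_const Y tau_inj 0; rewrite rmorph0 subr0. Qed.
Let y0 : y != 0.
Proof. by apply: (y_neq0 p_pr Hy tau_inj sf). Qed.

Lemma shiftX j i : (y + c j) ^+ i - y ^+ i = y ^+ i * ((1 + c j / y) ^+ i - 1).
Proof.
rewrite mulrBr mulr1 -exprMn; congr (_ ^+ _ - _).
by rewrite mulrDr mulr1 mulrCA divff // mulr1.
Qed.

Lemma vge_cj j : vge v n%:Z (c j / y).
Proof.
rewrite -[n%:Z]add0r; apply: vgeM; first exact: vge_const.
by rewrite vgeE ?invr_eq0 // pvalV // vy opprK.
Qed.

Lemma vge_1cj j : vge v 0 (1 + c j / y).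
Proof.
apply: vgeD; first by rewrite vgeE ?oner_neq0 // pval1.
exact: vgeW (vge_cj j).
Qed.

(** As s y = y + j, the monomial b y^i changes by the factor (1 + j/y)^i - 1, of value at least n.
    The extra 1 comes from the monomials themselves. *)
Lemma lower_ramification_n (s : gal_of {:Y}) : lower_ramification v n s.
Proof.
split; first exact: gal_mem_1.
move=> a ha; have [j sy] := gal_shift s.
rewrite (coord_sum p_pr Hy genY a) rmorph_sum /= -sumrB; apply: vge_sum => i _.
have hi := vge_coord_infinite p_pr chark Hy dimY genY tau_inj tau_gen sf n0 pn tneg ha (ltn_ord i).
move: (ycoord _ _ _ _)`_i hi => b hb.
rewrite linearZ /= rmorphXn /= sy -scalerBr.
have [->|b0] := eqVneq b 0; first by rewrite scale0r vge_0.
have [i0|i0] := posnP i; first by rewrite i0 !expr0 subrr scaler0 vge_0.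
rewrite shiftX scalerAl -[n.+1]addn1 addnC PoszD; apply: vgeM; last first.
  rewrite -[X in _ - X](expr1n _ i); apply: vge_subX; first exact: vge_1cj.
    by rewrite vgeE ?oner_neq0 // pval1.
  by rewrite addrC addKr; apply: vge_cj.
have yi0 : b *: y ^+ i != 0 by rewrite scaler_eq0 negb_or b0 expf_neq0.
move: hb; rewrite !vgeE // (val_mono p_pr Hy tau_inj v sf i b0).
(* For 0 < i < p the value of an integral b y^i is not divisible by p, hence it is at least 1. *)
have [z ->] := val_K_infinite p_pr chark dimY tau_inj tau_gen tneg b0.
rewrite vt vy -gtz0_ge1 => h; rewrite lt_neqAle h andbT eq_sym; apply/eqP => e.
have : (i : nat) = 0%N.
  apply: (@distinct_weights p n i 0 (- z) 0) => //; first exact: prime_gt0.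
  by rewrite !mulr0 subr0 -[RHS]e; ring.
by move=> e0; rewrite e0 in i0.
Qed.

Lemma explicit_uniformizer : exists i z : nat,
  [/\ (0 < i < p)%N & v (y ^+ i / t ^+ z) = 1].
Proof.
have [i [z [ip e]]] := bezout_ramified p_pr pn.
have p1 := prime_gt1 p_pr.
have i0 : (0 < i)%N.
  case: i ip e => // _; rewrite mulr0 subr0 => e.
  by have := dvdz_mulr z (dvdzz p%:Z); rewrite e dvdz1 absz_nat => /eqP pE; rewrite pE in p1.
have z0 : 0 < z.
  rewrite ltNge; apply/negP => zle.
  have h1 : p%:Z * z <= 0 by rewrite pmulr_rle0 // ltz_nat ltnW.
  by move: e; rewrite -PoszM; lia.
case: z z0 e => // z _ e; exists i, z; rewrite i0 ip; split=> //.
by rewrite pval_div ?expf_neq0 // !pvalX // vy vt; lia.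
Qed.

(** Test on the uniformizer u = y^i / t^z. If j is nonzero, s u - u is u times j/y times a sum with
    residue i, invertible because 0 < i < p, so its value is exactly n + 1. *)
Lemma lower_ramification_Sn (s : gal_of {:Y}) : lower_ramification v n.+1 s -> s = 1%g.
Proof.
move=> [Gs hs]; have [j sy] := gal_shift s.
have [i [z [ip vu]]] := explicit_uniformizer.
set u := y ^+ i / t ^+ z in vu.
have u0 : u != 0 by rewrite mulf_neq0 ?invr_eq0 ?expf_neq0.
have [j0|j0] := eqVneq (c j) 0; first by apply: gal_fix_y => //; rewrite sy j0 addr0.
have : vge v n.+2%:Z (s u - u) by apply: hs; rewrite vgeE // vu.
have -> : s u - u = u * ((1 + c j / y) ^+ i - 1).
  rewrite /u rmorphM fmorphV !rmorphXn /= gal_alg sy -mulrBl shiftX; ring.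
rewrite subrX1 addrAC subrr add0r.
set S := \sum_(_ < i) _.
have hS : vge v 1 (S - i%:R).
  have -> : (i%:R : Y) = \sum_(l < i) 1 by rewrite sumr_const card_ord.
  rewrite -sumrB; apply: vge_sum => l _; rewrite -[X in _ - X](expr1n _ l).
  apply: vge_subX; first exact: vge_1cj.
    by rewrite vgeE ?oner_neq0 // pval1.
  by rewrite addrC addKr; apply: vgeW (vge_cj j); rewrite lez_nat.
have in0 : i%:R != 0 :> Y := natr_neq0 charY ip.
have vi : v i%:R = 0 by rewrite -(rmorph_nat c) pval_const // -(fmorph_eq0 c) rmorph_nat.
have [] := pval_addl in0 (_ : vge v (v i%:R + 1) (S - i%:R)); first by rewrite vi.
rewrite addrC subrK vi => S0 vS.
have cy0 : c j / y != 0 by rewrite mulf_neq0 ?invr_eq0.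
have j0' : j != 0 by rewrite -(fmorph_eq0 c).
have q0 := mulf_neq0 cy0 S0.
rewrite (vgeE _ _ (mulf_neq0 u0 q0)) (pvalM v u0 q0) (pvalM v cy0 S0).
rewrite (pval_div v j0 y0) vu vS vy (pval_const v j0') add0r addr0 opprK.
by clear; lia.
Qed.

Lemma ramification_break_n : galois 1 {:Y} -> ramification_break v n.
Proof.
move=> galY; split; last exact: lower_ramification_Sn.
have : (1 < #|G|)%N by rewrite -galois_dim // dimv1 divn1 dimY prime_gt1.
move=> /card_gt1P[s1 [s2 [_ _ ne]]].
have [e|s1n] := eqVneq s1 1%g; last by exists s1 => //; apply: lower_ramification_n.
by exists s2; [apply: lower_ramification_n | rewrite -e eq_sym].
Qed.

End Ramification.

Section AffineCover.
Variables (k : closedFieldType) (p : nat) (Y : splittingFieldType (P1 k)) (y : Y).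
Variables (f : {poly k}) (n : nat).
Notation K := (P1 k).
Notation c := (cover_const Y).
Hypotheses (p_pr : prime p) (chark : p \in [pchar k]).
Hypothesis Hy : y ^+ p - y = (tofrac f : K)%:A.
Hypothesis dimY : \dim {:Y} = p.
Hypothesis genY : <<1; y>>%VS = fullv.
Hypotheses (sf : size f = n.+1) (n0 : (0 < n)%N) (pn : ~~ (p %| n)%N).

Lemma affine_Zp_cover : Zp_cover p Y.
Proof.
have charK := pchar_P1 chark.
split; first exact: (as_galois p_pr charK Hy genY).
exact: (as_isog p_pr charK Hy dimY genY).
Qed.

Lemma lies_over_x e (v : place c) (w : place (P1_const k)) a : lies_over e v w ->
  v ((P1_x k)%:A - c a) = e%:Z * w (P1_x k - P1_const k a).
Proof.
move=> [_ h]; rewrite -h ?P1_x_neq_const // scalerBl.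
by congr (v (_ - _)).
Qed.

Lemma affine_one_branch_point : one_branch_point n Y.
Proof.
have Hx := Hyx Hy; have pp := prime_gt0 p_pr.
exists (deg_place k); split.
- have [v hv] := place_at_infinity p_pr Hy dimY genY sf pn.
  by exists p, v; split=> //; apply: prime_gt1.
- move=> w [e [v [lv e1]]].
  have [tneg|[a ta]] := place_cover_cases p_pr chark Hx dimY genY (@x_inj k) (@x_gen k) v.
    have [e0 lv'] := lv; rewrite lv' ?P1_x_neq0 // in tneg.
    have wneg : w (P1_x k) < 0 by move: tneg; rewrite pmulr_rlt0 // ltz_nat.
    by have [] := same_deg_place wneg.
  (* At a finite point e divides v(x - a) = 1, so there is no ramification. *)
  have := val_finite p_pr chark Hx dimY genY (@x_inj k) (@x_gen k) ta.
  rewrite (lies_over_x _ lv); move: (w _) => z E; exfalso.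
  have := dvdz_mulr z (dvdzz e%:Z); rewrite E dvdz1 absz_nat => /eqP e'.
  by rewrite e' in e1.
move=> e v [e0 lv].
have tneg : v (P1_x k)%:A < 0.
  by rewrite lv ?P1_x_neq0 // deg_place_x mulrN1 oppr_lt0 ltz_nat.
apply: (ramification_break_n p_pr chark Hx dimY genY (@x_inj k) (@x_gen k) sf n0 pn tneg).
exact: (as_galois p_pr (pchar_P1 chark) Hy genY).
Qed.

End AffineCover.

(** * Reduction to standard form *)

(** The algebra of [reduce_pole], with Q = x - a, B = Q^m, A = Q^(pm-1-m) and Gp = G^p; the powers
    are made opaque so that [field] applies. *)
Lemma pole_identity (F : fieldType) (G Gp M Q N A B : F) :
  M != 0 -> Q != 0 -> A != 0 -> B != 0 ->
  (Gp * M + N * Q) / (A * B * Q * M) - (Gp / (A * B * Q) - G / B) =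
  (N + G * (A * M)) / (A * B * M).
Proof. by move=> M0 Q0 A0 B0; field; rewrite A0 B0 M0 Q0. Qed.

Lemma infinity_identity (F : fieldType) (G Gp M N X Xp : F) : M != 0 ->
  N / M - (Gp * Xp - G * X) = (N - Gp * (Xp * M) + G * (X * M)) / M.
Proof. by move=> M0; field. Qed.

Section StandardForm.
Variables (k : closedFieldType) (p : nat).
Hypotheses (p_pr : prime p) (chark : p \in [pchar k]).
Notation K := (P1 k).
Implicit Types N M : {poly k}.

(** No pole of N/M has order divisible by p, neither at a finite point nor at infinity, where the
    order is size N - size M. *)
Definition standard N M := [/\ M != 0, coprimep N M,
  forall a, root M a -> ~~ (p %| mup a M)%N &
  (size M < size N)%N -> ~~ (p %| size N - size M)%N].

Lemma size_sub_same_lead N M : N != 0 -> size N = size M -> lead_coef N = lead_coef M ->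
  (size (N - M)%R < size N)%N.
Proof.
rewrite -size_poly_gt0 => N0 sz lc; rewrite -(prednK N0) ltnS.
apply/leq_sizeP => j; rewrite leq_eqVlt => /orP[/eqP <-|lt].
  by rewrite coefB -lead_coefE lc lead_coefE sz subrr.
rewrite prednK // in lt; rewrite coefB nth_default // nth_default ?subrr //.
by rewrite -sz.
Qed.

(** With h = g / (x - a)^m and g^p the leading coefficient of the polar part at a, subtracting h^p -
    h cancels the top term of a pole of order p m and adds only one of order m. The bound H on both
    sizes is the measure that drops. *)
Lemma reduce_pole H N M a m : (0 < m)%N -> coprimep N M -> M != 0 ->
  mup a M = (p * m)%N -> (size N <= H.+1)%N -> (size M <= H.+1)%N ->
  exists h N' M', [/\ M' != 0, (size N' <= H)%N, (size M' <= H)%N &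
    tofrac N / tofrac M - (h ^+ p - h) = tofrac N' / tofrac M' :> K].
Proof.
move=> m0 nm M0 mM sN sM; have p1 := prime_gt1 p_pr.
have [r [M1]] := multiplicity_XsubC M a; rewrite M0 /= => M1a EM.
have M10 : M1 != 0 by apply: contraNneq M1a => ->; rewrite root0.
have Xa0 : 'X - a%:P != 0 :> {poly k} by rewrite polyXsubC_eq0.
have rE : r = (p * m)%N by rewrite -mM EM mupMr // mup_XsubCX eqxx.
have pm : (m < p * m)%N by rewrite ltn_Pmull.
pose g := proot p_pr (N.[a] / M1.[a]).
have ga : root (N - g ^+ p *: M1) a.
  by rewrite rootE !hornerE prootK divfK ?subrr.
have [N2 EN2] := factor_theorem _ _ ga.
pose Q := ('X - a%:P : {poly k}).
exists (tofrac g%:P / tofrac (Q ^+ m)), (N2 + g *: (Q ^+ (p * m - 1 - m) * M1)), (Q ^+ (p * m - 1) * M1).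
have sM1 : size M = (p * m + size M1)%N.
  by rewrite EM size_mul ?expf_neq0 // size_exp_XsubC rE addnS /= addnC.
have sM1_gt : (0 < size M1)%N by rewrite size_poly_gt0.
have sQM j : size (Q ^+ j * M1) = (j + size M1)%N.
  by rewrite size_mul ?expf_neq0 // size_exp_XsubC addSn.
split.
- by rewrite mulf_neq0 ?expf_neq0.
- apply: leq_trans (size_polyD _ _) _; rewrite geq_max; apply/andP; split.
    have [->|N20] := eqVneq N2 0; first by rewrite size_poly0.
    have : size (N - g ^+ p *: M1) = (size N2).+1.
      by rewrite EN2 size_mul // size_XsubC addn2.
    have := size_polyD N (- (g ^+ p *: M1)); rewrite size_polyN.
    have := size_scale_leq (g ^+ p) M1; rewrite leq_max.
    move=> h1 h2 h3; rewrite h3 in h2; rewrite -ltnS; case/orP: h2 => h2.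
      exact: leq_trans h2 sN.
    apply: leq_trans h2 (leq_trans h1 (leq_trans _ sM)).
    by rewrite sM1 leq_addl.
  apply: leq_trans (size_scale_leq _ _) _; rewrite sQM.
  by move: sM1 sM pm m0; clear; lia.
- by rewrite sQM; move: sM1 sM pm m0; clear; lia.
have QF j : tofrac (Q ^+ j) != 0 :> K by rewrite tofrac_eq0 expf_neq0.
have MF : tofrac M1 != 0 :> K by rewrite tofrac_eq0.
have e1 : tofrac N = tofrac g%:P ^+ p * tofrac M1 + tofrac N2 * tofrac Q :> K.
  rewrite -tofracXn -tofracM -tofracM -tofracD -EN2 -polyC_exp mul_polyC.
  by rewrite addrC subrK.
have e2 : tofrac M = tofrac Q ^+ (p * m) * tofrac M1 :> K.
  by rewrite -tofracXn -tofracM EM rE mulrC.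
have Q0 : tofrac Q != 0 :> K by rewrite tofrac_eq0.
have E1 : tofrac Q ^+ (p * m) = tofrac Q ^+ (p * m - 1) * tofrac Q :> K.
  by rewrite -exprSr subn1 prednK //; move: pm; clear; lia.
have E2 : tofrac Q ^+ (p * m - 1) = tofrac Q ^+ (p * m - 1 - m) * tofrac Q ^+ m :> K.
  by rewrite -exprD subnK //; move: pm; clear; lia.
have E3 : (tofrac g%:P / tofrac Q ^+ m) ^+ p = tofrac g%:P ^+ p / tofrac Q ^+ (p * m) :> K.
  by rewrite expr_div_n -exprM mulnC.
clearbody Q; rewrite e1 e2 -mul_polyC !(tofracD, tofracM, tofracXn) E3 E1 E2.
exact: (pole_identity _ _ _ MF Q0 (expf_neq0 _ Q0) (expf_neq0 _ Q0)).
Qed.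

(** The same reduction at infinity, with h = g x^m and g^p the quotient of the leading
    coefficients. *)
Lemma reduce_infinity H N M m : (0 < m)%N -> M != 0 ->
  size N = (size M + p * m)%N -> (size N <= H.+1)%N ->
  exists h N', [/\ (size N' <= H)%N, (size M <= H)%N &
    tofrac N / tofrac M - (h ^+ p - h) = tofrac N' / tofrac M :> K].
Proof.
move=> m0 M0 sNM sN; have p1 := prime_gt1 p_pr.
have pm : (m < p * m)%N by rewrite ltn_Pmull.
have sM0 : (0 < size M)%N by rewrite size_poly_gt0.
have N0 : N != 0 by rewrite -size_poly_gt0 sNM addn_gt0 sM0.
pose g := proot p_pr (lead_coef N / lead_coef M).
exists (tofrac (g *: 'X^m)), (N - g ^+ p *: ('X^(p * m) * M) + g *: ('X^m * M)).
have gp0 : g ^+ p != 0 by rewrite prootK mulf_neq0 ?invr_eq0 ?lead_coef_eq0.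
split.
- apply: leq_trans (size_polyD _ _) _; rewrite geq_max; apply/andP; split.
    rewrite -ltnS; apply: leq_trans sN; apply: size_sub_same_lead => //.
      by rewrite size_scale // mulrC size_mulXn // sNM addnC.
    by rewrite lead_coefZ lead_coefM lead_coefXn mul1r prootK divfK // lead_coef_eq0.
  apply: leq_trans (size_scale_leq _ _) _; rewrite mulrC size_mulXn //.
  by move: sNM sN pm; clear; lia.
- by move: sNM sN pm m0; clear; lia.
have MF : tofrac M != 0 :> K by rewrite tofrac_eq0.
rewrite -!mul_polyC !(tofracD, tofracM, tofracXn, tofracN) exprMn -exprM (mulnC m).
rewrite polyC_exp tofracXn.
exact: infinity_identity.
Qed.

Lemma standard_form N M : M != 0 ->
  exists h N' M', standard N' M' /\
    tofrac N / tofrac M - (h ^+ p - h) = tofrac N' / tofrac M' :> K.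
Proof.
have [H] : exists H, (maxn (size N) (size M) <= H)%N by exists (maxn (size N) (size M)).
elim: H N M => [|H IH] N0 M0; rewrite geq_max => /andP[sN0 sM0] M00.
  by move: sM0; rewrite leqn0 size_poly_eq0 (negPf M00).
pose g := gcdp N0 M0.
have g0 : g != 0 by rewrite gcdp_eq0 negb_and M00 orbT.
have [N [M [nm M1 sN sM EF]]] : exists N M, [/\ coprimep N M, M != 0,
    (size N <= H.+1)%N, (size M <= H.+1)%N &
    tofrac N0 / tofrac M0 = tofrac N / tofrac M :> K].
  exists (N0 %/ g), (M0 %/ g).
  have EN : N0 = N0 %/ g * g by rewrite divpK // dvdp_gcdl.
  have EM : M0 = M0 %/ g * g by rewrite divpK // dvdp_gcdr.
  split.
  - by apply: coprimep_div_gcd; rewrite M00 orbT.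
  - by apply: contraNneq M00 => e; rewrite EM e mul0r.
  - by apply: leq_trans (leq_divp _ _) sN0.
  - by apply: leq_trans (leq_divp _ _) sM0.
  rewrite {1}EN {1}EM !tofracM -mulf_div divff ?mulr1 //.
  by rewrite tofrac_eq0.
have frobK (a b : K) : (a + b) ^+ p = a ^+ p + b ^+ p.
  exact: (frobD p_pr (pchar_P1 chark)).
have step h1 N' M' : M' != 0 -> (size N' <= H)%N -> (size M' <= H)%N ->
    tofrac N / tofrac M - (h1 ^+ p - h1) = tofrac N' / tofrac M' :> K ->
    exists h N' M', standard N' M' /\
      tofrac N0 / tofrac M0 - (h ^+ p - h) = tofrac N' / tofrac M' :> K.
  move=> M'0 sN' sM' E1.
  have [|h2 [N2 [M2 [st E2]]]] := IH N' M' _ M'0; first by rewrite geq_max sN'.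
  (* The corrections add up because h^p - h is additive in characteristic p. *)
  exists (h1 + h2), N2, M2; split=> //.
  by rewrite -E2 -E1 EF frobK; ring.
have [[a [ra pa]]|noa] := classic (exists a, root M a /\ (p %| mup a M)%N).
  have [m mE] := dvdnP pa; rewrite mulnC in mE.
  have m0 : (0 < m)%N by have := mup_gt0 M1 ra; rewrite mE muln_gt0 => /andP[].
  have [h [N' [M' [M'0 sN' sM' E]]]] := reduce_pole m0 nm M1 mE sN sM.
  exact: step M'0 sN' sM' E.
have [[lt pd]|noinf] := classic ((size M < size N)%N /\ (p %| size N - size M)%N).
  have [m mE] := dvdnP pd; rewrite mulnC in mE.
  have m0 : (0 < m)%N by move: lt; rewrite -subn_gt0 mE muln_gt0 => /andP[].
  have sNM : size N = (size M + p * m)%N by rewrite -mE subnKC // ltnW.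
  have [h [N' [sN' sM' E]]] := reduce_infinity m0 M1 sNM sN.
  exact: step M1 sN' sM' E.
exists 0, N, M; split; last first.
  by rewrite expr0n gtn_eqF ?prime_gt0 // subrr subr0.
split=> // [a ra|lt]; apply/negP => dv.
  by apply: noa; exists a.
exact: noinf.
Qed.

End StandardForm.

(** * The coordinate 1/(x - a) *)

Section InverseCoordinate.
Variables (k : closedFieldType) (a : k).
Notation K := (P1 k).
Notation cK := (P1_const k).

Definition inv_coord : K := (P1_x k - cK a)^-1.
Notation tau := inv_coord.

Let xa0 : P1_x k - cK a != 0 := P1_x_neq_const a.

Lemma inv_coord_neq0 : tau != 0. Proof. by rewrite invr_eq0. Qed.

Lemma val_inv_coord (w : place cK) : w tau = - w (P1_x k - cK a).
Proof. exact: pvalV. Qed.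

Lemma inv_coord_inj (h : {poly k}) : h != 0 -> evt cK tau h != 0.
Proof.
move=> h0; have [e _] := same_ord_place (vge_xa a).
have neg : ord_place a tau < 0 by rewrite val_inv_coord e.
by have [] := val_evt_neg inv_coord_neq0 neg h0.
Qed.

Definition tau_frac (b : K) := exists u m : {poly k}, m != 0 /\ b = evt cK tau u / evt cK tau m.

Lemma tau_frac_evt u : tau_frac (evt cK tau u).
Proof. by exists u, 1; rewrite oner_neq0 rmorph1 divr1. Qed.

Lemma tau_fracD b b' : tau_frac b -> tau_frac b' -> tau_frac (b + b').
Proof.
move=> [u [m [m0 ->]]] [u' [m' [m'0 ->]]]; exists (u * m' + u' * m), (m * m').
split; first exact: mulf_neq0.
by rewrite (addf_div _ _ (inv_coord_inj m0) (inv_coord_inj m'0)) rmorphD !rmorphM.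
Qed.

Lemma tau_fracM b b' : tau_frac b -> tau_frac b' -> tau_frac (b * b').
Proof.
move=> [u [m [m0 ->]]] [u' [m' [m'0 ->]]]; exists (u * u'), (m * m').
by split; [exact: mulf_neq0 | rewrite mulf_div !rmorphM].
Qed.

Lemma tau_fracV b : tau_frac b -> tau_frac b^-1.
Proof.
move=> [u [m [m0 ->]]]; have [->|u0] := eqVneq u 0.
  rewrite rmorph0 mul0r invr0; exists 0, 1; split; first exact: oner_neq0.
  by rewrite rmorph0 mul0r.
by exists m, u; rewrite invf_div.
Qed.

Lemma inv_coord_gen (b : K) : tau_frac b.
Proof.
have fc z : tau_frac (cK z) by rewrite -(evtC cK tau); apply: tau_frac_evt.
have fx : tau_frac (P1_x k).
  rewrite -(subrK (cK a) (P1_x k)); apply: tau_fracD => //.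
  rewrite -[_ - _]invrK; apply: tau_fracV.
  by have := tau_frac_evt 'X; rewrite evtX.
have fp u : tau_frac (tofrac u).
  rewrite -evt_P1_x; elim/poly_ind: u => [|u z IH].
    by rewrite rmorph0 -(rmorph0 (evt cK tau)); apply: tau_frac_evt.
  rewrite rmorphD rmorphM /= evtX evtC; apply: tau_fracD => //.
  exact: tau_fracM.
have [u [m [m0 ->]]] := fracP b.
by apply: tau_fracM => //; apply: tau_fracV.
Qed.

Lemma frac_der_inv_coord : frac_der tau != 0.
Proof.
have e := frac_derM tau (P1_x k - cK a).
have d1 : frac_der (1 : K) = 0 by rewrite -tofrac1 frac_der_tofrac -polyC1 derivC tofrac0.
have dX : frac_der (P1_x k - cK a) = 1.
  by rewrite P1_xE frac_der_tofrac derivB derivX derivC subr0 tofrac1.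
move: e; rewrite /inv_coord (mulVf xa0) d1 dX mulr1 => e.
apply/eqP => t0; move: e; rewrite t0 mulr0 addr0 => /esym/eqP.
by rewrite (negPf inv_coord_neq0).
Qed.

(* [N / (x - a) ^ r] is the polynomial in [1 / (x - a)] whose coefficients are
   those of the Taylor expansion of [N] at [a], reversed. *)
Lemma pole_as_poly (N : {poly k}) r : (size N <= r.+1)%N -> ~~ root N a ->
  exists2 f : {poly k}, size f = r.+1 &
    tofrac N / tofrac (('X - a%:P) ^+ r) = evt cK tau f.
Proof.
move=> sN Na; pose N' := N \Po ('X + a%:P).
have sN' : (size N' <= r.+1)%N.
  by rewrite /N' size_comp_poly2 ?size_XaddC.
have NE : N = N' \Po ('X - a%:P).
  by rewrite /N' comp_polyXaddC_K.
pose f := \poly_(i < r.+1) N'`_(r - i).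
have f_top : f`_r != 0.
  rewrite coef_poly ltnSn subnn -horner_coef0 /N' horner_comp !hornerE.
  by rewrite -rootE.
exists f.
  apply/eqP; rewrite eqn_leq size_poly /= ltnNge; apply: contra f_top => le.
  by rewrite nth_default.
have EX : tofrac ('X - a%:P) = tau^-1 :> K by rewrite invrK P1_xE.
have t0 := inv_coord_neq0.
rewrite NE comp_polyE rmorph_sum /= tofracXn EX exprVn invrK.
rewrite /evt (@horner_coef_wide _ r.+1); last by rewrite size_map_poly size_poly.
rewrite mulr_suml.
rewrite (big_ord_widen _ (fun i => tofrac (N'`_i *: ('X - a%:P) ^+ i) * tau ^+ r) sN').
rewrite big_mkcond (reindex_inj rev_ord_inj) /=.
apply: eq_bigr => i _; rewrite coef_map coef_poly ltn_ord subSS.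
have ir : (i <= r)%N by rewrite -ltnS.
case: ltnP => [_|ge]; last first.
  have z0 : N'`_(r - i) = 0 by apply: nth_default.
  by rewrite z0 raddf0 mul0r.
rewrite -mul_polyC tofracM tofracXn EX exprVn -mulrA; congr (_ * _).
have -> : tau ^+ r = tau ^+ (r - i) * tau ^+ i by rewrite -exprD subnK.
by rewrite (mulKf (expf_neq0 _ t0)).
Qed.

End InverseCoordinate.

(** * Lower bound for an arbitrary cover *)

Section CoverLowerBound.
Variables (k : closedFieldType) (p : nat) (Y : splittingFieldType (P1 k)).
Notation K := (P1 k).
Notation cK := (P1_const k).
Notation c := (cover_const Y).
Hypotheses (p_pr : prime p) (chark : p \in [pchar k]).

Section Generator.
Variables (y : Y) (F : K).
Hypotheses (Hy : y ^+ p - y = F%:A) (dimY : \dim {:Y} = p) (genY : <<1; y>>%VS = fullv).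

Lemma generator_shift (h : K) (y' := y - h%:A) :
  y' ^+ p - y' = (F - (h ^+ p - h))%:A /\ <<1; y'>>%VS = fullv.
Proof.
have pn : [pchar Y].-nat p by rewrite pnatE // (pchar_cover Y chark).
split.
  rewrite /y' exprDn_pchar // exprNn_pchar // scalerBl scalerBl algX -Hy; ring.
apply/eqP; rewrite eqEsubv subvf -genY sub_adjoin1v.
rewrite -[y](subrK h%:A); apply: rpredD; first exact: memv_adjoin.
by apply: rpredZ; apply: mem1v.
Qed.

(** A constant is r^p - r with r in k, since k is algebraically closed; then y - r lies in the prime
    field and y generates nothing. *)
Lemma generator_not_const z : F != cK z.
Proof.
apply/negP => /eqP Fz; have charY := pchar_cover Y chark.
have [r rz] : exists r : k, r ^+ p - r = z.
  have : size ('X^p - 'X - z%:P : {poly k}) != 1%N.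
    by rewrite size_as // eqSS -lt0n prime_gt0.
  move=> /closed_rootP[r]; rewrite rootE !hornerD !hornerN hornerC hornerXn hornerX.
  by rewrite subr_eq0 => /eqP <-; exists r.
have e : (y - c r) ^+ p = y - c r.
  have pn : [pchar Y].-nat p by rewrite pnatE.
  apply/eqP; rewrite -subr_eq0; apply/eqP.
  rewrite exprDn_pchar // exprNn_pchar // -rmorphXn /=.
  transitivity ((y ^+ p - y) - c (r ^+ p - r)); first by rewrite rmorphB /=; ring.
  by rewrite Hy Fz rz subrr.
have [j _ ej] := frob_fixed p_pr charY e.
have : y \in 1%VS.
  rewrite -(subrK (c r) y) ej; apply: rpredD; first exact: rpred_nat.
  by apply: rpredZ; apply: mem1v.
move/Fadjoin_idP; rewrite genY => E.
by have := dimY; rewrite E dimv1 => p1; have := prime_gt1 p_pr; rewrite -p1.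
Qed.

Lemma pole_branch (w : place cK) n : (0 < n)%N -> ~~ (p %| n)%N -> F != 0 ->
  w F = - n%:Z -> branch_point Y w.
Proof.
move=> n0 pn F0 wF; exists p, (ram_place p_pr Hy dimY genY F0 wF pn); split.
  exact: ram_place_lies_over.
exact: prime_gt1.
Qed.

End Generator.

Variables (d m : nat).
Hypotheses (cov : Zp_cover p Y) (obp : one_branch_point d Y).
Hypothesis am : a_number c p m.

(* tau is a coordinate of P^1 with its pole at the branch point. *)
Lemma nullity_le_of_coordinate (tau : K) (f : {poly k}) (n : nat) (y : Y) :
  y ^+ p - y = (evt cK tau f)%:A -> \dim {:Y} = p -> <<1; y>>%VS = fullv ->
  (forall h : {poly k}, h != 0 -> evt cK tau h != 0) ->
  (forall b : K, exists u v : {poly k}, v != 0 /\ b = evt cK tau u / evt cK tau v) ->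
  frac_der tau != 0 ->
  size f = n.+1 -> (0 < n)%N -> ~~ (p %| n)%N ->
  (exists (e : nat) (v : place c), v tau%:A < 0 /\ ramification_break v d) ->
  size f = d.+1 /\ (nullity p d f <= m)%N.
Proof.
move=> Hy dimY genY tinj tgen dt0 sf n0 pn [_ [v [tneg rb]]].
have [galY _] := cov.
have rb' := ramification_break_n p_pr chark Hy dimY genY tinj tgen sf n0 pn tneg galY.
have E := ramification_break_uniq rb' rb.
rewrite -E; split=> //.
have [D HD Dt] := exists_derivation p_pr chark Hy dimY genY dt0.
exact: (nullity_le_a_number p_pr chark Hy dimY genY tinj tgen sf n0 pn HD Dt am).
Qed.

(** In standard form each pole of F = N/M has order prime to p and so is a branch point; hence the
    branch point w is the only possible pole. F is then a polynomial in x or in 1/(x - a),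
    nonconstant by [generator_not_const], and its degree is read off from the ramification break. *)
Theorem cover_lower_bound : exists2 f : {poly k}, size f = d.+1 & (nullity p d f <= m)%N.
Proof.
have [galY isoY] := cov.
have [y0 [F0 [Hy0 dimY gen0]]] := as_generator p_pr (pchar_P1 chark) galY isoY.
have [N0 [M0 [M00 F0E]]] := fracP F0.
have [h [N [M [[M1 nm noa noinf] E]]]] := standard_form p_pr chark N0 M00.
have [Hy genY] := generator_shift Hy0 gen0 h; rewrite F0E E in Hy.
move: (y0 - h%:A) Hy genY => y Hy genY {y0 F0 Hy0 gen0 N0 M0 M00 F0E E h}.
have [w [[e [v [lv e1]]] uniqw rb]] := obp.
have [epos lv'] := lv.
have rbv := rb e v lv.
have NM0 : tofrac N / tofrac M != 0 :> K.
  apply/negP => /eqP e0; have := generator_not_const Hy dimY genY 0.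
  by rewrite rmorph0 e0 eqxx.
have N0 : N != 0 by apply: contraNneq NM0 => ->; rewrite tofrac0 mul0r.
have fin a : root M a -> same_place (ord_place a) w.
  move=> ra; apply: uniqw; have [_ wa] := ord_place_pole M1 nm ra.
  exact: (pole_branch Hy dimY genY (mup_gt0 M1 ra) (noa a ra) NM0 wa).
have inf : (size M < size N)%N -> same_place (deg_place k) w.
  move=> lt; apply: uniqw.
  apply: (@pole_branch _ _ Hy dimY genY _ (size N - size M)%N) => //.
  - by rewrite subn_gt0.
  - exact: noinf.
  rewrite deg_placeE // /degz -subzn ?(ltnW lt) //.
  move: N0 M1; rewrite -!size_poly_gt0.
  by case: (size N) => // i; case: (size M) => // j _ _; rewrite /=; lia.
have x0 := P1_x_neq0 k.
have [[wx _]|[a [wa samea]]] := place_P1_cases w.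
  (* A finite pole would identify w with the order at a point, where x has nonnegative value. *)
  have Mconst : size M == 1%N.
    apply: contraTT isT => /closed_rootP[a ra].
    have := fin a ra _ x0; rewrite wx => E.
    have := vge_tofrac a 'X; rewrite (vgeE _ _ x0).
    by rewrite E.
  have [z z0 Mz] := size_poly1P _ Mconst.
  have Fpoly : tofrac N / tofrac M = evt cK (P1_x k) (z^-1 *: N).
    rewrite evt_P1_x Mz -mul_polyC tofracM mulrC; congr (_ * _).
    apply: (mulIf (_ : tofrac z%:P != 0)); first by rewrite tofrac_eq0 polyC_eq0.
    by rewrite mulVf ?tofrac_eq0 ?polyC_eq0 // -tofracM -polyCM mulVf.
  have Hx : y ^+ p - y = (evt cK (P1_x k) (z^-1 *: N))%:A by rewrite Hy Fpoly.
  have sN : size (z^-1 *: N) = size N by rewrite size_scale // invr_eq0.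
  have N1 : (1 < size N)%N.
    rewrite ltnNge; apply/negP => /size1_polyC NC.
    have := generator_not_const Hx dimY genY (z^-1 * N`_0).
    by rewrite {1}NC -mul_polyC -polyCM evtC eqxx.
  have M_1 := eqP Mconst.
  have sf : size (z^-1 *: N) = (size N).-1.+1 by rewrite sN (ltn_predK N1).
  have dx : frac_der (P1_x k) != 0 by rewrite frac_der_x oner_neq0.
  have n1 : (0 < (size N).-1)%N by rewrite -subn1 subn_gt0.
  have pn1 : ~~ (p %| (size N).-1)%N by have := noinf; rewrite M_1 subn1; apply.
  have ex : exists (e : nat) (v : place c), v (P1_x k)%:A < 0 /\ ramification_break v d.
    by exists e, v; rewrite lv' // wx mulrN1 oppr_lt0 ltz_nat.
  have [s1 s2] := nullity_le_of_coordinate Hx dimY genY (@x_inj k) (@x_gen k) dx sf n1 pn1 ex.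
  by exists (z^-1 *: N).
have xa0 := P1_x_neq_const a.
(* A pole at infinity would identify w with the degree place, where x - a has value - 1 instead of
   1. *)
have NM : (size N <= size M)%N.
  rewrite leqNgt; apply/negP => /inf /(_ _ xa0); rewrite wa P1_xE.
  rewrite -[tofrac _]divr1 -tofrac1 deg_placeE ?polyXsubC_eq0 ?oner_neq0 //.
  by rewrite /degz size_XsubC size_poly1.
have onlya b : root M b -> b = a.
  move=> rb'; have := fin b rb' _ xa0; rewrite wa.
  rewrite P1_xE -[tofrac _]divr1 -tofrac1 ord_placeE ?polyXsubC_eq0 ?oner_neq0 //.
  rewrite mup_const ?oner_neq0 // subr0 -['X - _]expr1 mup_XsubCX.
  by case: eqP.
have ME : M = lead_coef M *: ('X - a%:P) ^+ (size M).-1.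
  have [rs Ers] := closed_field_poly_normal M.
  have srs : size rs = (size M).-1.
    by rewrite {1}Ers size_scale ?lead_coef_eq0 // size_prod_XsubC.
  rewrite {1}Ers; congr (_ *: _).
  have /all_pred1P rsE : all (pred1 a) rs.
    apply/allP => b brs /=; apply/eqP/onlya.
    by rewrite Ers rootZ ?lead_coef_eq0 // root_prod_XsubC.
  by rewrite -srs {1}rsE big_nseq iter_mulr_1.
set l := lead_coef M in ME; set r := (size M).-1 in ME.
have l0 : l != 0 by rewrite lead_coef_eq0.
have sM : size M = r.+1 by rewrite /r prednK // size_poly_gt0.
have lF : tofrac l%:P != 0 :> K by rewrite tofrac_eq0 polyC_eq0.
have rpos : (0 < r)%N.
  rewrite lt0n; apply/negP => /eqP r0.
  have NC : N = (N`_0)%:P by apply: size1_polyC; rewrite (leq_trans NM) // sM r0.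
  have := generator_not_const Hy dimY genY (N`_0 / l).
  rewrite ME r0 expr0 {1}NC -mul_polyC mulr1.
  have -> : cK (N`_0 / l) = tofrac (N`_0)%:P / tofrac l%:P by rewrite fmorph_div.
  by rewrite eqxx.
have Ma : root M a by rewrite ME rootZ // rootE horner_exp !hornerE subrr expr0n gtn_eqF.
have mupM : mup a M = r by rewrite ME -mul_polyC mupMr ?rootC // mup_XsubCX eqxx.
have sNr : (size N <= r.+1)%N by rewrite -sM.
have [g sg Eg] := pole_as_poly sNr (coprimep_nroot nm Ma).
have Hx : y ^+ p - y = (evt cK (inv_coord a) (l^-1 *: g))%:A.
  rewrite Hy; congr (_%:A); rewrite evtZ -Eg ME -mul_polyC tofracM.
  rewrite invfM mulrCA; congr (_ * _); apply: (mulIf lF).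
  by rewrite mulVf // -tofracM -polyCM mulVf.
have sf : size (l^-1 *: g) = r.+1 by rewrite size_scale ?invr_eq0.
have pr : ~~ (p %| r)%N by rewrite -mupM; apply: noa.
have ex : exists (e : nat) (v : place c), v (inv_coord a)%:A < 0 /\ ramification_break v d.
  exists e, v; split=> //.
  by rewrite lv' ?inv_coord_neq0 // val_inv_coord wa mulrN1 oppr_lt0 ltz_nat.
have [s1 s2] := nullity_le_of_coordinate Hx dimY genY (@inv_coord_inj k a) (@inv_coord_gen k a)
  (frac_der_inv_coord a) sf rpos pr ex.
by exists (l^-1 *: g).
Qed.

End CoverLowerBound.

(** * Bounds for the nullity *)

Section RankBounds.
Variable F : fieldType.

Definition select_mx m (S : {set 'I_m}) : 'M[F]_m := \sum_(i in S) delta_mx i i.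

Lemma rank_select m (S : {set 'I_m}) : (\rank (select_mx S) <= #|S|)%N.
Proof.
rewrite /select_mx -sum1_card; elim/big_rec2: _ => [|i r M _ IH]; first by rewrite mxrank0.
by apply: leq_trans (mxrank_add _ _) _; rewrite mxrank_delta leq_add2l.
Qed.

Lemma select_mul m n (S : {set 'I_m}) (B : 'M[F]_(m, n)) i j :
  (select_mx S *m B) i j = if i \in S then B i j else 0.
Proof.
rewrite /select_mx mulmx_suml summxE; have [iS|iS] := boolP (i \in S).
  rewrite (bigD1 i) //= big1 ?addr0 => [|l /andP[_ li]].
    rewrite mxE (bigD1 i) //= big1 ?addr0 => [|q qi]; first by rewrite mxE !eqxx mul1r.
    by rewrite mxE (negPf qi) andbF mul0r.
  by rewrite mxE big1 // => q _; rewrite mxE eq_sym (negPf li) mul0r.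
rewrite big1 // => l lS; rewrite mxE big1 // => q _; rewrite mxE.
have [e|_] := eqVneq i l; last by rewrite mul0r.
by rewrite e lS in iS.
Qed.

Lemma mul_select m n (S : {set 'I_n}) (B : 'M[F]_(m, n)) i j :
  (B *m select_mx S) i j = if j \in S then B i j else 0.
Proof.
have -> : B *m select_mx S = (select_mx S *m B^T)^T.
  rewrite trmx_mul trmxK; congr (_ *m _); rewrite /select_mx raddf_sum /=.
  by apply: eq_bigr => l _; rewrite trmx_delta.
by rewrite mxE select_mul mxE.
Qed.

(** B is the sum of its columns in J and of a matrix supported on the rows outside I. *)
Lemma rank_block m n (B : 'M[F]_(m, n)) (I : {set 'I_m}) (J : {set 'I_n}) :
  (forall i j, i \in I -> j \notin J -> B i j = 0) -> (\rank B <= #|J| + #|~: I|)%N.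
Proof.
move=> h; have -> : B = B *m select_mx J + select_mx (~: I) *m (B - B *m select_mx J).
  apply/matrixP => i j; rewrite mxE select_mul mul_select.
  rewrite [fun_of_matrix (B - _) i j]mxE [fun_of_matrix (- _) i j]mxE mul_select inE; have [iI|iI] /= := boolP (i \in I).
    by rewrite addr0; case: ifPn => // jJ; rewrite (h _ _ iI jJ).
  by rewrite addrC subrK.
apply: leq_trans (mxrank_add _ _) _; apply: leq_add.
  by apply: leq_trans (mxrankM_maxr _ _) (rank_select _).
by apply: leq_trans (mxrankM_maxl _ _) (rank_select _).
Qed.

(** The hypothesis makes the projection to the coordinates in S injective on the kernel. *)
Lemma rank_ker_le m n (B : 'M[F]_(m, n)) (S : {set 'I_m}) :
  (forall u : 'rV[F]_m, u *m B = 0 -> (forall i, i \in S -> u 0 i = 0) -> u = 0) ->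
  (\rank (kermx B) <= #|S|)%N.
Proof.
move=> h; rewrite -(mxrank_mul_ker (kermx B) (select_mx S)).
rewrite (_ : (kermx B :&: kermx (select_mx S))%MS = 0) ?mxrank0 ?addn0.
  by apply: leq_trans (mxrankM_maxr _ _) (rank_select _).
apply/eqP; rewrite -submx0; apply/row_subP => i; rewrite submx0; apply/eqP.
set u := row i _.
have uS : (u <= kermx B :&: kermx (select_mx S))%MS by apply: row_sub.
move: uS; rewrite sub_capmx => /andP[/sub_kermxP uB /sub_kermxP uk].
apply: (h u uB) => j jS; have := congr1 (fun M : 'rV[F]_m => M 0 j) uk.
by rewrite mul_select jS => ->; rewrite mxE.
Qed.

End RankBounds.

Lemma card_enum_val (T : finType) (P : pred T) :
  #|[set r : 'I_#|T| | P (enum_val r)]| = #|[set x | P x]|.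
Proof.
rewrite -(card_imset _ (@enum_val_inj T _)); apply: eq_card => x.
apply/imsetP/idP => [[r + ->]|]; first by rewrite !inE.
by rewrite inE => Px; exists (enum_rank x); rewrite ?inE enum_rankK.
Qed.

Section NullityBounds.
Variables (k : closedFieldType) (p n : nat).
Hypotheses (p_pr : prime p).
Notation A m := (m * n %/ p)%N.

Lemma card_pairs_dep N (h : 'I_p -> nat) (P : 'I_p -> nat -> bool) : (forall i, h i <= N)%N ->
  #|[set x : 'I_p * 'I_N | P x.1 x.2 && (x.2 < h x.1)%N]| = (\sum_i \sum_(a < h i) P i a)%N.
Proof.
move=> hN; rewrite -sum1_card.
transitivity (\sum_(i : 'I_p) \sum_(a : 'I_N | P i a && (a < h i)) 1)%N.
  by rewrite pair_big_dep /=; apply: eq_bigl => -[i a]; rewrite inE.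
apply: eq_bigr => i _; rewrite (big_ord_widen N (fun a => P i a : nat) (hN i)).
rewrite big_mkcondl big_mkcond [RHS]big_mkcond /=.
by apply: eq_bigr => a _; case: (P i a); case: ifP.
Qed.

Lemma card_pairs N (h : 'I_p -> nat) (P : pred 'I_p) : (forall i, h i <= N)%N ->
  #|[set x : 'I_p * 'I_N | P x.1 && (x.2 < h x.1)%N]| = (\sum_(i | P i) h i)%N.
Proof.
move=> hN; rewrite (card_pairs_dep (fun i _ => P i) hN) [RHS]big_mkcond.
by apply: eq_bigr => i _; rewrite sum_nat_const card_ord; case: (P i); rewrite ?muln1 ?muln0.
Qed.

Lemma A_le m : (m <= p)%N -> (A m <= n)%N.
Proof.
move=> mp; rewrite -(@leq_pmul2r p) ?prime_gt0 //.
by apply: leq_trans (leq_trunc_div _ _) _; rewrite mulnC leq_mul2l mp orbT.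
Qed.

(* If only the layers i <= p-1-j are kept, the condition at X^(pb+p-1) in the
   component l = p-1-m is vacuous unless j <= m and b < cond_bound j m. *)
Definition cond_bound j m := (((m - j) * n + A j) %/ p)%N.

Lemma sum_rev (h : nat -> nat) j : (j < p)%N ->
  (\sum_(i < p | (j <= p.-1 - i)%N) h (p.-1 - i) = \sum_(j <= m < p) h m)%N.
Proof.
move=> jp; rewrite (reindex_inj rev_ord_inj) /=.
have E (i : 'I_p) : (p.-1 - (p - i.+1))%N = i by have := ltn_ord i; lia.
under eq_bigl => i do rewrite E.
under eq_bigr => i _ do rewrite E.
rewrite big_geq_mkord; apply: eq_bigl => i; by [].
Qed.

Lemma card_form_index_dep (P : 'I_p -> nat -> bool) :
  #|[set r : 'I_#|form_index p n| | P (fidx r).1 (fidx r).2]| =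
    (\sum_(i < p) \sum_(a < A (p.-1 - i)) P i a)%N.
Proof.
pose Q : pred ('I_p * 'I_n) := fun x => P x.1 x.2.
rewrite (@card_enum_val _ (fun x : form_index p n => Q (val x))).
rewrite -(@card_pairs_dep n (fun i => A (p.-1 - i))); last by move=> i; apply: A_le; lia.
rewrite -(card_imset _ val_inj); apply: eq_card => x.
apply/imsetP/idP => [[r + ->]|]; rewrite !inE.
  by move=> Qr; apply/andP; split; [exact: Qr|exact: (valP r)].
by case/andP => Px h; exists (Sub x h); rewrite ?inE ?SubK.
Qed.

Lemma card_form_index_pred (P : pred 'I_p) :
  #|[set r : 'I_#|form_index p n| | P (fidx r).1]| = (\sum_(i | P i) A (p.-1 - i))%N.
Proof.
rewrite (card_form_index_dep (fun i _ => P i)) [RHS]big_mkcond.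
by apply: eq_bigr => i _; rewrite sum_nat_const card_ord; case: (P i); rewrite ?muln1 ?muln0.
Qed.

Lemma nullity_eq (f : {poly k}) : nullity p n f = (#|form_index p n| - \rank (cartier_mx p n f))%N.
Proof. by rewrite /nullity mxrank_ker. Qed.

Lemma A_step m j : (j <= m)%N -> (A m <= (m - j) * n + A j)%N.
Proof.
move=> jm; have pp := prime_gt0 p_pr.
rewrite -(divnMDl _ _ pp); apply: leq_div2r.
have -> : (m * n = (m - j) * n + j * n)%N by rewrite -mulnDl subnK.
by rewrite leq_add2r leq_pmulr.
Qed.

(** The binomial coefficient vanishes for i < l; otherwise the exponent p b + p - 1 exceeds the
    degree (i - l) n + a. *)
Lemma cartier_coef_eq0 (f : {poly k}) j (x s : 'I_p * 'I_n) : (size f <= n.+1)%N ->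
  (j <= p.-1 - x.1)%N -> (x.2 < A (p.-1 - x.1))%N ->
  ~~ ((j <= p.-1 - s.1)%N && (s.2 < cond_bound j (p.-1 - s.1))%N) ->
  cartier_coef f x s = 0.
Proof.
case: x s => [i a] [l b] /= sf ji ha hb; rewrite /cartier_coef /=.
have [il|li] := ltnP i l; first by rewrite bin_small.
have pp := prime_gt0 p_pr; have ip := ltn_ord i; have lp := ltn_ord l.
have jl : (j <= p.-1 - l)%N by apply: leq_trans ji _; apply: leq_sub2l.
move: hb; rewrite jl /= -leqNgt => hb.
have hb' : ((p.-1 - l - j) * n + A j < p * b + p)%N.
  apply: leq_trans (ltn_ceil _ pp) _; rewrite mulnC [(p * b + p)%N]addnC -mulnS leq_mul2l ltnS.
  by apply/orP; right.
have sN : (size (- f) <= n.+1)%N by rewrite size_polyN.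
have sX e : (size ((- f) ^+ e) <= (n * e).+1)%N.
  apply: leq_trans (size_poly_exp_leq _ _) _; rewrite ltnS leq_mul2r.
  by apply/orP; right; rewrite -subn1 leq_subLR add1n.
rewrite nth_default ?mul0rn //.
apply: leq_trans (size_polyMleq _ _) _; rewrite size_polyXn addnS /=.
apply: leq_trans (leq_add (sX _) (leqnn _)) _.
have st : ((p.-1 - i - j) * n + A j >= A (p.-1 - i))%N by apply: A_step.
have e1 : (p.-1 - l - j = (i - l) + (p.-1 - i - j))%N by move: ji li ip lp; clear; lia.
move: hb'; rewrite e1 mulnDl -addnA [(n * _)%N]mulnC => hb'.
have pb : (p * b + p = (p * b + p.-1).+1)%N by rewrite -addnS prednK.
move: hb' st ha; rewrite pb.
move: ((i - l) * n)%N ((p.-1 - i - j) * n)%N (A j) (A _) (p * b + p.-1)%N (val a) => u1 u2 u3 u4 u5 u6.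
by clear; lia.
Qed.

(** The unknowns I of the kept layers enter only the conditions J, so at least #|I| - #|J|
    independent solutions remain. *)
Lemma nullity_ge (f : {poly k}) j : (size f <= n.+1)%N -> (1 <= j < p)%N ->
  (\sum_(j <= m < p) A m <= nullity p n f + \sum_(j <= m < p) cond_bound j m)%N.
Proof.
move=> sf /andP[j1 jp].
pose I : {set 'I_#|form_index p n|} := [set r | (j <= p.-1 - (fidx r).1)%N].
pose condP : pred ('I_p * 'I_n) :=
  fun x => (j <= p.-1 - x.1)%N && (x.2 < cond_bound j (p.-1 - x.1))%N.
pose J : {set 'I_#|cond_index p n|} := [set s | condP (enum_val s)].
have cI : #|I| = (\sum_(j <= m < p) A m)%N.
  by rewrite (@card_form_index_pred (fun i => (j <= p.-1 - i)%N)) (sum_rev (fun m => A m)).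
have cJ : #|J| = (\sum_(j <= m < p) cond_bound j m)%N.
  rewrite (@card_enum_val _ (condP : pred (cond_index p n))).
  rewrite (@card_pairs n (fun i => cond_bound j (p.-1 - i)) (fun i => j <= p.-1 - i)%N).
    by rewrite (sum_rev (cond_bound j)).
  move=> i; rewrite /cond_bound; have pp := prime_gt0 p_pr.
  have aj : (A j <= j * n)%N by apply: leq_div.
  rewrite -(@leq_pmul2r p) //; apply: leq_trans (leq_trunc_div _ _) _.
  have aj' := A_le (ltnW jp); have ip := ltn_ord i.
  apply: (@leq_trans ((p.-1 - i - j) * n + n)%N); first by rewrite leq_add2l.
  by rewrite addnC -mulSn mulnC leq_mul2l; apply/orP; right; lia.
have hB : forall r s, r \in I -> s \notin J -> cartier_mx p n f r s = 0.
  move=> r s; rewrite !inE => rI sJ; rewrite mxE; apply: (cartier_coef_eq0 sf rI) => //.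
  exact: (valP (enum_val r)).
have := rank_block hB; rewrite cJ -cI => rk.
have cT : (#|I| + #|~: I| = #|form_index p n|)%N by rewrite cardsC card_ord.
by rewrite nullity_eq; move: rk cT; clear; lia.
Qed.

(** P marks the coefficients left free: if an element of the kernel is determined by its marked
    coefficients, their number bounds the nullity. *)
Lemma nullity_le (f : {poly k}) (P : nat -> nat -> bool) : (size f <= n.+1)%N ->
  (forall g : nat -> {poly k},
    (forall i a, (i < p)%N -> (A (p.-1 - i) <= a)%N -> (g i)`_a = 0) ->
    (forall l e, (l < p)%N -> (e %% p = p.-1)%N -> (frob_part p f g l)`_e = 0) ->
    (forall i a, (i < p)%N -> P i a -> (g i)`_a = 0) ->
    forall i a, (i < p)%N -> (g i)`_a = 0) ->
  (nullity p n f <= \sum_(i < p) \sum_(a < A (p.-1 - i)) P i a)%N.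
Proof.
move=> sf H; rewrite -(card_form_index_dep (fun i a => P i a)).
apply: rank_ker_le => u /(kernel_row p_pr sf) ku uS.
apply: (poly_of_row_inj ) => i ip; apply/polyP => a; rewrite coef0.
apply: (H (poly_of_row u)) => // {i a ip}.
- move=> i a ip Aa; apply: nth_default; apply: leq_trans Aa.
  by rewrite leq_divRL ?prime_gt0 // size_poly_of_row.
- by move=> l e lp ep; rewrite (divn_eq e p) ep mulnC ku.
- move=> i a ip Pia; rewrite /poly_of_row coef_sum big1 // => r _.
  case: eqP => [ei|_]; last by rewrite coef0.
  rewrite coefZ coefXn; have [ea|_] := eqVneq a (fidx r).2; last by rewrite mulr0.
  by rewrite uS ?mul0r // inE ei -ea.
Qed.

End NullityBounds.

Lemma floor_ratr (a b : nat) : (0 < b)%N -> Num.floor (a%:R / b%:R : rat) = (a %/ b)%N%:Z.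
Proof.
move=> b0; have b0' : (0 : rat) < b%:R by rewrite ltr0n.
apply: floor_def; rewrite -[_ + 1]/((a %/ b)%N%:Z + 1%N%:Z) -PoszD -!pmulrn.
rewrite ler_pdivlMr // ltr_pdivrMr // -!natrM ler_nat ltr_nat leq_trunc_div /=.
by rewrite addn1 ltn_ceil.
Qed.

Lemma bigmax_int_eq (r : seq nat) (h : nat -> int) (M : int) : 0 <= M ->
  (forall j, j \in r -> h j <= M) -> (exists2 j, j \in r & h j = M) ->
  \big[Num.max/0]_(j <- r) h j = M.
Proof.
move=> M0 le [j jr hj]; apply/eqP; rewrite eq_le; apply/andP; split.
  by rewrite big_seq; elim/big_rec: _ => // i x ir xM; rewrite ge_max le.
elim: r jr {le} => // i r IH; rewrite in_cons big_cons => /orP[/eqP <-|/IH le].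
  by rewrite hj le_max lexx.
by rewrite le_max le orbT.
Qed.

Lemma L_bound_eq p n N j0 : prime p -> (1 <= j0 < p)%N ->
  (forall j, (1 <= j < p)%N ->
    (\sum_(j <= m < p) (m * n %/ p) <= N + \sum_(j <= m < p) cond_bound p n j m)%N) ->
  (N + \sum_(j0 <= m < p) cond_bound p n j0 m <= \sum_(j0 <= m < p) (m * n %/ p))%N ->
  N%:Z = L_bound p n.
Proof.
move=> p_pr j0p lo up; have pp := prime_gt0 p_pr.
pose h j : int := (\sum_(j <= m < p) (m * n %/ p))%N%:Z - (\sum_(j <= m < p) cond_bound p n j m)%N%:Z.
have -> : L_bound p n = \big[Num.max/0]_(j <- index_iota 1 p) h j.
  apply: eq_big_nat => j /andP[j1 jp].
  rewrite /h -!natz !natr_sum -sumrB; apply: eq_big_nat => i /andP[ji ip].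
  (* Over the common denominator p^2, dividing twice by p turns the second floor into
     [cond_bound]. *)
  rewrite !natz floor_ratr // (_ : _ - (1 - _) * _ = (((i - j) * n * p + j * n)%:R / (p * p)%:R : rat)).
    by rewrite floor_ratr ?muln_gt0 ?pp // divnMA divnMDl.
  have pr : (p%:R : rat) != 0 by rewrite pnatr_eq0 -lt0n.
  rewrite -{1}(subnK ji) !(natrD, natrM); field.
  exact: pr.
apply/esym/bigmax_int_eq => //.
  by move=> j; rewrite mem_index_iota => jp; have := lo j jp; rewrite /h; lia.
exists j0; first by rewrite mem_index_iota.
have := lo j0 j0p; move: up; rewrite /h; lia.
Qed.

(** * Polynomials attaining the lower bound *)

Section Trinomial.
Variables (k : fieldType) (d s t : nat) (tau : bool).

Definition trinomial : {poly k} := 'X^d + 'X^s + 'X^t *+ tau.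
Notation f := trinomial.

(** The coefficient of X^m h at e; the test guards against truncated subtraction. *)
Definition shift m (h : {poly k}) e : k := if (e < m)%N then 0 else h`_(e - m).

Lemma shift0 m (h : {poly k}) e : ((m <= e)%N -> h`_(e - m) = 0) -> shift m h e = 0.
Proof. by rewrite /shift; case: ltnP => // me h0; apply: h0. Qed.

Lemma shiftK m (h : {poly k}) a : shift m h (a + m) = h`_a.
Proof. by rewrite /shift ltnNge leq_addl addnK. Qed.

Lemma trinomial_mul (h : {poly k}) e :
  (f * h)`_e = shift d h e + shift s h e + shift t h e *+ tau.
Proof. by rewrite !mulrDl !coefD mulrnAl coefMn !coefXnM. Qed.

Lemma trinomial_sq_mul (h : {poly k}) e :
  (f ^+ 2 * h)`_e = shift (d + d) h e + shift (d + s) h e *+ 2 + shift (s + s) h e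
    + (shift (d + t) h e *+ 2 + shift (s + t) h e *+ 2 + shift (t + t) h e) *+ tau.
Proof.
have -> : f ^+ 2 * h = 'X^(d + d) * h + 'X^(d + s) * h *+ 2 + 'X^(s + s) * h
    + ('X^(d + t) * h *+ 2 + 'X^(s + t) * h *+ 2 + 'X^(t + t) * h) *+ tau.
  rewrite !exprD /f; case: tau => /=; ring.
by rewrite !(coefD, coefMn) !coefXnM.
Qed.

Lemma coef_trinomial i : (s < d)%N -> (tau -> t < s)%N ->
  f`_i = ((i == d) || (i == s) || (tau && (i == t)))%:R.
Proof.
move=> sd ts; rewrite !coefD coefMn !coefXn; case: tau ts => /= ts.
  have {}ts := ts isT; rewrite mulr1n.
  have [->|_] := eqVneq i d; first by rewrite (gtn_eqF sd) (gtn_eqF (ltn_trans ts sd)) !addr0.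
  have [->|_] := eqVneq i s; first by rewrite (gtn_eqF ts) add0r addr0.
  by rewrite !add0r.
rewrite mulr0n addr0 orbF; have [->|_] := eqVneq i d; first by rewrite (gtn_eqF sd) addr0.
by rewrite add0r.
Qed.

Lemma size_trinomial : (s < d)%N -> (tau -> t < s)%N -> size f = d.+1.
Proof.
move=> sd ts; rewrite /f -addrA size_polyDl size_polyXn // ltnS.
apply: leq_trans (size_polyD _ _) _; rewrite geq_max size_polyXn sd /=.
case: tau ts => /= [/(_ isT) ts|_]; last by rewrite size_poly0.
by rewrite size_polyXn (leq_trans ts (ltnW sd)).
Qed.

End Trinomial.

Lemma from_Fp_trinomial (k : fieldType) p d s t (tau : bool) : prime p -> p \in [pchar k] ->
  (s < d)%N -> (tau -> t < s)%N ->
  from_Fp k (trinomial 'F_p d s t tau) = trinomial k d s t tau.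
Proof.
move=> p_pr chk sd ts; apply/polyP => i; rewrite coef_map_id0 //.
by rewrite !coef_trinomial //; case: (_ || _).
Qed.

(** The coefficients of g1 vanish from the top down: at the exponent a + d, or a + s in the window
    from A4 to d, g0 has no coefficient and the other monomials meet g1 only above a. *)
Lemma layer01_eq0 (k : fieldType) (d s t : nat) (tau : bool) (A3 A4 : nat)
    (g0 g1 : {poly k}) : (s < d)%N -> (t < s)%N -> (A4 <= d)%N ->
  (forall a, (A4 <= a)%N -> g0`_a = 0) -> (forall a, (A3 <= a)%N -> g1`_a = 0) ->
  (forall e, (e %% 5 = 4)%N -> g1`_e = 0) ->
  (forall e, (e %% 5 = 4)%N -> g0`_e = (trinomial k d s t tau * g1)`_e) ->
  (forall a, (a %% 5 != 4)%N -> g0`_a = 0) ->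
  (forall a, (a %% 5 != 4)%N -> ((a + d) %% 5 != 4)%N ->
     ~~ (((a + s) %% 5 == 4) && (A4 <= a + s < d))%N -> g1`_a = 0) ->
  (forall a, g0`_a = 0) /\ (forall a, g1`_a = 0).
Proof.
move=> sd ts A4d z0 z1 h1 h0 free0 free1.
have g1_0 n a : (A3 <= a + n)%N -> g1`_a = 0.
  elim: n a => [|n IH] a aA; first by apply: z1; rewrite -(addn0 a).
  have {}IH b : (a < b)%N -> g1`_b = 0 by move=> ab; apply: IH; lia.
  have [a4|n4] := eqVneq (a %% 5)%N 4%N; first exact: h1.
  have [ad|nd] := eqVneq ((a + d) %% 5)%N 4%N.
    have := h0 _ ad; rewrite trinomial_mul shiftK z0; last by lia.
    rewrite (@shift0 _ s) => [|_]; last by apply: IH; lia.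
    rewrite (@shift0 _ t) => [|_]; last by apply: IH; lia.
    by rewrite mul0rn !addr0.
  have [/andP[/eqP as_ /andP[ge lt]]|ns] := boolP (((a + s) %% 5 == 4) && (A4 <= a + s < d))%N.
    have := h0 _ as_; rewrite trinomial_mul shiftK z0 //.
    rewrite (@shift0 _ d) => [|?]; last by lia.
    rewrite (@shift0 _ t) => [|_]; last by apply: IH; lia.
    by rewrite mul0rn add0r addr0.
  exact: free1.
have {}g1_0 a : g1`_a = 0 by apply: (g1_0 A3); apply: leq_addl.
split=> // a; have [a4|n4] := eqVneq (a %% 5)%N 4%N; last exact: free0.
by rewrite h0 // trinomial_mul !shift0 ?mul0rn ?addr0.
Qed.

(** * Vanishing of the upper layers for p = 5 *)

Section PeelFive.
Variables (k : fieldType) (d s t : nat) (tau : bool).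
Hypothesis two0 : (2 : k) != 0.
Variables A1 A2 A3 A4 : nat.
Hypothesis (d5 : (d %% 5 != 0)%N) (sd5 : (s %% 5 = (3 * d) %% 5)%N).
Notation f := (trinomial k d s t tau).

Lemma double0 (x : k) : x *+ 2 = 0 -> x = 0.
Proof. by rewrite -mulr_natl => /eqP; rewrite mulf_eq0 (negPf two0) => /eqP. Qed.

(** As s = 3d mod 5, the shifts 0, d, s, 2d, d + s cover all residues mod 5. Each coefficient is
    thus hit by a condition on h, f h or f^2 h, and the size bounds make it the only
    contribution. *)
Lemma layer3_eq0 (h : {poly k}) :
  (A1 + s <= d)%N -> (t + A2 <= s)%N -> (A1 <= A2)%N ->
  (forall a, (A1 <= a)%N -> h`_a = 0) ->
  (forall e, (e %% 5 = 4)%N -> h`_e = 0) ->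
  (forall e, (e %% 5 = 4)%N -> (A2 <= e)%N -> (f * h)`_e = 0) ->
  (forall e, (e %% 5 = 4)%N -> (d + A2 <= e)%N -> (f ^+ 2 * h)`_e = 0) ->
  forall a, h`_a = 0.
Proof.
move=> A1d tA A12 hA h4 h1 h2 a; have [aA|/hA //] := ltnP a A1.
have [a4|n4] := eqVneq (a %% 5)%N 4%N; first exact: h4.
have [ad|nd] := eqVneq ((a + d) %% 5)%N 4%N.
  have := h1 _ ad; rewrite trinomial_mul shiftK.
  rewrite (@shift0 _ s) => [|_]; last by apply: hA; lia.
  rewrite (@shift0 _ t) => [|_]; last by apply: hA; lia.
  by rewrite mul0rn !addr0; apply; lia.
have [as_|ns] := eqVneq ((a + s) %% 5)%N 4%N.
  have := h1 _ as_; rewrite trinomial_mul shiftK.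
  rewrite (@shift0 _ d) => [|?]; last by lia.
  rewrite (@shift0 _ t) => [|_]; last by apply: hA; lia.
  by rewrite mul0rn add0r addr0; apply; lia.
have [ad2|nd2] := eqVneq ((a + (d + d)) %% 5)%N 4%N.
  have := h2 _ ad2; rewrite trinomial_sq_mul shiftK.
  rewrite (@shift0 _ (d + s)) => [|_]; last by apply: hA; lia.
  rewrite (@shift0 _ (s + s)) => [|_]; last by apply: hA; lia.
  rewrite (@shift0 _ (d + t)) => [|_]; last by apply: hA; lia.
  rewrite (@shift0 _ (s + t)) => [|_]; last by apply: hA; lia.
  rewrite (@shift0 _ (t + t)) => [|_]; last by apply: hA; lia.
  by rewrite !(mul0rn, addr0); apply; lia.
have ads : ((a + (d + s)) %% 5 = 4)%N by lia.
have := h2 _ ads; rewrite trinomial_sq_mul shiftK.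
rewrite (@shift0 _ (d + d)) => [|?]; last by lia.
rewrite (@shift0 _ (s + s)) => [|_]; last by apply: hA; lia.
rewrite (@shift0 _ (d + t)) => [|_]; last by apply: hA; lia.
rewrite (@shift0 _ (s + t)) => [|_]; last by apply: hA; lia.
rewrite (@shift0 _ (t + t)) => [|_]; last by apply: hA; lia.
by rewrite !(mul0rn, addr0, add0r) => /(_ ltac:(lia)) /double0.
Qed.

Section Layer2.
Variable h : {poly k}.
Hypotheses (sd : (s < d)%N) (tA2 : (t + A2 <= s)%N) (A3d : (A3 <= d)%N)
  (A2ds : (A2 + 2 * s <= 2 * d)%N).
Hypothesis hA : forall a, (A2 <= a)%N -> h`_a = 0.
Hypothesis h4 : forall e, (e %% 5 = 4)%N -> h`_e = 0.
Hypothesis h1 : forall e, (e %% 5 = 4)%N -> (A3 <= e)%N -> (f * h)`_e = 0.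
Hypothesis h2 : forall e, (e %% 5 = 4)%N -> (d + A3 <= e)%N -> (f ^+ 2 * h)`_e = 0.

(** In the intended range s is about 3d/5 and A2 is 2d/5, so a + d - s may fall below A2: one
    condition then couples two coefficients of h. *)
Lemma layer2_d a : ((a + d) %% 5 = 4)%N -> h`_a + h`_(a + d - s) = 0.
Proof.
move=> ad; have := h1 ad; rewrite trinomial_mul shiftK.
rewrite (@shift0 _ t) => [|_]; last by apply: hA; lia.
rewrite mul0rn addr0 {1}/shift ltnNge (_ : (s <= a + d)%N) /=; last by lia.
by apply; lia.
Qed.

Lemma layer2_dd a : ((a + (d + d)) %% 5 = 4)%N -> h`_a + h`_(a + d - s) *+ 2 = 0.
Proof.
move=> ad; have := h2 ad; rewrite trinomial_sq_mul shiftK.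
rewrite (@shift0 _ (s + s)) => [|_]; last by apply: hA; lia.
rewrite (@shift0 _ (d + t)) => [|_]; last by apply: hA; lia.
rewrite (@shift0 _ (s + t)) => [|_]; last by apply: hA; lia.
rewrite (@shift0 _ (t + t)) => [|_]; last by apply: hA; lia.
rewrite !(mul0rn, addr0) {1}/shift ltnNge (_ : (d + s <= a + (d + d))%N) /=; last by lia.
rewrite (_ : a + (d + d) - (d + s) = a + d - s)%N; last by lia.
by apply; lia.
Qed.

Lemma layer2_good a : (a + d)%N = 4 %[mod 5] \/ (a + (d + d))%N = 4 %[mod 5] ->
  (A2 <= a + d - s)%N -> h`_a = 0.
Proof.
move=> ad aA; have hd := hA aA.
by case: ad => [/layer2_d|/layer2_dd]; rewrite hd ?mul0rn addr0.
Qed.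

Lemma layer2_s a : ((a + s) %% 5 = 4)%N -> (a + s < d)%N -> (A3 <= a + s)%N -> h`_a = 0.
Proof.
move=> as_ lt ge; have := h1 as_ ge; rewrite trinomial_mul shiftK.
rewrite (@shift0 _ d) => [|?]; last by lia.
rewrite (@shift0 _ t) => [|_]; last by apply: hA; lia.
by rewrite mul0rn add0r addr0.
Qed.

Lemma layer2_ds a : ((a + (d + s)) %% 5 = 4)%N -> (a + s < d)%N -> (A3 <= a + s)%N -> h`_a = 0.
Proof.
move=> ads lt ge; have := h2 ads; rewrite trinomial_sq_mul shiftK.
rewrite (@shift0 _ (d + d)) => [|?]; last by lia.
rewrite (@shift0 _ (s + s)) => [|?]; last by apply: layer2_good; [left|]; lia.
rewrite (@shift0 _ (d + t)) => [|_]; last by apply: hA; lia.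
rewrite (@shift0 _ (s + t)) => [|_]; last by apply: hA; lia.
rewrite (@shift0 _ (t + t)) => [|_]; last by apply: hA; lia.
by rewrite !(mul0rn, addr0, add0r) => /(_ ltac:(lia)) /double0.
Qed.

(** The same residues are exhausted, but coupled pairs a, a + d - s can occur; [pair] kills one
    member of each and the coupling kills the other. [small] rules out coefficients whose condition
    at a + s or a + d + s is below the usable range. *)
Lemma layer2_eq0 :
  (forall a, (a + s < A3)%N -> (a + s) %% 5 != 4 /\ (a + (d + s)) %% 5 != 4)%N ->
  (forall a, (a + d < A2 + s)%N ->
    (a + d)%N = 4 %[mod 5] \/ (a + (d + d))%N = 4 %[mod 5] ->
    h`_a = 0 \/ h`_(a + d - s) = 0) ->
  forall a, h`_a = 0.
Proof.
move=> small pair; have H a :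
    (a + d)%N = 4 %[mod 5] \/ (a + (d + d))%N = 4 %[mod 5] -> h`_a = 0 /\ h`_(a + d - s) = 0.
  move=> ad; have [aA|aA] := ltnP (a + d - s) A2; last first.
    by split; [apply: layer2_good|apply: hA].
  have /(pair a) : (a + d < A2 + s)%N by lia.
  move=> /(_ ad) h0; case: ad => [/layer2_d|/layer2_dd]; case: h0 => ->.
  - by rewrite add0r => ->.
  - by rewrite addr0 => ->.
  - by rewrite add0r => /double0 ->.
  - by rewrite mul0rn addr0 => ->.
move=> a.
have [a4|n4] := eqVneq (a %% 5)%N 4%N; first exact: h4.
have [ad|nd] := eqVneq ((a + d) %% 5)%N 4%N; first by have [] := H a (or_introl ad).
have [ad2|nd2] := eqVneq ((a + (d + d)) %% 5)%N 4%N; first by have [] := H a (or_intror ad2).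
(* If a + s >= d, then a is the upper member of the pair starting at a + s - d. *)
have [lt|ge] := ltnP (a + s) d; last first.
  have [|_] := H (a + s - d)%N; first by lia.
  by rewrite (_ : a + s - d + d - s = a)%N; last by lia.
have [ls|ls] := ltnP (a + s) A3; first by have := small a ls; lia.
have [as_|ns] := eqVneq ((a + s) %% 5)%N 4%N; first exact: layer2_s.
by apply: layer2_ds => //; lia.
Qed.

(* The third monomial X^t decouples the pair of coefficients a, a + d - s left
   undetermined by X^d + X^s. *)
Lemma layer2_t a : tau -> ((a + t) %% 5 = 4)%N -> (A3 <= a + t)%N -> (a + t < s)%N -> h`_a = 0.
Proof.
move=> tau1 at_ ge lt; have := h1 at_ ge; rewrite trinomial_mul shiftK tau1.
rewrite (@shift0 _ d) => [|?]; last by lia.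
rewrite (@shift0 _ s) => [|?]; last by lia.
by rewrite !add0r.
Qed.

(** The counterpart of [layer2_t] for f^2. The congruence t = 2d mod 5 places the coefficient met
    through X^(2s) among those killed by [layer2_good]. *)
Lemma layer2_dt a : tau -> ((a + (d + t)) %% 5 = 4)%N -> ((t + 3 * d) %% 5 = 0)%N ->
  (A3 <= a + t)%N -> (a + t < s)%N -> (A2 + s <= a + d)%N -> (A2 + 3 * s <= a + t + 2 * d)%N ->
  h`_a = 0.
Proof.
move=> tau1 at_ td ge lt ad ads; have := h2 at_; rewrite trinomial_sq_mul shiftK tau1.
rewrite (@shift0 _ (d + d)) => [|?]; last by lia.
rewrite (@shift0 _ (d + s)) => [|?]; last by lia.
rewrite (@shift0 _ (s + s)) => [|?]; last by apply: layer2_good; [left|]; lia.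
rewrite (@shift0 _ (s + t)) => [|_]; last by apply: hA; lia.
rewrite (@shift0 _ (t + t)) => [|_]; last by apply: hA; lia.
by rewrite !(mul0rn, addr0, add0r, mulr1n) => /(_ ltac:(lia)) /double0.
Qed.

(** Serves the degrees 9 and 18, treated with two monomials: X^(2s) isolates the lower member of the
    coupled pair. *)
Lemma layer2_ss a : ~~ tau -> ((a + (s + s)) %% 5 = 4)%N -> (d + A3 <= a + (s + s))%N ->
  (a + s < d)%N -> h`_a = 0.
Proof.
move=> /negPf tau0 as_ ge lt; have := h2 as_ ge; rewrite trinomial_sq_mul shiftK tau0.
rewrite (@shift0 _ (d + d)) => [|?]; last by lia.
rewrite (@shift0 _ (d + s)) => [|?]; last by lia.
by rewrite !(mul0rn, addr0, add0r, mulr0n).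
Qed.

End Layer2.

End PeelFive.

Lemma sum_mod5 N u : (\sum_(a < N) ((a + u) %% 5 == 4) = (N + u) %/ 5 - u %/ 5)%N.
Proof.
elim: N => [|N IH]; first by rewrite big_ord0 add0n subnn.
rewrite big_ord_recr /= IH; case: eqP; lia.
Qed.

Lemma sum_mod5_cut N s m d : (m <= d)%N -> (s %/ 5 <= m %/ 5)%N ->
  (\sum_(a < N) (((a + s) %% 5 == 4) && (m <= a + s < d)) = minn (N + s) d %/ 5 - m %/ 5)%N.
Proof.
move=> md sm; elim: N => [|N IH]; first by rewrite big_ord0; lia.
rewrite big_ord_recr /= IH.
by case: eqP => /=; case: leqP => /=; try case: ltnP => /=; lia.
Qed.

Section NullityFive.
Variables (k : closedFieldType) (d s t : nat) (tau : bool).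
Hypothesis ch5 : 5 \in [pchar k].
Notation f := (trinomial k d s t tau).
Notation A m := (m * d %/ 5)%N.

Lemma frob_part5 (F : {poly k}) (g : nat -> {poly k}) : g 4 = 0 ->
  [/\ frob_part 5 F g 3 = g 3, frob_part 5 F g 2 = g 2 - F * g 3 *+ 3,
      frob_part 5 F g 1 = g 1 - F * g 2 *+ 2 + F ^+ 2 * g 3 *+ 3 &
      frob_part 5 F g 0 = g 0 - F * g 1 + F ^+ 2 * g 2 - F ^+ 3 * g 3].
Proof.
move=> g4; split; rewrite /frob_part; do 5 rewrite big_ord_recr /=;
  rewrite big_ord0 g4 ?subnn ?subn0 ?subSS ?subn0 /binomial /=; ring.
Qed.

Lemma natr5_neq0 m : (0 < m < 5)%N -> (m%:R : k) != 0.
Proof.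
by move=> m5; rewrite -(dvdn_pcharf ch5); apply/negP => /dvdn_leq; lia.
Qed.

Lemma mulrn5_eq0 m (x : k) : (0 < m < 5)%N -> x *+ m = 0 -> x = 0.
Proof.
by move=> /natr5_neq0 m0; rewrite -mulr_natl => /eqP; rewrite mulf_eq0 (negPf m0) => /eqP.
Qed.

Definition layer3_trivial := forall h : {poly k},
  (forall a, (A 1 <= a)%N -> h`_a = 0) ->
  (forall e, (e %% 5 = 4)%N -> h`_e = 0) ->
  (forall e, (e %% 5 = 4)%N -> (A 2 <= e)%N -> (f * h)`_e = 0) ->
  (forall e, (e %% 5 = 4)%N -> (d + A 2 <= e)%N -> (f ^+ 2 * h)`_e = 0) ->
  forall a, h`_a = 0.

Definition layer2_trivial := forall h : {poly k},
  (forall a, (A 2 <= a)%N -> h`_a = 0) ->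
  (forall e, (e %% 5 = 4)%N -> h`_e = 0) ->
  (forall e, (e %% 5 = 4)%N -> (A 3 <= e)%N -> (f * h)`_e = 0) ->
  (forall e, (e %% 5 = 4)%N -> (d + A 3 <= e)%N -> (f ^+ 2 * h)`_e = 0) ->
  forall a, h`_a = 0.

Lemma trinomial_mul_high (h : {poly k}) N e : (s < d)%N -> (t < s)%N ->
  (forall a, (N <= a)%N -> h`_a = 0) -> (d + N <= e)%N -> (f * h)`_e = 0.
Proof.
move=> sd ts hN e0; rewrite trinomial_mul !shift0 ?mul0rn ?addr0 //;
  by move=> _; apply: hN; lia.
Qed.

(** Layers 3 and 2 are killed in turn by conditions at exponents beyond the reach of the lower
    layers: A(2) for f g3, d + A(2) for f^2 g3, and A(3), d + A(3) for g2. What remains is a count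
    in layers 1 and 0. *)
Lemma nullity5_le : (s < d)%N -> (t < s)%N -> (0 < s %% 5)%N -> (0 < d %% 5)%N ->
  (s %% 5 != d %% 5)%N -> (s %/ 5 <= A 4 %/ 5)%N -> (d <= A 3 + s)%N ->
  layer3_trivial -> layer2_trivial ->
  (nullity 5 d f + (A 3 %/ 5 + (d + A 3) %/ 5) <= A 3 + A 4)%N.
Proof.
move=> sd ts s5 d5 sd5 s4 ds L3 L2.
(* For e = 4 mod 5 the conditions at e determine the coefficient of g_1 at e, and
   that of g_0 at e if e < A 4, of g_1 at e - s if A 4 <= e < d, of g_1 at e - d
   if d <= e; P selects the remaining coefficients. *)
pose P i a := if i == 0%N then (a %% 5 != 4)%N else if i == 1%N then
   [&& (a %% 5 != 4)%N, ((a + d) %% 5 != 4)%N &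
      ~~ (((a + s) %% 5 == 4) && (A 4 <= a + s < d))%N] else false.
have sf : (size f <= d.+1)%N by rewrite size_trinomial.
have A4d : (A 4 <= d)%N by lia.
have := @nullity_le k 5 d isT f P sf.
set H := (X in (X -> _) -> _); have HH : H; last first.
  move=> /(_ HH); do 5 rewrite big_ord_recl /=; rewrite big_ord0 /P /=.
  rewrite [X in (_ + (_ + X))%N](_ : _ = 0%N) ?addn0; last first.
    by rewrite !big1.
  have c0 := @sum_mod5 (A 4) 0; have c1 := @sum_mod5 (A 3) 0.
  have c2 := @sum_mod5 (A 3) d; have c3 := @sum_mod5_cut (A 3) s (A 4) d A4d s4.
  have S0 : (\sum_(a < A 4) ((a %% 5 != 4) : nat) + \sum_(a < A 4) ((a + 0) %% 5 == 4) <= A 4)%N.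
    rewrite -big_split /= -[X in (_ <= X)%N]card_ord -sum1_card; apply: leq_sum => a _.
    by rewrite addn0; case: eqP.
  have S1 : (\sum_(a < A 3) (P 1%N a : nat) + (\sum_(a < A 3) ((a + 0) %% 5 == 4)
      + (\sum_(a < A 3) ((a + d) %% 5 == 4)
      + \sum_(a < A 3) (((a + s) %% 5 == 4) && (A 4 <= a + s < d)))) <= A 3)%N.
    rewrite -!big_split /= -[X in (_ <= X)%N]card_ord -sum1_card; apply: leq_sum => a _.
    rewrite /P /= addn0.
    move: (A 4 <= a + s < d)%N => b.
    case: eqVneq => a4; case: eqVneq => ad; case: eqVneq => as_; case: b => //=;
      move: a4 ad as_ s5 d5 sd5; clear; lia.
  (* With the minimum equal to d, the terms d/5 and A(4)/5 cancel between the counts. *)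
  move: S0 S1; rewrite c0 c1 c2 c3 /P /= (minn_idPr ds).
  move: (\sum_(_ < A 4) _)%N (\sum_(_ < A 3) _)%N => x y; lia.
move=> g gA gC gP.
have g4 : g 4 = 0.
  by apply/polyP => a; rewrite coef0; apply: gA.
have [E3 E2 E1 E0] := frob_part5 f g4.
have g3 : g 3 = 0.
  apply/polyP => a; rewrite coef0; apply: L3 a.
  - by move=> a; apply: (gA 3).
  - by move=> e e4; have := gC 3%N e isT e4; rewrite E3.
  - move=> e e4 Ae; have := gC 2%N e isT e4.
    by rewrite E2 coefB coefMn (gA 2) // sub0r => /eqP; rewrite oppr_eq0 => /eqP /mulrn5_eq0; apply.
  - move=> e e4 Ae; have := gC 1%N e isT e4.
    rewrite E1 coefD coefB !coefMn (gA 1%N) //; last by rewrite /=; lia.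
    rewrite (trinomial_mul_high sd ts (N := A 2)) //; last by move=> a; apply: (gA 2).
    by rewrite mul0rn subr0 add0r => /mulrn5_eq0; apply.
move: E2 E1 E0; rewrite g3 !(mulr0, mul0rn, subr0, addr0) => E2 E1 E0.
have g2 : g 2 = 0.
  apply/polyP => a; rewrite coef0; apply: L2 a.
  - by move=> a; apply: (gA 2).
  - by move=> e e4; have := gC 2%N e isT e4; rewrite E2.
  - move=> e e4 Ae; have := gC 1%N e isT e4.
    by rewrite E1 coefB coefMn (gA 1%N) // sub0r => /eqP; rewrite oppr_eq0 => /eqP /mulrn5_eq0; apply.
  - move=> e e4 Ae; have := gC 0%N e isT e4.
    rewrite E0 coefD coefB (gA 0%N) //; last by rewrite /=; lia.
    rewrite (trinomial_mul_high sd ts (N := A 3)) //; last by move=> a; apply: (gA 1%N).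
    by rewrite subr0 add0r.
move: E1 E0; rewrite g2 !(mulr0, mul0rn, subr0, addr0) => E1 E0.
have [z0 z1] : (forall a, (g 0%N)`_a = 0) /\ (forall a, (g 1%N)`_a = 0).
  apply: (@layer01_eq0 k d s t tau (A 3) (A 4)) => //.
  - by move=> a; apply: (gA 0%N).
  - by move=> a; apply: (gA 1%N).
  - by move=> e e4; have := gC 1%N e isT e4; rewrite E1.
  - by move=> e e4; have := gC 0%N e isT e4; rewrite E0 coefB => /eqP; rewrite subr_eq0 => /eqP.
  - by move=> a a4; apply: (gP 0%N).
  - by move=> a a4 ad as_; apply: (gP 1%N) => //; rewrite /P /= a4 ad as_.
by case=> [|[|[|[|[|i]]]]] a // _; rewrite ?g2 ?g3 ?g4 ?coef0.
Qed.

End NullityFive.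

Section ExponentsFive.
Variable k : closedFieldType.
Hypothesis ch5 : 5 \in [pchar k].

Definition small_nullity5 d s t (tau : bool) :=
  [/\ (s < d)%N, (tau -> t < s)%N & (nullity 5 d (trinomial k d s t tau) +
    ((3 * d %/ 5) %/ 5 + (d + 3 * d %/ 5) %/ 5) <= 3 * d %/ 5 + 4 * d %/ 5)%N].

(** Everything becomes linear arithmetic on exponents. The three alternatives for a coupled pair are
    those of [layer2_t], [layer2_dt] and [layer2_ss]. *)
Lemma small_nullity5_criterion d s t (tau : bool) :
  (d %% 5 != 0)%N -> (s %% 5 = (3 * d) %% 5)%N -> (s < d)%N -> (t < s)%N ->
  (1 * d %/ 5 + s <= d)%N -> (t + 2 * d %/ 5 <= s)%N -> (2 * d %/ 5 + 2 * s <= 2 * d)%N ->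
  (s %/ 5 <= 4 * d %/ 5 %/ 5)%N -> (d <= 3 * d %/ 5 + s)%N ->
  (forall a, (a + s < 3 * d %/ 5)%N ->
     (a + s) %% 5 != 4 /\ (a + (d + s)) %% 5 != 4)%N ->
  (forall a, (a + d < 2 * d %/ 5 + s)%N ->
     (a + d)%N = 4 %[mod 5] \/ (a + (d + d))%N = 4 %[mod 5] ->
     (exists2 b, b = (a + d - s)%N & tau /\ [/\ ((b + t) %% 5 = 4)%N, (3 * d %/ 5 <= b + t)%N
         & (b + t < s)%N])
     \/ (exists2 b, b = (a + d - s)%N & tau /\ [/\ ((b + (d + t)) %% 5 = 4)%N,
         ((t + 3 * d) %% 5 = 0)%N, (3 * d %/ 5 <= b + t)%N & (b + t < s)%N] /\
         (2 * d %/ 5 + s <= b + d)%N /\ (2 * d %/ 5 + 3 * s <= b + t + 2 * d)%N)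
     \/ [/\ ~~ tau, ((a + (s + s)) %% 5 = 4)%N, (d + 3 * d %/ 5 <= a + (s + s))%N & (a + s < d)%N]) ->
  small_nullity5 d s t tau.
Proof.
move=> d5 sd5 sd ts A1s tA2 A2s s4 ds small pair; split=> //.
have two0 : (2 : k) != 0 by apply: (@natr5_neq0 k ch5 2).
apply: nullity5_le => //; try by move: d5 sd5; clear; lia.
  move=> h hA h4 h1 h2; apply: (layer3_eq0 two0 d5 sd5 A1s tA2 _ hA h4 h1 h2).
  by apply: leq_div2r; rewrite leq_mul2r orbT.
move=> h hA h4 h1 h2.
have A3d : (3 * d %/ 5 <= d)%N by clear; lia.
apply: (layer2_eq0 two0 d5 sd5 sd tA2 A3d A2s hA h4 h1 h2 small) => a aA ad.
have [[b eb [tau1 [bt Ab bs]]]|[[b eb [tau1 [[bt td Ab bs] [b1 b2]]]]|[tau0 b1 b2 b3]]] := pair a aA ad.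
- by right; rewrite -eb; apply: (layer2_t two0 d5 sd5 sd tA2 A3d A2s h1 h2 tau1 bt Ab bs).
- right; rewrite -eb.
  by apply: (layer2_dt two0 d5 sd5 sd tA2 A3d A2s hA h1 h2 tau1 bt td Ab bs b1 b2).
- by left; apply: (layer2_ss two0 d5 sd5 sd tA2 A3d A2s h1 h2 tau0 b1 b2 b3).
Qed.

Local Ltac exponents := intros; apply: small_nullity5_criterion;
  match goal with |- forall a : nat, _ -> _ \/ _ -> _ => idtac | _ => try lia end;
  try (by move=> a; lia).
(** The outcomes for coupled pairs: none exists, or the third monomial isolates the upper member
    through f, or through f^2. *)
Local Ltac pair_none := move=> a aA ad; exfalso; lia.
Local Ltac pair_t := move=> a aA ad; left; eexists; [reflexivity|split=> //; split; lia].
Local Ltac pair_dt := move=> a aA ad; right; left; eexists; [reflexivity|split=> //; split;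
  split; lia].

(** Genus 0: there are no regular forms, so marking every coefficient still counts none. *)
Lemma small_nullity5_d1 : small_nullity5 1 0 0 false.
Proof.
split=> //; have sf : (size (trinomial k 1 0 0 false) <= 2)%N by rewrite size_trinomial.
have := @nullity_le k 5 1 isT _ (fun _ _ => true) sf.
set H := (X in (X -> _) -> _); have HH : H by move=> g _ _ + i a i5; apply.
move=> /(_ HH); do 5 rewrite big_ord_recl /=; rewrite !big_ord0 /= leqn0 => /eqP ->.
by [].
Qed.

(** Layer 3 is empty and layer 2 has a single coefficient, exposed by X^(2s) = X^4 in f^2. *)
Lemma small_nullity5_d3 : small_nullity5 3 2 0 false.
Proof.
split=> //; apply: nullity5_le => // h hA h4 h1 h2 a; first exact: hA.
case: a => [|a]; last exact: hA.
have := h2 4%N erefl isT; rewrite trinomial_sq_mul (shiftK _ h 0).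
by rewrite !mulr0n !addr0 /shift /= mul0rn !add0r.
Qed.

Lemma small_nullity5_d9 : small_nullity5 9 7 0 false.
Proof.
exponents; move=> a aA ad; right; right; rewrite (_ : a = 0)%N //; move: aA ad; clear; lia.
Qed.

Lemma small_nullity5_d18 : small_nullity5 18 14 0 false.
Proof.
exponents; move=> a aA ad; right; right; rewrite (_ : a = 1)%N //; move: aA ad; clear; lia.
Qed.

(* The exponents were found by computer search. *)
Lemma exists_small_nullity5 d : (d %% 5 != 0)%N -> exists s t tau, small_nullity5 d s t tau.
Proof.
move=> d5; have -> : d = (25 * (d %/ 25) + d %% 25)%N by rewrite mulnC -divn_eq.
have : ((d %% 25) %% 5 != 0)%N by move: d5; clear; lia.
have := ltn_pmod d (isT : 0 < 25)%N; move: (d %/ 25)%N (d %% 25)%N => q {d d5}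
  [|[|[|[|[|[|[|[|[|[|[|[|[|[|[|[|[|[|[|[|[|[|[|[|[|r]]]]]]]]]]]]]]]]]]]]]]]]] // _ _.
- case: (posnP q) => [->|q0]; first by exists 0%N, 0%N, false; apply: small_nullity5_d1.
  by exists (15 * q + 3)%N, 0%N, false; exponents; pair_none.
- by exists (15 * q + 1)%N, 0%N, false; exponents; pair_none.
- case: (posnP q) => [->|q0]; first by exists 2%N, 0%N, false; apply: small_nullity5_d3.
  by exists (15 * q + 4)%N, (5 * q + 1)%N, true; exponents; pair_dt.
- by exists (15 * q + 2)%N, 0%N, false; exponents; pair_none.
- by exists (15 * q + 3)%N, 0%N, false; exponents; pair_none.
- by exists (15 * q + 6)%N, (5 * q + 3)%N, true; exponents; pair_t.
- by exists (15 * q + 4)%N, 0%N, false; exponents; pair_none.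
- case: (posnP q) => [->|q0]; first by exists 7%N, 0%N, false; apply: small_nullity5_d9.
  by exists (15 * q + 7)%N, (5 * q + 3)%N, true; exponents; pair_dt.
- by exists (15 * q + 8)%N, 0%N, false; exponents; pair_none.
- by exists (15 * q + 6)%N, 0%N, false; exponents; pair_none.
- by exists (15 * q + 9)%N, 0%N, false; exponents; pair_none.
- by exists (15 * q + 7)%N, 0%N, false; exponents; pair_none.
- by exists (15 * q + 13)%N, (5 * q + 4)%N, true; exponents; pair_t.
- by exists (15 * q + 11)%N, 0%N, false; exponents; pair_none.
- case: (posnP q) => [->|q0]; first by exists 14%N, 0%N, false; apply: small_nullity5_d18.
  by exists (15 * q + 14)%N, (5 * q + 6)%N, true; exponents; pair_dt.
- by exists (15 * q + 12)%N, 0%N, false; exponents; pair_none.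
- by exists (15 * q + 13)%N, 0%N, false; exponents; pair_none.
- by exists (15 * q + 16)%N, (5 * q + 8)%N, true; exponents; pair_t.
- by exists (15 * q + 14)%N, 0%N, false; exponents; pair_none.
- by exists (15 * q + 12)%N, 0%N, false; exponents; pair_none.
Qed.

End ExponentsFive.

Lemma sum_mod3 N : (\sum_(a < N) (a %% 3 == 2) = N %/ 3)%N.
Proof.
elim: N => [|N IH]; first by rewrite big_ord0.
rewrite big_ord_recr /= IH; case: eqP; lia.
Qed.

(** * The case p = 3 *)

Section NullityThree.
Variables (k : closedFieldType) (d s : nat).
Notation f := (trinomial k d s 0 false).
Notation A m := (m * d %/ 3)%N.

Lemma frob_part3 (F : {poly k}) (g : nat -> {poly k}) : g 2 = 0 ->
  frob_part 3 F g 1 = g 1%N /\ frob_part 3 F g 0 = g 0%N - F * g 1%N.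
Proof.
move=> g2; split; rewrite /frob_part; do 3 rewrite big_ord_recr /=;
  rewrite big_ord0 g2 ?subnn ?subn0 ?subSS ?subn0 /binomial /=; ring.
Qed.

Definition layer1_trivial3 := forall h : {poly k},
  (forall a, (A 1 <= a)%N -> h`_a = 0) ->
  (forall e, (e %% 3 = 2)%N -> h`_e = 0) ->
  (forall e, (e %% 3 = 2)%N -> (A 2 <= e)%N -> (f * h)`_e = 0) ->
  forall a, h`_a = 0.

(** The shifts 0, d, s = 2d cover all residues mod 3, and [pair] excludes coupled coefficients, so a
    third monomial is never called for. *)
Lemma layer1_eq0 : (d %% 3 != 0)%N -> (s %% 3 = (2 * d) %% 3)%N ->
  (forall a, (a + s < A 2)%N -> (a + s) %% 3 != 2)%N ->
  (forall a, (a + d < A 1 + s)%N -> (a + d) %% 3 != 2)%N ->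
  layer1_trivial3.
Proof.
move=> d3 sd3 small pair h hA h2 h1.
have hd a : ((a + d) %% 3 = 2)%N -> h`_a = 0.
  move=> ad; have := h1 _ ad; rewrite trinomial_mul shiftK mulr0n addr0.
  rewrite (@shift0 _ s) => [|_]; last by apply: hA; have := pair a; move: ad; clear; lia.
  by rewrite addr0; apply; clear; lia.
move=> a.
have [a2|n2] := eqVneq (a %% 3)%N 2%N; first exact: h2.
have [ad|nd] := eqVneq ((a + d) %% 3)%N 2%N; first exact: hd.
have as_ : ((a + s) %% 3 = 2)%N by move: n2 nd d3 sd3; clear; lia.
have As : (A 2 <= a + s)%N by rewrite leqNgt; apply/negP => /small; rewrite as_.
have := h1 _ as_ As; rewrite trinomial_mul shiftK mulr0n addr0.
rewrite (@shift0 _ d) ?add0r // => ds.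
by apply: hd; rewrite subnK.
Qed.

Lemma nullity3_le : (s < d)%N -> layer1_trivial3 ->
  (nullity 3 d f + A 2 %/ 3 <= A 2)%N.
Proof.
move=> sd L1.
pose P i a := (i == 0%N) && (a %% 3 != 2)%N.
have sf : (size f <= d.+1)%N by rewrite size_trinomial.
have := @nullity_le k 3 d isT f P sf.
set H := (X in (X -> _) -> _); have HH : H; last first.
  move=> /(_ HH); do 3 rewrite big_ord_recl /=; rewrite big_ord0 /P /=.
  rewrite [X in (_ + X)%N](_ : _ = 0%N) ?addn0; last by rewrite !big1.
  have c0 := @sum_mod3 (A 2).
  have S0 : (\sum_(a < A 2) ((a %% 3 != 2) : nat) + \sum_(a < A 2) (a %% 3 == 2) <= A 2)%N.
    rewrite -big_split /= -[X in (_ <= X)%N]card_ord -sum1_card; apply: leq_sum => a _.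
    by case: eqP.
  by move: S0; rewrite c0; move: (\sum_(_ < A 2) _)%N => x; clear; lia.
move=> g gA gC gP.
have g2 : g 2 = 0.
  by apply/polyP => a; rewrite coef0; apply: gA.
have [E1 E0] := frob_part3 f g2.
have g1 : g 1%N = 0.
  apply/polyP => a; rewrite coef0; apply: L1 a.
  - by move=> a; apply: (gA 1%N).
  - by move=> e e2; have := gC 1%N e isT e2; rewrite E1.
  - move=> e e2 Ae; have := gC 0%N e isT e2.
    by rewrite E0 coefB (gA 0%N) // sub0r => /eqP; rewrite oppr_eq0 => /eqP.
move: E0; rewrite g1 mulr0 subr0 => E0.
case=> [|[|[|i]]] a // _; rewrite ?g1 ?g2 ?coef0 //.
have [a2|n2] := eqVneq (a %% 3)%N 2%N; last by apply: gP.
by have := gC 0%N a isT a2; rewrite E0.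
Qed.

End NullityThree.

Section ExponentsThree.
Variable k : closedFieldType.

Definition small_nullity3 d s :=
  (s < d)%N /\ (nullity 3 d (trinomial k d s 0 false) + (2 * d %/ 3) %/ 3 <= 2 * d %/ 3)%N.

Lemma small_nullity3_criterion d s :
  (d %% 3 != 0)%N -> (s %% 3 = (2 * d) %% 3)%N -> (s < d)%N ->
  (forall a, (a + s < 2 * d %/ 3)%N -> (a + s) %% 3 != 2)%N ->
  (forall a, (a + d < 1 * d %/ 3 + s)%N -> (a + d) %% 3 != 2)%N ->
  small_nullity3 d s.
Proof.
by move=> d3 sd3 sd small pair; split=> //; apply: nullity3_le => //; apply: layer1_eq0.
Qed.

Local Ltac exponents := intros; apply: small_nullity3_criterion; try lia; by move=> a; lia.

Lemma small_nullity3_d1 : small_nullity3 1 0.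
Proof.
split=> //; apply: nullity3_le => // h hA h4 h1 a; exact: hA.
Qed.

Lemma exists_small_nullity3 d : (d %% 3 != 0)%N -> exists s, small_nullity3 d s.
Proof.
move=> d3; have -> : d = (9 * (d %/ 9) + d %% 9)%N by rewrite mulnC -divn_eq.
have : ((d %% 9) %% 3 != 0)%N by move: d3; clear; lia.
have := ltn_pmod d (isT : 0 < 9)%N; move: (d %/ 9)%N (d %% 9)%N => q {d d3}
  [|[|[|[|[|[|[|[|[|r]]]]]]]]] // _ _.
- case: (posnP q) => [->|q0]; first by exists 0%N; apply: small_nullity3_d1.
  by exists (6 * q + 2)%N; exponents.
- by exists (6 * q + 1)%N; exponents.
- by exists (6 * q + 2)%N; exponents.
- by exists (6 * q + 4)%N; exponents.
- by exists (6 * q + 5)%N; exponents.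
- by exists (6 * q + 4)%N; exponents.
Qed.

End ExponentsThree.

Lemma exists_small_nullity (k : closedFieldType) p d :
  p = 3%N \/ p = 5%N -> p \in [pchar k] -> ~~ (p %| d)%N ->
  exists (s t : nat) (tau : bool) (j0 : nat), [/\ (s < d)%N, tau -> (t < s)%N, (1 <= j0 < p)%N &
    (nullity p d (trinomial k d s t tau) + \sum_(j0 <= m < p) cond_bound p d j0 m
      <= \sum_(j0 <= m < p) (m * d %/ p))%N].
Proof.
case=> -> ch pd.
  have [s [sd le]] := exists_small_nullity3 k pd.
  by exists s, 0%N, false, 2; split=> //; rewrite !big_nat1 /cond_bound subnn mul0n add0n.
have [s [t [tau [sd ts le]]]] := exists_small_nullity5 ch pd.
exists s, t, tau, 3; split=> //.
by rewrite !(@big_nat_recr _ _ _ 4) // !big_nat1 /cond_bound subnn mul0n add0n mul1n.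
Qed.

(** A solution would have a pole at infinity, whose order times p would be n. *)
Lemma as_no_root (k : closedFieldType) p (f : {poly k}) n : prime p -> p \in [pchar k] ->
  size f = n.+1 -> (0 < n)%N -> ~~ (p %| n)%N ->
  forall y : P1 k, y ^+ p - y != (tofrac f : P1 k).
Proof.
move=> p_pr ch sf n0 pn y; apply/eqP => yf.
have f0 : (tofrac f : P1 k) != 0 by rewrite tofrac_eq0 -size_poly_gt0 sf.
have vf := deg_place_f sf.
have vneg : ~~ vge (deg_place k) 0 (tofrac f : P1 k).
  by rewrite vgeE // vf -ltNge oppr_lt0 ltz_nat.
have y0 : y != 0.
  by apply: contraNneq vneg => y0; rewrite -yf y0 expr0n gtn_eqF ?prime_gt0 // subrr vge_0.
have yneg : deg_place k y < 0.
  rewrite ltNge; apply: contra vneg => yp; rewrite -yf.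
  by apply: vgeD; [apply: vge0X|rewrite vgeN]; rewrite vgeE.
have [_] := val_as_neg p_pr (pchar_P1 ch) y0 yneg.
rewrite yf vf => /eqP; rewrite eqr_oppLR => /eqP e; case/negP: pn.
have : (p%:Z %| n%:Z)%Z by rewrite e -mulrN dvdz_mulr.
by [].
Qed.

Theorem theorem1p2 (p : nat) (k : closedFieldType) (d : nat) :
  p = 3%N \/ p = 5%N -> p \in [pchar k] -> (0 < d)%N -> ~~ (p %| d)%N ->
  exists n : nat,
    [/\ n%:Z = L_bound p d,
        exists2 f : {poly 'F_p}, size f = d.+1 &
          (exists Y : fieldExtType (P1 k), artin_schreier_curve p (from_Fp k f) Y)
          /\ (forall Y : fieldExtType (P1 k),
                artin_schreier_curve p (from_Fp k f) Y ->
                a_number (cover_const Y) p n) &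
        minimal_a_number k p d n].
Proof.
move=> p35 ch d0 pd.
have p_pr : prime p by case: p35 => ->.
have [s [t [tau [j0 [sd ts j0p le]]]]] := exists_small_nullity p35 ch pd.
pose f := trinomial k d s t tau.
have sf : size f = d.+1 by apply: size_trinomial.
have fE : from_Fp k (trinomial 'F_p d s t tau) = f by apply: from_Fp_trinomial.
have [Y0 [y0 [Hy0 dimY0 genY0]]] :=
  exists_as_ext p_pr (pchar_P1 ch) (as_no_root p_pr ch sf d0 pd).
exists (nullity p d f); split.
- apply: (L_bound_eq p_pr j0p) le => j jp.
  by apply: (nullity_ge p_pr _ jp); rewrite sf.
- exists (trinomial 'F_p d s t tau); first by apply: size_trinomial.
  rewrite fE; split; first by exists Y0; split=> //; exists y0.
  by move=> Y [dimY [y [Hy genY]]]; apply: (a_number_nullity p_pr ch p35 Hy dimY genY sf d0 pd).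
- split.
    exists Y0; split.
    + exact: (affine_Zp_cover p_pr ch Hy0 dimY0 genY0).
    + exact: (affine_one_branch_point p_pr ch Hy0 dimY0 genY0 sf d0 pd).
    + exact: (a_number_nullity p_pr ch p35 Hy0 dimY0 genY0 sf d0 pd).
  move=> Y m cov obp am.
  have [g sg gm] := cover_lower_bound p_pr ch cov obp am.
  apply: leq_trans gm.
  (* The sums at j0 bound the nullity of g from below and that of the trinomial from above, so the
     two nullities can be compared. *)
  have ge : (\sum_(j0 <= m < p) (m * d %/ p) <=
      nullity p d g + \sum_(j0 <= m < p) cond_bound p d j0 m)%N.
    by apply: (nullity_ge p_pr _ j0p); rewrite sg.
  by rewrite -(leq_add2r (\sum_(j0 <= m < p) cond_bound p d j0 m)); apply: leq_trans le ge.
Qed.
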